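(* (PBW theorem in the $N$-case) Let $k$ be a von Neumann regular ring, $V$ a $k$-$k$-bimodule, $N\geq 2$ an integer, and $P$ a sub-$k$-$k$-bimodule of $F^N$, where $F^n=\bigoplus_{0\leq i\leq n}V^{\otimes i}$ for $n\geq 0$. Set $U=T(V)/I(P)$ and $A=T(V)/I(R)$, where $R=\pi(P)$ and $\pi$ is the projection of $F^N$ onto $V^{\otimes N}$ modulo $F^{N-1}$. Assume that the graded left $k$-module $\mathrm{Tor}_3^A(k_A,{}_Ak)$ is concentrated in degree $N+1$. Then the conditions $$P\cap F^{N-1}=0,\qquad (PV+VP)\cap F^N\subseteq P$$ imply that the PBW property holds, i.e. the natural algebra morphism $A\to \mathrm{gr}(U)$ is an isomorphism.
   Context: A (unital, possibly non-commutative) ring $k$ is von Neumann regular if for every $x\in k$ there is $y\in k$ with $xyx=x$. Tensor powers $V^{\otimes n}$ are taken over $k$, with $V^{\otimes 0}=k$, and $T(V)=\bigoplus_{n\ge0}V^{\otimes n}$. For sub-$k$-$k$-bimodules $E,F$ of $T(V)$, $EF$ is the sub-$k$-$k$-bimodule of finite sums of products $ab$, $a\in E$, $b\in F$; $I(E)$ is the two-sided ideal of $T(V)$ generated by $E$. The ring $A$ is $\mathbb{N}$-graded ($V$ in degree $1$), with $A_n=V^{\otimes n}/I(R)_n$, $I(R)_n=\sum_{i+N+j=n}V^{\otimes i}RV^{\otimes j}$. The projection $A\to A_0=k$ makes $k$ an $A$-$A$-bimodule; ${}_Ak$ and $k_A$ are the associated left and right modules. $\mathrm{Tor}_n^A(k_A,{}_Ak)$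 is a graded left $k$-module, computed from graded (flat) resolutions of ${}_Ak$ by graded left $A$-modules. The ring $U$ is filtered by $U^n=F^n/(I(P)\cap F^n)$, and $\mathrm{gr}(U)$ is the associated graded ring, $\mathrm{gr}(U)_n=U^n/U^{n-1}\cong F^n/(I(P)\cap F^n+F^{n-1})$. The natural maps $V^{\otimes n}\to F^n\to F^n/(I(P)\cap F^n+F^{n-1})$ form a surjective graded ring morphism $T(V)\to\mathrm{gr}(U)$ that vanishes on $R$; the induced surjective morphism $A\to\mathrm{gr}(U)$ is the natural algebra morphism of the statement. *)

(* Defs.v *)
From HB Require Import structures.
From mathcomp Require Import all_boot ssralg ssrint generic_quotient ring_quotient.
From mathcomp Require Import boolp classical_sets.
From mathcomp.multinomials Require Import freeg.

Set Implicit Arguments.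
Unset Strict Implicit.
Unset Printing Implicit Defensive.

Import GRing.Theory.
Local Open Scope classical_set_scope.
Local Open Scope ring_scope.

Definition von_neumann_regular (k : pzRingType) : Prop :=
  forall x : k, exists y : k, x * y * x = x.

Definition subgroup (G : zmodType) (H : set G) : Prop :=
  H 0 /\ forall x y, H x -> H y -> H (x - y).

Definition span (G : zmodType) (S : set G) : set G := smallest (@subgroup G) S.

Lemma span_subgroup (G : zmodType) (S : set G) : subgroup (span S).
Proof.
split=> [H [[]] //|x y Sx Sy H [Hg SH]].
by apply: Hg.2; [apply: Sx | apply: Sy].
Qed.

Lemma sub_span (G : zmodType) (S : set G) : S `<=` span S.
Proof. exact: sub_gen_smallest. Qed.

Lemma span_min (G : zmodType) (S H : set G) :
  subgroup H -> S `<=` H -> span S `<=` H.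
Proof. by move=> gH SH; apply: smallest_sub. Qed.

Lemma span_id (G : zmodType) (H : set G) : subgroup H -> span H = H.
Proof. exact: smallest_id. Qed.

Section SubgroupTheory.
Variables (G : zmodType) (H : set G) (gH : subgroup H).
Lemma subgroup0 : H 0. Proof. exact: gH.1. Qed.
Lemma subgroupB x y : H x -> H y -> H (x - y). Proof. exact: gH.2. Qed.
Lemma subgroupN x : H x -> H (- x).
Proof. by rewrite -sub0r; apply: subgroupB subgroup0. Qed.
Lemma subgroupD x y : H x -> H y -> H (x + y).
Proof. by move=> Hx /subgroupN; rewrite -{2}[y]opprK; apply: subgroupB. Qed.
Lemma subgroup_sum I (r : seq I) (F : I -> G) :
  (forall i, H (F i)) -> H (\sum_(i <- r) F i).
Proof.
move=> HF; elim/big_ind: _ => //; [exact: subgroup0 | exact: subgroupD].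
Qed.
End SubgroupTheory.

Definition span_pred (G : zmodType) (S : set G) : {pred G} :=
  fun x => `[< span S x >].

Lemma span_predE (G : zmodType) (S : set G) x : x \in span_pred S <-> span S x.
Proof. by rewrite unfold_in /span_pred asboolE. Qed.

Fact span_zmod_closed (G : zmodType) (S : set G) : zmod_closed (span_pred S).
Proof.
split=> [|x y /span_predE Sx /span_predE Sy]; apply/span_predE.
  exact: subgroup0 (span_subgroup S).
exact: subgroupB (span_subgroup S) _ _ Sx Sy.
Qed.

HB.instance Definition _ (G : zmodType) (S : set G) :=
  GRing.isZmodClosed.Build G (span_pred S) (span_zmod_closed S).

(** [zquot S] is [G] modulo the subgroup generated by [S]. *)
Definition zquot (G : zmodType) (S : set G) : zmodType :=
  Quotient.quot (span_pred S).

Definition zpi (G : zmodType) (S : set G) : G -> zquot S :=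
  \pi_(Quotient.quot (span_pred S))%qT.

Definition zrepr (G : zmodType) (S : set G) (c : zquot S) : G :=
  repr (c : Quotient.quot (span_pred S)).

Section ZquotTheory.
Variables (G : zmodType) (S : set G).

Fact zpi_zmod_morphism : zmod_morphism (@zpi G S).
Proof. by move=> x y; rewrite /zpi raddfB. Qed.
HB.instance Definition _ :=
  GRing.isZmodMorphism.Build G (zquot S) (@zpi G S) zpi_zmod_morphism.

Lemma zreprK (c : zquot S) : zpi S (zrepr c) = c.
Proof. exact: reprK. Qed.

Lemma zpi_eq x y : zpi S x = zpi S y <-> span S (x - y).
Proof.
have E := Quotient.idealrBE (span_pred S : zmodClosed G) x y.
rewrite -span_predE; split=> [xy|xy].
  by rewrite E; apply/eqP.
by apply/eqP; rewrite -E.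
Qed.

Lemma zpi_eq0 x : zpi S x = 0 <-> span S x.
Proof. by rewrite -(raddf0 (zpi S)) zpi_eq subr0. Qed.

Lemma zreprP x : span S (zrepr (zpi S x) - x).
Proof. by apply/zpi_eq; rewrite zreprK. Qed.

End ZquotTheory.

Record subz (G : zmodType) (S : set G) := Subz {
  subz_val :> G;
  subz_valP : subz_val \in span_pred S }.

HB.instance Definition _ (G : zmodType) (S : set G) :=
  [isSub for @subz_val G S].
HB.instance Definition _ (G : zmodType) (S : set G) :=
  [Choice of subz S by <:].
HB.instance Definition _ (G : zmodType) (S : set G) :=
  [SubChoice_isSubZmodule of subz S by <:].

(** [subquot Z B] is Z / (Z \cap B) for subgroups [Z] and [B] of [G]. *)
Definition subquot (G : zmodType) (Z B : set G) : zmodType :=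
  zquot [set z : subz Z | span B (subz_val z)].

(** The class in [subquot Z B] of an element of [Z] (0 outside [Z]). *)
Definition sqclass (G : zmodType) (Z B : set G) (x : G) : subquot Z B :=
  zpi _ (insubd (0 : subz Z) x).

Section Tensor.
Variables (R : Type) (M N : zmodType).
Variables (ra : M -> R -> M) (la : R -> N -> N).

Inductive tens_rel : {freeg (M * N)%type} -> Prop :=
| TensDl m m' n : tens_rel (<< (m + m', n) >> - << (m, n) >> - << (m', n) >>)
| TensDr m n n' : tens_rel (<< (m, n + n') >> - << (m, n) >> - << (m, n') >>)
| TensA m r n : tens_rel (<< (ra m r, n) >> - << (m, la r n) >>).

Definition tprod : zmodType := zquot tens_rel.

Definition tens (m : M) (n : N) : tprod := zpi tens_rel << (m, n) >>.

Lemma tensDl m m' n : tens (m + m') n = tens m n + tens m' n.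
Proof.
rewrite /tens -raddfD; apply/zpi_eq; apply: sub_span; rewrite opprD addrA.
exact: TensDl.
Qed.

Lemma tensDr m n n' : tens m (n + n') = tens m n + tens m n'.
Proof.
rewrite /tens -raddfD; apply/zpi_eq; apply: sub_span; rewrite opprD addrA.
exact: TensDr.
Qed.

Lemma tens_bal m r n : tens (ra m r) n = tens m (la r n).
Proof. by apply/zpi_eq; apply: sub_span; apply: TensA. Qed.

Lemma tens0l n : tens 0 n = 0.
Proof. by apply: (@addrI _ (tens 0 n)); rewrite -tensDl !addr0. Qed.

Lemma tens0r m : tens m 0 = 0.
Proof. by apply: (@addrI _ (tens m 0)); rewrite -tensDr !addr0. Qed.

Lemma tens_ind (H : set tprod) :
  subgroup H -> (forall m n, H (tens m n)) -> forall t, H t.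
Proof.
move=> gH Hmn t; rewrite -[t]zreprK -[zrepr t]freeg_sumE raddf_sum /=.
apply: subgroup_sum => // z; rewrite -(intz (coeff z _)) -freegU_mulz.
rewrite raddfMz.
have Hz : H (zpi tens_rel << z >>) by case: z => m n; apply: Hmn.
have HM j : H (zpi tens_rel << z >> *+ j).
  by elim: j => [|j IH]; rewrite ?mulrS; [exact: subgroup0 | apply: subgroupD].
by case: (coeff z _) => j; [exact: HM | apply: subgroupN => //; exact: HM].
Qed.

(** The additive extension of [f] to formal sums, and the map it induces on the
    tensor product when [f] is balanced. *)
Definition fgsum (G : zmodType) (f : M -> N -> G) (D : {freeg (M * N)%type}) : G :=
  fglift (fun p => f p.1 p.2 : zmodule G) D.

Definition tlift (G : zmodType) (f : M -> N -> G) (t : tprod) : G :=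
  fgsum f (zrepr t).

Definition balanced (G : zmodType) (f : M -> N -> G) : Prop :=
  [/\ forall m m' n, f (m + m') n = f m n + f m' n,
      forall m n n', f m (n + n') = f m n + f m n'
    & forall m r n, f (ra m r) n = f m (la r n)].

Section Lift.
Variables (G : zmodType) (f : M -> N -> G) (bf : balanced f).

Fact fgsumB x y : fgsum f (x - y) = fgsum f x - fgsum f y.
Proof. exact: (@lift_is_additive _ _ (zmodule G) (fun p => f p.1 p.2)). Qed.

Fact fgsum1 p : fgsum f << p >> = f p.1 p.2.
Proof. by rewrite /fgsum liftU scale1r. Qed.

Fact fgsum_rel D : span tens_rel D -> fgsum f D = 0.
Proof.
apply: (@span_min _ _ [set D | fgsum f D = 0]).
  have F0 : fgsum f 0 = 0 by have := fgsumB 0 0; rewrite !subrr.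
  by split=> // x y /= Fx Fy; rewrite fgsumB Fx Fy subrr.
case: bf => fl fr fb _ [a b c|a b c|a b c] /=; rewrite !fgsumB !fgsum1 /=.
- by rewrite fl addrAC addrK subrr.
- by rewrite fr addrAC addrK subrr.
- by rewrite fb subrr.
Qed.

Lemma tlift_zmod_morphism : zmod_morphism (tlift f).
Proof.
move=> x y; apply/eqP; rewrite -subr_eq0 -!fgsumB; apply/eqP/fgsum_rel/zpi_eq0.
by rewrite raddfB (raddfB (zpi tens_rel) (zrepr x)) /= !zreprK subrr.
Qed.

Lemma tliftE m n : tlift f (tens m n) = f m n.
Proof.
rewrite -[RHS](fgsum1 (m, n)); apply/eqP; rewrite -subr_eq0 -fgsumB.
by apply/eqP/fgsum_rel; apply: zreprP.
Qed.

End Lift.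
End Tensor.

Lemma tens_eq (R : Type) (M N G : zmodType) (ra : M -> R -> M) (la : R -> N -> N)
    (f g : tprod ra la -> G) :
  zmod_morphism f -> zmod_morphism g ->
  (forall m n, f (tens ra la m n) = g (tens ra la m n)) -> f =1 g.
Proof.
move=> fB gB fg; apply: tens_ind => //.
split=> [|x y /= fx fy]; last by rewrite fB gB fx fy.
by have := fB 0 0; have := gB 0 0; rewrite !subrr => -> ->.
Qed.

Lemma zmod_morphD (G H : zmodType) (f : G -> H) :
  zmod_morphism f -> {morph f : x y / x + y}.
Proof.
move=> fB x y; have f0 : f 0 = 0 by have := fB 0 0; rewrite !subrr.
by rewrite -{1}[y]opprK fB -[- y]sub0r fB f0 sub0r opprK.
Qed.

Definition tmap (R : Type) (M N M' N' : zmodType)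
    (ra : M -> R -> M) (la : R -> N -> N)
    (ra' : M' -> R -> M') (la' : R -> N' -> N') (f : M -> M') (g : N -> N') :
    tprod ra la -> tprod ra' la' :=
  tlift (fun m n => tens ra' la' (f m) (g n)).
Arguments tmap {R M N M' N'} ra la ra' la' f g t.

HB.mixin Record Lmodule_isBimodule (k : pzRingType) V of GRing.Lmodule k V := {
  ract : V -> k -> V;
  ractDl : forall u v a, ract (u + v) a = ract u a + ract v a;
  ractDr : forall u a b, ract u (a + b) = ract u a + ract u b;
  ractA : forall u a b, ract (ract u a) b = ract u (a * b);
  ract1 : forall u, ract u 1 = u;
  ractZ : forall a u b, ract (a *: u) b = a *: ract u b
}.

#[short(type="bimodType")]
HB.structure Definition Bimodule (k : pzRingType) :=
  {V of Lmodule_isBimodule k V & GRing.Lmodule k V}.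

HB.instance Definition _ (k : pzRingType) :=
  Lmodule_isBimodule.Build k k^o
    (ract := fun x a => x * a)
    (fun u v a => mulrDl u v a) (fun u a b => mulrDr u a b)
    (fun u a b => esym (mulrA u a b)) (fun u => mulr1 u)
    (fun a u b => esym (mulrA a u b)).

Section BimoduleTensor.
Variables (k : pzRingType) (V W : bimodType k).

Definition btens : Type := tprod (@ract k V) (@GRing.scale k W).
HB.instance Definition _ := GRing.Zmodule.on btens.

Local Notation tn := (tens (@ract k V) (@GRing.scale k W)).

Definition btens_scale (a : k) (t : btens) : btens :=
  tlift (fun v w => tn (a *: v) w) t.
Definition btens_ract (t : btens) (a : k) : btens :=
  tlift (fun v w => tn v (ract w a)) t.

Fact btens_scale_bal a : balanced (@ract k V) (@GRing.scale k W)
  (fun v w => tn (a *: v) w).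
Proof.
split=> [m m' n|m n n'|m r n]; first by rewrite scalerDr tensDl.
  by rewrite tensDr.
by rewrite -ractZ tens_bal.
Qed.

Fact btens_ract_bal a : balanced (@ract k V) (@GRing.scale k W)
  (fun v w => tn v (ract w a)).
Proof.
split=> [m m' n|m n n'|m r n]; first by rewrite tensDl.
  by rewrite ractDl tensDr.
by rewrite tens_bal ractZ.
Qed.

Lemma btens_ind (H : btens -> Prop) :
  (forall v w, H (tn v w)) -> (forall s t, H s -> H t -> H (s - t)) ->
  forall t, H t.
Proof.
move=> Hp HB; apply: tens_ind => //; split=> //.
by have := HB _ _ (Hp 0 0) (Hp 0 0); rewrite subrr.
Qed.

Lemma btens_scaleE a v w : btens_scale a (tn v w) = tn (a *: v) w.
Proof. exact: tliftE (btens_scale_bal a) v w. Qed.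
Lemma btens_ractE a v w : btens_ract (tn v w) a = tn v (ract w a).
Proof. exact: tliftE (btens_ract_bal a) v w. Qed.
Fact btens_scaleB a : zmod_morphism (btens_scale a).
Proof. exact: tlift_zmod_morphism (btens_scale_bal a). Qed.
Fact btens_ractB a : zmod_morphism (btens_ract^~ a).
Proof. exact: tlift_zmod_morphism (btens_ract_bal a). Qed.

HB.instance Definition _ a :=
  GRing.isZmodMorphism.Build btens btens (btens_scale a) (btens_scaleB a).

Fact btens_scaleA a b t : btens_scale a (btens_scale b t) = btens_scale (a * b) t.
Proof.
elim/btens_ind: t => [v w|s t IHs IHt]; last by rewrite !raddfB /= IHs IHt.
by rewrite !btens_scaleE scalerA.
Qed.
Fact btens_scale1 t : btens_scale 1 t = t.
Proof.
elim/btens_ind: t => [v w|s t IHs IHt]; last by rewrite !raddfB /= IHs IHt.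
by rewrite !btens_scaleE scale1r.
Qed.
Fact btens_scaleDr : right_distributive btens_scale +%R.
Proof. by move=> a s t; rewrite raddfD. Qed.
Fact btens_scaleDl t : {morph btens_scale^~ t : a b / a + b}.
Proof.
move=> a b; elim/btens_ind: t => [v w|s t IHs IHt].
  by rewrite !btens_scaleE scalerDl tensDl.
by rewrite /= in IHs IHt *; rewrite !raddfB /= IHs IHt addrACA -opprD.
Qed.
HB.instance Definition _ := GRing.Zmodule_isLmodule.Build k btens
  btens_scaleA btens_scale1 btens_scaleDr btens_scaleDl.

Fact btens_ractDl s t a : btens_ract (s + t) a = btens_ract s a + btens_ract t a.
Proof. exact: zmod_morphD (btens_ractB a) s t. Qed.
Fact btens_ractDr t a b : btens_ract t (a + b) = btens_ract t a + btens_ract t b.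
Proof.
elim/btens_ind: t => [v w|s t IHs IHt].
  by rewrite !btens_ractE ractDr tensDr.
by rewrite !btens_ractB IHs IHt addrACA -opprD.
Qed.
Fact btens_ractA t a b : btens_ract (btens_ract t a) b = btens_ract t (a * b).
Proof.
elim/btens_ind: t => [v w|s t IHs IHt]; last by rewrite !btens_ractB IHs IHt.
by rewrite !btens_ractE ractA.
Qed.
Fact btens_ract1 t : btens_ract t 1 = t.
Proof.
elim/btens_ind: t => [v w|s t IHs IHt]; last by rewrite !btens_ractB IHs IHt.
by rewrite !btens_ractE ract1.
Qed.
Fact btens_ractZ a t b : btens_ract (a *: t) b = a *: btens_ract t b.
Proof.
rewrite /GRing.scale /=; elim/btens_ind: t => [v w|s t IHs IHt].
  by rewrite !(btens_scaleE, btens_ractE).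
by rewrite !(btens_scaleB, btens_ractB) IHs IHt.
Qed.
HB.instance Definition _ := Lmodule_isBimodule.Build k btens
  btens_ractDl btens_ractDr btens_ractA btens_ract1 btens_ractZ.

End BimoduleTensor.

(** [tpow V n] is the n-th tensor power of [V] over [k], nested to the right and
    ending in [k]; in particular [tpow V 1] is V (x) k, identified with [V]. *)
Fixpoint tpow (k : pzRingType) (V : bimodType k) (n : nat) : bimodType k :=
  if n is m.+1 then btens V (tpow V m) else k^o.

Definition gcast (G : nat -> zmodType) m n (e : m = n) (x : G m) : G n :=
  ecast i (G i) e x.

Record gradedRing := GradedRing {
  gcomp :> nat -> zmodType;
  gone : gcomp 0%N;
  gmul : forall m n, gcomp m -> gcomp n -> gcomp (m + n)%N;
  gmulDl : forall m n (x y : gcomp m) (z : gcomp n),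
    gmul (x + y) z = gmul x z + gmul y z;
  gmulDr : forall m n (x : gcomp m) (y z : gcomp n),
    gmul x (y + z) = gmul x y + gmul x z;
  gmul1l : forall n (x : gcomp n), gcast (add0n n) (gmul gone x) = x;
  gmul1r : forall n (x : gcomp n), gcast (addn0 n) (gmul x gone) = x;
  gmulA : forall m n p (x : gcomp m) (y : gcomp n) (z : gcomp p),
    gcast (addnA m n p) (gmul x (gmul y z)) = gmul (gmul x y) z
}.

Record dsum (G : nat -> zmodType) := DSum {
  dcomp :> forall n, G n;
  dcompP : exists N, forall n, (N <= n)%N -> dcomp n = 0
}.

HB.instance Definition _ G := gen_eqMixin (dsum G).
HB.instance Definition _ G := gen_choiceMixin (dsum G).

Section DsumZmodule.
Variable G : nat -> zmodType.
Implicit Types x y z : dsum G.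

Lemma dsumP x y : (forall n, x n = y n) -> x = y.
Proof.
case: x y => [x xP] [y yP] /= xy; have {}xy : x = y by apply: functional_extensionality_dep.
by case: _ / xy in yP *; congr DSum; apply: Prop_irrelevance.
Qed.

Fact dzero_fin : exists N, forall n, (N <= n)%N -> (0 : G n) = 0.
Proof. by exists 0%N. Qed.
Definition dzero : dsum G := DSum dzero_fin.

Fact dopp_fin x : exists N, forall n, (N <= n)%N -> - x n = 0.
Proof. by case: (dcompP x) => N xN; exists N => n /xN ->; rewrite oppr0. Qed.
Definition dopp x : dsum G := DSum (dopp_fin x).

Fact dadd_fin x y : exists N, forall n, (N <= n)%N -> x n + y n = 0.
Proof.
case: (dcompP x) (dcompP y) => N xN [M yM]; exists (maxn N M) => n.
by rewrite geq_max => /andP[/xN -> /yM ->]; rewrite addr0.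
Qed.
Definition dadd x y : dsum G := DSum (dadd_fin x y).

Fact daddA : associative dadd.
Proof. by move=> x y z; apply: dsumP => n; apply: addrA. Qed.
Fact daddC : commutative dadd.
Proof. by move=> x y; apply: dsumP => n; apply: addrC. Qed.
Fact dadd0 : left_id dzero dadd.
Proof. by move=> x; apply: dsumP => n; apply: add0r. Qed.
Fact daddN : left_inverse dzero dopp dadd.
Proof. by move=> x; apply: dsumP => n; apply: addNr. Qed.

HB.instance Definition _ :=
  GRing.isZmodule.Build (dsum G) daddA daddC dadd0 daddN.

Lemma dcomp0 n : (0 : dsum G) n = 0. Proof. by []. Qed.
Lemma dcompD x y n : (x + y) n = x n + y n. Proof. by []. Qed.
Lemma dcompN x n : (- x) n = - x n. Proof. by []. Qed.
Lemma dcompB x y n : (x - y) n = x n - y n. Proof. by []. Qed.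
Lemma dcomp_sum I (r : seq I) (F : I -> dsum G) n :
  (\sum_(i <- r) F i) n = \sum_(i <- r) F i n.
Proof. exact: (big_morph (fun x : dsum G => x n)). Qed.

Definition dinj_fun n (x : G n) (m : nat) : G m :=
  if @eqP _ n m is ReflectT e then gcast e x else 0.
Fact dinj_fin n (x : G n) :
  exists N, forall m, (N <= m)%N -> dinj_fun x m = 0.
Proof.
exists n.+1 => m nm; rewrite /dinj_fun; case: eqP => // e.
by rewrite e ltnn in nm.
Qed.
Definition dinj n (x : G n) : dsum G := DSum (dinj_fin x).

Lemma dinj_id n (x : G n) : dinj x n = x.
Proof.
by rewrite /dinj /= /dinj_fun; case: eqP => // e; rewrite (eq_irrelevance e erefl).
Qed.
Lemma dinj_neq n (x : G n) m : n != m -> dinj x m = 0.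
Proof. by rewrite /dinj /= /dinj_fun; case: eqP. Qed.

Fact dinjB n : zmod_morphism (@dinj n).
Proof.
move=> x y; apply: dsumP => m; rewrite dcompB.
have [<-|nm] := eqVneq n m; first by rewrite !dinj_id.
by rewrite !dinj_neq ?subr0.
Qed.
HB.instance Definition _ n :=
  GRing.isZmodMorphism.Build (G n) (dsum G) (@dinj n) (@dinjB n).

Lemma dinj_cast m n (e : m = n) (x : G m) : dinj (gcast e x) = dinj x.
Proof. by case: _ / e. Qed.

Definition dbound x : nat := projT1 (cid (dcompP x)).
Lemma dboundP x n : (dbound x <= n)%N -> x n = 0.
Proof. by rewrite /dbound; case: cid => N; apply. Qed.

Lemma dsumE x N : (forall n, (N <= n)%N -> x n = 0) ->
  x = \sum_(i < N) dinj (x i).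
Proof.
move=> xN; apply: dsumP => n; rewrite dcomp_sum.
have [nN|Nn] := ltnP n N.
  rewrite (bigD1 (Ordinal nN)) //= big1 ?addr0 => [|i ni].
    exact/esym/dinj_id.
  exact: dinj_neq.
rewrite xN // big1 // => i _; apply: dinj_neq.
by rewrite neq_ltn (leq_trans (ltn_ord i)).
Qed.

Lemma dsum_ind (H : dsum G -> Prop) :
  (forall n (x : G n), H (dinj x)) -> (forall x y, H x -> H y -> H (x + y)) ->
  forall x, H x.
Proof.
move=> Hi HD x; rewrite (dsumE (@dboundP x)).
elim/big_ind: _ => [|//|i _]; last exact: Hi.
by rewrite -(raddf0 (@dinj 0%N)); apply: Hi.
Qed.

End DsumZmodule.

Lemma sum_trunc (G : zmodType) (F : nat -> G) a b :
  (forall i, (a <= i)%N -> F i = 0) -> (forall i, (b <= i)%N -> F i = 0) ->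
  \sum_(i < a) F i = \sum_(i < b) F i.
Proof.
wlog ab : a b / (a <= b)%N => [hw|Fa _].
  by case/orP: (leq_total a b) => ab Fa Fb; [apply: hw | apply/esym/hw].
rewrite -!(big_mkord xpredT) (big_cat_nat _ ab) //=.
rewrite [X in _ = _ + X]big_nat_cond [X in _ = _ + X]big1 ?addr0 // => i.
by rewrite andbT => /andP[/Fa].
Qed.

Definition total (G : gradedRing) : Type := dsum G.

Section TotalRing.
Variable G : gradedRing.
HB.instance Definition _ := GRing.Zmodule.on (total G).
Implicit Types x y z : total G.

Lemma gmul0l m n (z : G n) : gmul (0 : G m) z = 0.
Proof. by apply: (@addrI _ (gmul (0 : G m) z)); rewrite -gmulDl !addr0. Qed.
Lemma gmul0r m n (z : G m) : gmul z (0 : G n) = 0.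
Proof. by apply: (@addrI _ (gmul z (0 : G n))); rewrite -gmulDr !addr0. Qed.

Definition tone : total G := dinj (gone G).
Definition tmul x y : total G :=
  \sum_(i < dbound x) \sum_(j < dbound y) dinj (gmul (x i) (y j)).

Fact tmulE x y a b :
  (forall i, (a <= i)%N -> x i = 0) -> (forall j, (b <= j)%N -> y j = 0) ->
  tmul x y = \sum_(i < a) \sum_(j < b) dinj (gmul (x i) (y j)).
Proof.
move=> xa yb; rewrite /tmul.
rewrite (@sum_trunc _ (fun i => \sum_(j < dbound y) dinj (gmul (x i) (y j))) _ a).
- apply: eq_bigr => i _; apply: (@sum_trunc _ (fun j => dinj (gmul (x i) (y j)))) => j.
    by move/dboundP ->; rewrite gmul0r raddf0.
  by move/yb ->; rewrite gmul0r raddf0.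
- by move=> i /dboundP ->; rewrite big1 // => j _; rewrite gmul0l raddf0.
- by move=> i /xa ->; rewrite big1 // => j _; rewrite gmul0l raddf0.
Qed.

Fact tmulDl x y z : tmul (x + y) z = tmul x z + tmul y z.
Proof.
pose N := maxn (dbound x) (dbound y).
have xN i : (N <= i)%N -> x i = 0.
  by rewrite geq_max => /andP[/dboundP].
have yN i : (N <= i)%N -> y i = 0.
  by rewrite geq_max => /andP[_ /dboundP].
have xyN i : (N <= i)%N -> (x + y) i = 0.
  by move=> Ni; rewrite dcompD xN ?yN ?addr0.
rewrite (tmulE xyN (@dboundP _ z)) (tmulE xN (@dboundP _ z)) (tmulE yN (@dboundP _ z)).
rewrite -big_split; apply: eq_bigr => i _; rewrite -big_split.
by apply: eq_bigr => j _; rewrite dcompD gmulDl raddfD.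
Qed.

Fact tmulDr z x y : tmul z (x + y) = tmul z x + tmul z y.
Proof.
pose N := maxn (dbound x) (dbound y).
have xN i : (N <= i)%N -> x i = 0.
  by rewrite geq_max => /andP[/dboundP].
have yN i : (N <= i)%N -> y i = 0.
  by rewrite geq_max => /andP[_ /dboundP].
have xyN i : (N <= i)%N -> (x + y) i = 0.
  by move=> Ni; rewrite dcompD xN ?yN ?addr0.
rewrite (tmulE (@dboundP _ z) xyN) (tmulE (@dboundP _ z) xN) (tmulE (@dboundP _ z) yN).
rewrite -big_split; apply: eq_bigr => i _; rewrite -big_split.
by apply: eq_bigr => j _; rewrite dcompD gmulDr raddfD.
Qed.

Lemma tmul_dinj m n (x : G m) (y : G n) : tmul (dinj x) (dinj y) = dinj (gmul x y).
Proof.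
have dN p (u : G p) i : (p.+1 <= i)%N -> dinj u i = 0.
  by move=> pi; rewrite dinj_neq // neq_ltn pi.
have d1 p (u : G p) : dinj_fun u p = u := dinj_id u.
have d0 p q (u : G p) : (q < p)%N -> dinj_fun u q = 0.
  by move=> qp; apply: dinj_neq; rewrite neq_ltn qp orbT.
rewrite (tmulE (dN _ x) (dN _ y)) big_ord_recr big1 /= => [|i _].
  rewrite add0r big_ord_recr big1 /= => [|j _]; first by rewrite add0r !d1.
  by rewrite (d0 _ _ y) ?gmul0r ?raddf0.
by rewrite big1 // => j _; rewrite (d0 _ _ x) ?gmul0l ?raddf0.
Qed.

Fact tmulA : associative tmul.
Proof.
move=> x y z; elim/dsum_ind: x => [m x|x x' IHx IHx']; last first.
  by rewrite !tmulDl IHx IHx'.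
elim/dsum_ind: y => [n y|y y' IHy IHy']; last first.
  by rewrite !(tmulDl, tmulDr) IHy IHy'.
elim/dsum_ind: z => [p z|z z' IHz IHz']; last by rewrite !tmulDr IHz IHz'.
by rewrite !tmul_dinj -gmulA dinj_cast.
Qed.

Fact tmul1l : left_id tone tmul.
Proof.
move=> x; elim/dsum_ind: x => [m x|x y IHx IHy]; last by rewrite tmulDr IHx IHy.
by rewrite tmul_dinj -[x in RHS](gmul1l x) dinj_cast.
Qed.

Fact tmul1r : right_id tone tmul.
Proof.
move=> x; elim/dsum_ind: x => [m x|x y IHx IHy]; last by rewrite tmulDl IHx IHy.
by rewrite tmul_dinj -[x in RHS](gmul1r x) dinj_cast.
Qed.

HB.instance Definition _ := GRing.Zmodule_isPzRing.Build (total G)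
  tmulA tmul1l tmul1r tmulDl tmulDr.

Lemma mul_dinj m n (x : G m) (y : G n) :
  (dinj x : total G) * (dinj y : total G) = dinj (gmul x y).
Proof. exact: tmul_dinj. Qed.

Lemma total1E : 1 = dinj (gone G) :> total G.
Proof. by []. Qed.

End TotalRing.

Section TensorRing.
Variables (k : pzRingType) (V : bimodType k).

Local Notation tn n := (tens (@ract k V) (@GRing.scale k (tpow V n))).

Definition tpone : tpow V 0 := (1 : k).

(** Concatenation of tensors; in degree 0 it is the action of scalars. *)
Fixpoint tpmul (m n : nat) : tpow V m -> tpow V n -> tpow V (m + n)%N :=
  match m return tpow V m -> tpow V n -> tpow V (m + n)%N with
  | 0 => fun (a : k) y => a *: y
  | m'.+1 => fun t y => tlift (fun v x => tn (m' + n)%N v (tpmul x y)) t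
  end.

Fact tpmul_left m n (y : tpow V n) :
  zmod_morphism (fun x : tpow V m => tpmul x y) /\
  forall a (x : tpow V m), tpmul (a *: x) y = a *: tpmul x y.
Proof.
elim: m => [|m [IHB IHZ]].
  by split=> [a b|a b] /=; [exact: scalerBl | rewrite scalerA].
have bal : balanced (@ract k V) (@GRing.scale k (tpow V m))
    (fun v x => tn (m + n)%N v (tpmul x y)).
  split=> [v v' x|v x x'|v a x]; first exact: tensDl.
    by rewrite (zmod_morphD IHB) tensDr.
  by rewrite tens_bal IHZ.
have B : zmod_morphism (fun x : tpow V m.+1 => tpmul x y).
  exact: tlift_zmod_morphism bal.
split=> // a x; elim/btens_ind: x => [v x|s t IHs IHt].
  rewrite [a *: _]btens_scaleE /= (tliftE bal) (tliftE bal).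
  exact/esym/btens_scaleE.
by rewrite scalerBr !B IHs IHt scalerBr.
Qed.

Lemma tpmulDl m n (x y : tpow V m) (z : tpow V n) :
  tpmul (x + y) z = tpmul x z + tpmul y z.
Proof. exact: zmod_morphD (tpmul_left m z).1 x y. Qed.
Lemma tpmulBl m n (x y : tpow V m) (z : tpow V n) :
  tpmul (x - y) z = tpmul x z - tpmul y z.
Proof. exact: (tpmul_left m z).1. Qed.
Lemma tpmulZl m n a (x : tpow V m) (y : tpow V n) :
  tpmul (a *: x) y = a *: tpmul x y.
Proof. exact: (tpmul_left m y).2. Qed.

Lemma tpmul_tens m n (v : V) (x : tpow V m) (y : tpow V n) :
  tpmul (tn m v x : tpow V m.+1) y = tn (m + n)%N v (tpmul x y).
Proof.
apply: (tliftE (f := fun v x => tn (m + n)%N v (tpmul x y))).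
split=> [? ? ?|? ? ?|? ? ?]; first exact: tensDl.
  by rewrite tpmulDl tensDr.
by rewrite tens_bal tpmulZl.
Qed.

Lemma tpmulDr m n (x : tpow V m) (y z : tpow V n) :
  tpmul x (y + z) = tpmul x y + tpmul x z.
Proof.
elim: m x => [|m IH] x; first exact: scalerDr.
elim/btens_ind: x => [v x|s t IHs IHt]; first by rewrite !tpmul_tens IH tensDr.
by rewrite !tpmulBl IHs IHt addrACA -opprD.
Qed.

Fact gcast_tens m n (e : m = n) (e' : m.+1 = n.+1) (v : V) (x : tpow V m) :
  gcast (G := tpow V) e' (tn m v x) = tn n v (gcast (G := tpow V) e x).
Proof. by case: _ / e in e' *; rewrite (eq_irrelevance e' erefl). Qed.

Fact gcastB (G : nat -> zmodType) m n (e : m = n) :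
  zmod_morphism (@gcast G m n e).
Proof. by case: _ / e. Qed.

Fact tpmul1l n (x : tpow V n) :
  gcast (G := tpow V) (add0n n) (tpmul tpone x) = x.
Proof. by rewrite (eq_irrelevance (add0n n) erefl) ; exact: scale1r. Qed.

Fact tpmul1r n (x : tpow V n) :
  gcast (G := tpow V) (addn0 n) (tpmul x tpone) = x.
Proof.
elim: n x => [|n IH] x.
  by rewrite (eq_irrelevance (addn0 0) erefl); exact: mulr1.
elim/btens_ind: x => [v x|s t IHs IHt].
  by rewrite tpmul_tens (gcast_tens (addn0 n)) IH.
by rewrite tpmulBl gcastB IHs IHt.
Qed.

Fact tpmulA m n p (x : tpow V m) (y : tpow V n) (z : tpow V p) :
  gcast (G := tpow V) (addnA m n p) (tpmul x (tpmul y z)) = tpmul (tpmul x y) z.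
Proof.
elim: m x => [|m IH] x.
  by rewrite (eq_irrelevance (addnA 0 n p) erefl) /= tpmulZl.
elim/btens_ind: x => [v x|s t IHs IHt].
  by rewrite !tpmul_tens (gcast_tens (addnA m n p)) IH.
by rewrite !tpmulBl gcastB IHs IHt.
Qed.

Definition tensor_graded : gradedRing :=
  @GradedRing (tpow V) tpone tpmul tpmulDl tpmulDr tpmul1l tpmul1r tpmulA.

Definition tensor_ring : pzRingType := total tensor_graded.

End TensorRing.

Definition ideal (T : pzRingType) (I : set T) : Prop :=
  subgroup I /\ forall a x, I x -> I (a * x) /\ I (x * a).

Definition ideal_gen (T : pzRingType) (E : set T) : set T := smallest (@ideal T) E.

Lemma ideal_gen_ideal (T : pzRingType) (E : set T) : ideal (ideal_gen E).
Proof.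
split=> [|a x Ix].
  split=> [I [[gI _] _]|x y Ix Iy I II]; first exact: subgroup0.
  by apply: (subgroupB II.1.1); [apply: Ix | apply: Iy].
by split=> I II; have [] := II.1.2 a x (Ix I II).
Qed.

Definition qring (T : pzRingType) (E : set T) : Type := zquot (ideal_gen E).

Section QuotientRing.
Variables (T : pzRingType) (E : set T).
HB.instance Definition _ := GRing.Zmodule.on (qring E).

Definition qpi (x : T) : qring E := zpi (ideal_gen E) x.
Definition qrepr (c : qring E) : T := zrepr c.

HB.instance Definition _ :=
  GRing.isZmodMorphism.Build T (qring E) qpi (@zpi_zmod_morphism T (ideal_gen E)).

Lemma qreprK c : qpi (qrepr c) = c. Proof. exact: zreprK. Qed.

Lemma qpi_eq x y : qpi x = qpi y <-> ideal_gen E (x - y).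
Proof. by rewrite -[ideal_gen E]span_id ?zpi_eq //; apply: (ideal_gen_ideal E).1. Qed.

Definition qone : qring E := qpi 1.
Definition qmul (c d : qring E) : qring E := qpi (qrepr c * qrepr d).

Fact qpi_mul x y : qmul (qpi x) (qpi y) = qpi (x * y).
Proof.
have [gI mI] := ideal_gen_ideal E; apply/qpi_eq.
have Ix : ideal_gen E (qrepr (qpi x) - x) by apply/qpi_eq; rewrite qreprK.
have Iy : ideal_gen E (qrepr (qpi y) - y) by apply/qpi_eq; rewrite qreprK.
have -> : qrepr (qpi x) * qrepr (qpi y) - x * y =
    (qrepr (qpi x) - x) * qrepr (qpi y) + x * (qrepr (qpi y) - y).
  by rewrite mulrBl mulrBr addrA subrK.
exact: subgroupD gI _ _ (mI _ _ Ix).2 (mI _ _ Iy).1.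
Qed.

Fact qmulA : associative qmul.
Proof.
by move=> a b c; rewrite -[a]qreprK -[b]qreprK -[c]qreprK !qpi_mul mulrA.
Qed.
Fact qmul1l : left_id qone qmul.
Proof. by move=> a; rewrite -[a]qreprK qpi_mul mul1r. Qed.
Fact qmul1r : right_id qone qmul.
Proof. by move=> a; rewrite -[a]qreprK qpi_mul mulr1. Qed.
Fact qmulDl : left_distributive qmul +%R.
Proof.
move=> a b c; rewrite -[a]qreprK -[b]qreprK -[c]qreprK.
by rewrite -raddfD !qpi_mul mulrDl raddfD.
Qed.
Fact qmulDr : right_distributive qmul +%R.
Proof.
move=> a b c; rewrite -[a]qreprK -[b]qreprK -[c]qreprK.
by rewrite -raddfD !qpi_mul mulrDr raddfD.
Qed.
HB.instance Definition _ := GRing.Zmodule_isPzRing.Build (qring E)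
  qmulA qmul1l qmul1r qmulDl qmulDr.

Fact qpi_monoid_morphism : monoid_morphism qpi.
Proof. by split=> [|x y]; last exact/esym/qpi_mul. Qed.
HB.instance Definition _ :=
  GRing.isMonoidMorphism.Build T (qring E) qpi qpi_monoid_morphism.

End QuotientRing.

Record filtration (U : pzRingType) := Filtration {
  fil :> nat -> set U;
  fil_subgroup : forall n, subgroup (fil n);
  filS : forall n, fil n `<=` fil n.+1;
  fil1 : fil 0%N 1;
  filM : forall m n x y, fil m x -> fil n y -> fil (m + n)%N (x * y)
}.

Lemma subz_valB (G : zmodType) (S : set G) (a b : subz S) :
  subz_val (a - b) = subz_val a - subz_val b.
Proof. exact: (raddfB val). Qed.

Section AssociatedGraded.
Variables (U : pzRingType) (F : filtration U).

(** [fil_pred n] is the (n-1)-st step of the filtration, 0 for n = 0. *)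
Definition fil_pred (n : nat) : set U := if n is m.+1 then F m else [set 0].

Definition gr_comp (n : nat) : zmodType := subquot (F n) (fil_pred n).

Definition gr_class (n : nat) (x : U) : gr_comp n := sqclass (F n) (fil_pred n) x.

Definition gr_repr (n : nat) (c : gr_comp n) : U := subz_val (zrepr c).

Definition gr_mul (m n : nat) (c : gr_comp m) (d : gr_comp n) : gr_comp (m + n)%N :=
  gr_class (m + n)%N (gr_repr c * gr_repr d).

Fact fil_pred_subgroup n : subgroup (fil_pred n).
Proof.
case: n => [|n]; last exact: fil_subgroup.
by split=> //= x y -> ->; rewrite subrr.
Qed.

Fact fil_subz n x : F n x <-> x \in span_pred (F n).
Proof. by rewrite span_predE span_id //; apply: fil_subgroup. Qed.

Lemma gr_reprP n (c : gr_comp n) : F n (gr_repr c).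
Proof. exact/fil_subz/subz_valP. Qed.

Lemma gr_reprK n (c : gr_comp n) : gr_class n (gr_repr c) = c.
Proof. by rewrite /gr_class /sqclass valKd zreprK. Qed.

Lemma gr_class_eq n x y : F n x -> F n y ->
  gr_class n x = gr_class n y <-> fil_pred n (x - y).
Proof.
move=> /fil_subz Fx /fil_subz Fy; have gP := fil_pred_subgroup n.
have gQ : subgroup [set z : subz (F n) | fil_pred n (subz_val z)].
  split=> [|a b Pa Pb]; first exact: subgroup0 gP.
  by change (fil_pred n (subz_val (a - b))); rewrite subz_valB; exact: subgroupB gP _ _ Pa Pb.
rewrite zpi_eq (span_id gP) (span_id gQ).
suff <- : subz_val (insubd 0 x - insubd 0 y : subz (F n)) = x - y by [].
by apply: etrans (subz_valB _ _) _; congr (_ - _); apply: insubdK.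
Qed.

Lemma gr_classB n x y : F n x -> F n y ->
  gr_class n (x - y) = gr_class n x - gr_class n y.
Proof.
move=> Fx Fy; apply: etrans (raddfB (zpi _) _ _); congr (zpi _ _); apply: val_inj.
apply/esym/(etrans (subz_valB _ _)); rewrite !insubdK //; try exact/fil_subz.
by apply/fil_subz; apply: (subgroupB (fil_subgroup F n)).
Qed.

Lemma gr_classD n x y : F n x -> F n y ->
  gr_class n (x + y) = gr_class n x + gr_class n y.
Proof.
move=> Fx Fy; have FN := subgroupN (fil_subgroup F n) Fy.
have F0 := subgroup0 (fil_subgroup F n).
have cN : gr_class n (- y) = - gr_class n y.
  have c0 : gr_class n 0 = 0 by have := gr_classB Fy Fy; rewrite !subrr.
  by rewrite -[- y]sub0r gr_classB // c0 sub0r.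
by rewrite -{1}[y]opprK gr_classB // cN opprK.
Qed.

Lemma gr_class_repr n x : F n x -> fil_pred n (gr_repr (gr_class n x) - x).
Proof. by move=> Fx; apply/gr_class_eq; rewrite ?gr_reprK //; apply: gr_reprP. Qed.

Fact fil_pred_sub n : fil_pred n `<=` F n.
Proof.
by case: n => [x ->|n]; [exact: subgroup0 (fil_subgroup F 0) | exact: filS].
Qed.

Fact fil_predMl m n x y : fil_pred m x -> F n y -> fil_pred (m + n)%N (x * y).
Proof.
case: m => [|m] Fx Fy; last exact: filM.
by rewrite Fx mul0r; exact: subgroup0 (fil_pred_subgroup n).
Qed.

Fact fil_predMr m n x y : F m x -> fil_pred n y -> fil_pred (m + n)%N (x * y).
Proof.
case: n => [|n] Fx Fy; last by rewrite addnS; exact: filM.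
by rewrite Fy mulr0; exact: subgroup0 (fil_pred_subgroup (m + 0)).
Qed.

Lemma gr_class_mul m n x y : F m x -> F n y ->
  gr_mul (gr_class m x) (gr_class n y) = gr_class (m + n)%N (x * y).
Proof.
move=> Fx Fy; apply/gr_class_eq; [| exact: filM |].
  by apply: filM; apply: gr_reprP.
set x' := gr_repr _; set y' := gr_repr _.
have -> : x' * y' - x * y = (x' - x) * y' + x * (y' - y).
  by rewrite mulrBl mulrBr addrA subrK.
apply: (subgroupD (fil_pred_subgroup (m + n))).
  by apply: fil_predMl; [exact: gr_class_repr | exact: gr_reprP].
by apply: fil_predMr => //; exact: gr_class_repr.
Qed.

Fact gr_mulDl m n (x y : gr_comp m) (z : gr_comp n) :
  gr_mul (x + y) z = gr_mul x z + gr_mul y z.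
Proof.
rewrite -[x]gr_reprK -[y]gr_reprK -[z]gr_reprK.
have Fx := gr_reprP x; have Fy := gr_reprP y; have Fz := gr_reprP z.
rewrite -gr_classD // !gr_class_mul //; last exact: subgroupD (fil_subgroup F m) _ _ Fx Fy.
by rewrite mulrDl gr_classD //; apply: filM.
Qed.

Fact gr_mulDr m n (x : gr_comp m) (y z : gr_comp n) :
  gr_mul x (y + z) = gr_mul x y + gr_mul x z.
Proof.
rewrite -[x]gr_reprK -[y]gr_reprK -[z]gr_reprK.
have Fx := gr_reprP x; have Fy := gr_reprP y; have Fz := gr_reprP z.
rewrite -gr_classD // !gr_class_mul //; last exact: subgroupD (fil_subgroup F n) _ _ Fy Fz.
by rewrite mulrDr gr_classD //; apply: filM.
Qed.

Fact gcast_class m n (e : m = n) x :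
  gcast (G := gr_comp) e (gr_class m x) = gr_class n x.
Proof. by case: _ / e. Qed.

Fact gr_mul1l n (x : gr_comp n) :
  gcast (G := gr_comp) (add0n n) (gr_mul (gr_class 0 1) x) = x.
Proof.
rewrite -[x]gr_reprK gr_class_mul ?mul1r ?gcast_class //; first exact: fil1.
exact: gr_reprP.
Qed.

Fact gr_mul1r n (x : gr_comp n) :
  gcast (G := gr_comp) (addn0 n) (gr_mul x (gr_class 0 1)) = x.
Proof.
rewrite -[x]gr_reprK gr_class_mul ?mulr1 ?gcast_class //; last exact: fil1.
exact: gr_reprP.
Qed.

Fact gr_mulA m n p (x : gr_comp m) (y : gr_comp n) (z : gr_comp p) :
  gcast (G := gr_comp) (addnA m n p) (gr_mul x (gr_mul y z)) = gr_mul (gr_mul x y) z.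
Proof.
rewrite -[x]gr_reprK -[y]gr_reprK -[z]gr_reprK.
have Fx := gr_reprP x; have Fy := gr_reprP y; have Fz := gr_reprP z.
have Fxy := filM Fx Fy; have Fyz := filM Fy Fz.
by rewrite !gr_class_mul // gcast_class mulrA.
Qed.

Definition assoc_graded : gradedRing :=
  @GradedRing gr_comp (gr_class 0 1) gr_mul
    gr_mulDl gr_mulDr gr_mul1l gr_mul1r gr_mulA.

Definition gr_ring : pzRingType := total assoc_graded.

End AssociatedGraded.

Section Tor.
Variables (k A : pzRingType) (Agr : nat -> set A) (eps : A -> k).

(** [Agr n] is the degree n part of the graded ring [A]. *)
Definition graded_lmodule (M : lmodType A) (Mgr : nat -> set M) : Prop :=
  [/\ forall n, subgroup (Mgr n),
      forall m n a x, Agr m a -> Mgr n x -> Mgr (m + n)%N (a *: x)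
    & forall x, exists! c : nat -> M, (forall n, Mgr n (c n)) /\
        exists N, (forall n, (N <= n)%N -> c n = 0) /\ x = \sum_(n < N) c n].

(** Right [A]-modules are left modules over the converse ring. *)
Definition rscale (M : lmodType A^c) (m : M) (a : A) : M := (a : A^c) *: m.

Definition flat (Q : lmodType A) : Prop :=
  forall (M M' : lmodType A^c) (f : {linear M -> M'}), injective f ->
  injective (tmap (@rscale M) (@GRing.scale A Q) (@rscale M') (@GRing.scale A Q)
                  f id).

(** Resolutions of the left [A]-module [k], with [A] acting through [eps],
    concentrated in degree 0. *)
Record graded_flat_resolution := GradedFlatResolution {
  res :> nat -> lmodType A;
  res_gr : forall i, nat -> set (res i);
  res_d : forall i, {linear res i.+1 -> res i};
  res_aug : {additive res 0%N -> k};
  res_graded : forall i, graded_lmodule (@res_gr i);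
  res_flat : forall i, flat (res i);
  res_d_gr : forall i n x, res_gr n x -> res_gr n (res_d i x);
  res_augZ : forall a x, res_aug (a *: x) = eps a * res_aug x;
  res_aug_gr : forall n x, n <> 0%N -> res_gr n x -> res_aug x = 0;
  res_aug_surj : forall c, exists x, res_aug x = c;
  res_exact0 : forall x, res_aug x = 0 <-> exists y, res_d 0%N y = x;
  res_exact : forall i x, res_d i x = 0 <-> exists y, res_d i.+1 y = x
}.

Variable Q : graded_flat_resolution.

Definition kright (c : k) (a : A) : k := c * eps a.

Definition kQ (i : nat) : zmodType := tprod kright (@GRing.scale A (Q i)).

Definition kQ_d (i : nat) : kQ i.+1 -> kQ i :=
  tmap kright (@GRing.scale A (Q i.+1)) kright (@GRing.scale A (Q i))
       id (res_d Q i).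

Definition kQ_gr (i n : nat) : set (kQ i) :=
  span [set tens kright (@GRing.scale A (Q i)) c q | c in setT & q in res_gr n].
Arguments kQ_gr : clear implicits.

Definition kQ_cycle (i n : nat) : set (kQ i) :=
  match i return set (kQ i) with
  | 0 => kQ_gr 0 n
  | j.+1 => kQ_gr j.+1 n `&` [set t | kQ_d t = 0]
  end.
Arguments kQ_cycle : clear implicits.

(** The degree n part of Tor_i^A(k, k), computed from the resolution [Q]. *)
Definition Tor (i n : nat) : zmodType :=
  subquot (kQ_cycle i n) (kQ_d (i := i) @` kQ_gr i.+1 n).

Definition Tor_concentrated (i d : nat) : Prop :=
  forall n, n <> d -> forall c : Tor i n, c = 0.

End Tor.

Section PBW.
Variables (k : pzRingType) (V : bimodType k).

Local Notation T := (tensor_ring V).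
Local Notation inj n := (@dinj (tensor_graded V) n).

Definition tscalar (a : k) : T := inj 0%N a.

(** The tensor power of degree n inside T(V), and the sum F^n of those of degree
    at most n. *)
Definition tgr (n : nat) : set T := range (inj n).
Definition tfil (n : nat) : set T := [set x : T | forall m, (n < m)%N -> x m = 0].

Definition subbimodule (E : set T) : Prop :=
  subgroup E /\ forall a x, E x -> E (tscalar a * x) /\ E (x * tscalar a).

Definition set_mul (E F : set T) : set T := span [set x * y | x in E & y in F].
Definition set_add (E F : set T) : set T := [set x + y | x in E & y in F].

(** The image of [P] under the projection to the tensor power of degree N. *)
Definition top_part (N : nat) (P : set T) : set T := [set inj N (p N) | p in P].

Definition qgr (E : set T) (n : nat) : set (qring E) := qpi E @` tgr n.

(** The projection of T(V)/I(E) to k; by [qaugE] it does not depend on the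
    representative when [E] has no component in degree 0. *)
Definition qaug (E : set T) (c : qring E) : k := qrepr c 0%N.

Lemma tmul_comp0 (x y : T) : (x * y) 0%N = x 0%N * y 0%N :> k.
Proof.
elim/dsum_ind: x => [m x|x x' IHx IHx']; last first.
  by rewrite mulrDl !dcompD IHx IHx'; exact/esym/(mulrDl (x 0%N : k)).
elim/dsum_ind: y => [n y|y y' IHy IHy']; last first.
  by rewrite mulrDr !dcompD IHy IHy'; exact/esym/(mulrDr (inj m x 0%N : k)).
rewrite mul_dinj.
case: (eqVneq m 0%N) x => [->|m0] x; last first.
  rewrite dinj_neq ?addn_eq0 ?negb_and ?m0 //.
  by rewrite (dinj_neq x m0); exact/esym/(mul0r (inj n y 0%N : k)).
case: (eqVneq n 0%N) y => [->|n0] y; first by rewrite !dinj_id.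
by rewrite dinj_neq // (dinj_neq y n0); exact/esym/(mulr0 (inj 0%N x 0%N : k)).
Qed.

Lemma qaugE (E : set T) (x : T) :
  (forall y, E y -> y 0%N = 0) -> qaug (qpi E x) = x 0%N.
Proof.
move=> E0; have : ideal_gen E (qrepr (qpi E x) - x) by apply/qpi_eq; rewrite qreprK.
suff sub : ideal_gen E `<=` [set y : T | y 0%N = 0].
  by move=> /sub xx; apply/eqP; rewrite -subr_eq0; apply/eqP.
apply: smallest_sub => //; split.
  by split=> // u v u0 v0; change (u 0%N - v 0%N = 0); rewrite u0 v0 subrr.
move=> a u u0; split; rewrite /mkset tmul_comp0 u0; [exact: (mulr0 (a 0%N : k)) | exact: (mul0r (a 0%N : k))].
Qed.

Fact tfil_subgroup n : subgroup (tfil n).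
Proof. by split=> [//|x y xn yn m nm]; rewrite dcompB xn ?yn ?subrr. Qed.

Fact tfilM m n x y : tfil m x -> tfil n y -> tfil (m + n)%N (x * y).
Proof.
move=> xm yn p mnp; rewrite [x * y](tmulE xm yn) dcomp_sum big1 // => i _.
rewrite dcomp_sum big1 // => j _; apply: dinj_neq.
rewrite neq_ltn (leq_ltn_trans _ mnp) //.
by apply: leq_add; rewrite -ltnS ltn_ord.
Qed.

Section Filtration.
Variable P : set T.

Definition qfil_set (n : nat) : set (qring P) := qpi P @` tfil n.

Fact qfil_subgroup n : subgroup (qfil_set n).
Proof.
split=> [|_ _ [x xn <-] [y yn <-]].
  by exists 0; [exact: subgroup0 (tfil_subgroup n) | rewrite raddf0].
by exists (x - y); [exact: subgroupB (tfil_subgroup n) _ _ xn yn | rewrite raddfB].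
Qed.

Fact qfilS n : qfil_set n `<=` qfil_set n.+1.
Proof. by move=> _ [x xn <-]; exists x => // m /ltnW; exact: xn. Qed.

Fact qfil1 : qfil_set 0%N 1.
Proof.
exists 1; last exact: rmorph1.
by move=> m m0; rewrite total1E dinj_neq // neq_ltn m0.
Qed.

Fact qfilM m n x y : qfil_set m x -> qfil_set n y -> qfil_set (m + n)%N (x * y).
Proof.
move=> [{}x xm <-] [{}y yn <-]; exists (x * y); last exact: rmorphM.
exact: tfilM.
Qed.

(** The filtration of U = T(V)/I(P) by the images U^n of F^n. *)
Definition qfil : filtration (qring P) :=
  Filtration qfil_subgroup qfilS qfil1 qfilM.

End Filtration.

(** The natural morphism sends the class of a homogeneous tensor [x] of degree n
    in T(V)/I(R) to its class in U^n/U^(n-1); these classes generate T(V)/I(R)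
    additively. *)
Definition PBW_property (N : nat) (P : set T) : Prop :=
  exists phi : {rmorphism qring (top_part N P) -> gr_ring (qfil P)},
    (forall n (x : tpow V n),
       phi (qpi (top_part N P) (inj n x)) =
       @dinj (assoc_graded (qfil P)) n (gr_class (qfil P) n (qpi P (inj n x)))) /\
    bijective phi.

End PBW.

Arguments qgr {k V} E n _.
Arguments qaug {k V} E c.

(* Main.v *)
(** Write [N = N' + 1], [I = I(R)], and let [J n] ([ifil n] below) be the sum of
    the V^i P V^j with [i + N + j <= n]. Since I(P) is the union of the [J n], the
    PBW property follows from the cancellation [J n.+1] /\ F^n = [J n], which is
    proved by induction on [n]. An element of [J n.+1] is modulo [J n] a sum
    [y + w] with [y] = sum of [p t] in P V^j, n + 1 = N + j, and [w] in V [J n]. If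
    its top component vanishes, then the sum of the [r (x) t], with [r] the top
    component of [p], defines an element of the kernel D of
    R (x)_k A -> V (x)_k A. If every such element lifts to [J n] + V [J n], only
    V [J n] /\ F^n remains to be treated, where the flatness of [V] over the von
    Neumann regular ring [k] reduces to the previous step.

    The lifting property is immediate in A-degree 0 (P /\ F^(N-1) = 0) and in
    A-degree 1 ((PV + VP) /\ F^N <= P), and it propagates from D to D A_+. The
    Tor hypothesis says that every element of D of A-degree at least 2 lies in
    D A_+. Indeed V (x)_k A and R (x)_k A are the first terms of a resolution of
    the right module [k], and a diagram chase in its product with the given flat
    resolution identifies D / D A_+ with Tor_3(k, k). *)
From HB Require Import structures.
Require Import Defs.
From mathcomp Require Import all_boot ssralg ssrint.
From mathcomp Require Import boolp classical_sets.
From mathcomp.multinomials Require Import freeg.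

Set Implicit Arguments.
Unset Strict Implicit.
Unset Printing Implicit Defensive.

Import GRing.Theory.
Local Open Scope classical_set_scope.
Local Open Scope ring_scope.

(** The difficulty is that lifting a relation from the graded algebra to T(V) involves lower-order
    terms and a choice of representatives. Working modulo [left_ifil] absorbs both: the lift becomes
    an additive map [rel_lift j] out of P (x)_k A, the lifting property becomes its vanishing on the
    kernel D, and this vanishing is stable under right multiplication by A. With P rather than R as
    the source no section R -> P has to be chosen, and the intersection of P with F^(N-1) sits in
    the A-degree 0 part of D, where the first condition is used.

    An element of D of A-degree j has total degree N + j, so among positive degrees the Tor
    hypothesis leaves only j = 1 to a direct check; this is the degree in which PV meets VP.
    Flatness of V enters only in [span_tvec_cancel], and there through a universal property, because
    the map to be factored is built from arbitrary lifts. *)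

(** * Generated subgroups, right exactness of tensor products, submodules *)

Lemma span_elim (G : zmodType) (S H : set G) :
  H 0 -> (forall x y, H x -> H y -> H (x - y)) -> (forall x, S x -> H x) ->
  forall x, span S x -> H x.
Proof. by move=> H0 HB SH; apply: span_min. Qed.

Lemma spanS (G : zmodType) (S S' : set G) : S `<=` S' -> span S `<=` span S'.
Proof.
by move=> SS; apply: span_min (span_subgroup _) _ => x /SS; apply: sub_span.
Qed.

Section Morphisms.
Variables (G H : zmodType) (f : G -> H) (fB : zmod_morphism f).
Lemma zmorph0 : f 0 = 0.
Proof. by have := fB 0 0; rewrite !subrr. Qed.
Lemma zmorphD : {morph f : x y / x + y}.
Proof. exact: zmod_morphD. Qed.
Lemma zmorphN : {morph f : x / - x}.
Proof. by move=> x; rewrite -[- x]sub0r fB zmorph0 sub0r. Qed.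
Lemma zmorph_sum I (r : seq I) (F : I -> G) :
  f (\sum_(i <- r) F i) = \sum_(i <- r) f (F i).
Proof. exact: (big_morph f zmorphD zmorph0). Qed.
Lemma preim_subgroup (K : set H) : subgroup K -> subgroup [set x | K (f x)].
Proof.
move=> gK; split=> [|x y Kx Ky]; rewrite /mkset ?zmorph0; first exact: gK.1.
by rewrite fB; apply: gK.2.
Qed.
Lemma range_subgroup : subgroup (range f).
Proof.
split=> [|_ _ [x _ <-] [y _ <-]]; first by exists 0; rewrite ?zmorph0.
by exists (x - y); rewrite ?fB.
Qed.
Lemma span_morph (S : set G) (K : set H) :
  subgroup K -> (forall x, S x -> K (f x)) -> forall x, span S x -> K (f x).
Proof.
move=> gK SK; apply: (@span_min _ _ [set x | K (f x)]) => //.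
exact: preim_subgroup.
Qed.
End Morphisms.

Lemma subgroup_set0 (G : zmodType) : subgroup [set (0 : G)].
Proof. by split=> // x y /= -> ->; rewrite subrr. Qed.


Section TensorFunctoriality.
Variables (R : Type) (M N M' N' : zmodType).
Variables (ra : M -> R -> M) (la : R -> N -> N).
Variables (ra' : M' -> R -> M') (la' : R -> N' -> N').

Lemma tens_Bl m m' n : tens ra la (m - m') n = tens ra la m n - tens ra la m' n.
Proof. by apply/eqP; rewrite eq_sym subr_eq -tensDl subrK. Qed.
Lemma tens_Br m n n' : tens ra la m (n - n') = tens ra la m n - tens ra la m n'.
Proof. by apply/eqP; rewrite eq_sym subr_eq -tensDr subrK. Qed.

Section Tmap.
Variables (f : M -> M') (g : N -> N').
Hypotheses (fB : zmod_morphism f) (gB : zmod_morphism g).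
Hypotheses (fr : forall m r, f (ra m r) = ra' (f m) r).
Hypotheses (gl : forall r n, g (la r n) = la' r (g n)).

Lemma tmap_bal : balanced ra la (fun m n => tens ra' la' (f m) (g n)).
Proof.
split=> [m m' n|m n n'|m r n]; first by rewrite zmorphD ?tensDl.
  by rewrite (zmorphD gB) tensDr.
by rewrite fr gl tens_bal.
Qed.
Lemma tmapE m n : tmap ra la ra' la' f g (tens ra la m n) = tens ra' la' (f m) (g n).
Proof. exact: (tliftE tmap_bal). Qed.
Lemma tmapB : zmod_morphism (tmap ra la ra' la' f g).
Proof. exact: tlift_zmod_morphism tmap_bal. Qed.
End Tmap.
End TensorFunctoriality.

(** An inverse of (M (x) N)/S -> M' (x) N is built from a set-theoretic section [h] of [g]: two
    preimages of the same element differ by an element of the kernel, so modulo S the map is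
    balanced although [h] is arbitrary. *)
Lemma tens_rexact (R : Type) (M M' N : zmodType) (ra : M -> R -> M)
    (ra' : M' -> R -> M') (la : R -> N -> N) (g : M -> M') :
  zmod_morphism g -> (forall m r, g (ra m r) = ra' (g m) r) ->
  (forall m', exists m, g m = m') ->
  forall t, tmap ra la ra' la g id t = 0 ->
  span [set tens ra la m n | m in [set m | g m = 0] & n in setT] t.
Proof.
move=> gB gr /choice[h hK] t.
set S := [set _ | _ in _ & _ in _].
pose f m' n := zpi S (tens ra la (h m') n).
have fE m n : f (g m) n = zpi S (tens ra la m n).
  apply/zpi_eq; rewrite -tens_Bl; apply: sub_span.
  by exists (h (g m) - m); [rewrite /mkset gB hK subrr | exists n].
have bf : balanced ra' la f.
  split=> [m m' n|m n n'|m r n].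
  - by rewrite -(hK m) -(hK m') -zmorphD // !fE -raddfD -tensDl.
  - by rewrite /f tensDr raddfD.
  - by rewrite -(hK m) -gr !fE tens_bal.
move=> t0; apply/zpi_eq0.
have -> : zpi S t = tlift f (tmap ra la ra' la g id t).
  pose F t := tlift f (tmap ra la ra' la g id t).
  apply: (@tens_eq _ _ _ _ ra la (zpi S) F _ _ _ t) => [||m n]; rewrite /F.
  - exact: raddfB.
  - by move=> x y; rewrite tmapB // (tlift_zmod_morphism bf).
  - by rewrite tmapE // (tliftE bf) fE.
by rewrite t0 (zmorph0 (tlift_zmod_morphism bf)).
Qed.

Section Submodules.
Variables (S : pzRingType) (M : lmodType S).

Definition submodule (E : set M) : Prop :=
  subgroup E /\ forall a x, E x -> E (a *: x).

Variables (E : set M) (sE : submodule E).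

(** The closure proof is an argument of the type, so that the module structure can be recovered from
    the type alone. *)
Definition smod of submodule E : Type := subz E.
Local Notation sm := (smod sE).
HB.instance Definition _ := GRing.Zmodule.on sm.

Definition smval (x : sm) : M := subz_val x.

Lemma smod_in x : E x <-> x \in span_pred E.
Proof. by rewrite span_predE (span_id sE.1). Qed.
Lemma smvalP (x : sm) : E (smval x).
Proof. exact/smod_in/subz_valP. Qed.
Lemma smval_inj : injective smval.
Proof. exact: val_inj. Qed.
Definition smk x (Ex : E x) : sm := Subz (iffLR (smod_in x) Ex).
Lemma smkK x (Ex : E x) : smval (smk Ex) = x.
Proof. by []. Qed.
Lemma smvalB : zmod_morphism smval.
Proof. exact: subz_valB. Qed.

Definition smod_scale a (x : sm) : sm := smk (sE.2 a _ (smvalP x)).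
Fact smod_scaleA a b x : smod_scale a (smod_scale b x) = smod_scale (a * b) x.
Proof. by apply: smval_inj; rewrite !smkK scalerA. Qed.
Fact smod_scale1 x : smod_scale 1 x = x.
Proof. by apply: smval_inj; rewrite !smkK scale1r. Qed.
Fact smod_scaleDr : right_distributive smod_scale +%R.
Proof.
by move=> a x y; apply: smval_inj; rewrite !(smkK, zmorphD smvalB) scalerDr.
Qed.
Fact smod_scaleDl x : {morph smod_scale^~ x : a b / a + b}.
Proof.
by move=> a b; apply: smval_inj; rewrite !(smkK, zmorphD smvalB) scalerDl.
Qed.
HB.instance Definition _ := GRing.Zmodule_isLmodule.Build S sm
  smod_scaleA smod_scale1 smod_scaleDr smod_scaleDl.

Fact smvalZ : scalable smval. Proof. by []. Qed.
HB.instance Definition _ := GRing.isZmodMorphism.Build sm M smval smvalB.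
HB.instance Definition _ := GRing.isScalable.Build S sm M *:%R smval smvalZ.

End Submodules.

Section FlatExact.
Variables (A : pzRingType) (Q : lmodType A) (fQ : flat Q).
Local Notation tn X := (tens (@rscale A X) (@GRing.scale A Q)).
Local Notation tm X Y f :=
  (tmap (@rscale A X) (@GRing.scale A Q) (@rscale A Y) (@GRing.scale A Q) f id).

Lemma flat_sub (X : lmodType A^c) (E : set X) (sE : submodule E) :
  injective (tm (smod sE) X (@smval _ _ _ sE)).
Proof. exact: fQ (@smval_inj _ _ _ sE). Qed.

(** Factor [f] through its range: flatness keeps the inclusion of the range injective after
    tensoring, and right exactness deals with the surjection onto the range. *)
Lemma flat_exact (X Y : lmodType A^c) (f : X -> Y) :
  zmod_morphism f -> scalable f ->
  forall t, tm X Y f t = 0 -> span [set tn X x q | x in [set x | f x = 0] & q in setT] t.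
Proof.
move=> fB fZ t.
have sE : submodule (range f).
  split; first exact: range_subgroup.
  by move=> a _ [x _ <-]; exists (a *: x); rewrite ?fZ.
have fE x : range f (f x) by exists x.
pose g x : smod sE := smk sE (fE x).
have gB : zmod_morphism g.
  by move=> x y; apply: smval_inj; rewrite smvalB !smkK fB.
have gr x r : g (rscale x r) = rscale (g x) r by apply: smval_inj; apply: fZ.
move=> t0; pose S := [set tn X m n | m in [set m | g m = 0] & n in setT].
have : span S t.
  apply: tens_rexact => //.
    move=> y; case: (smvalP y) => x _ xy; exists x; exact: smval_inj.
  have vB : zmod_morphism (@smval _ _ _ sE) by exact: smvalB.
  have idB : zmod_morphism (@id Q) by [].
  apply: (@flat_sub _ _ sE).
  rewrite (zmorph0 (tmapB (f := @smval _ _ _ sE) vB idB _ _)) //.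
  pose F t := tm (smod sE) Y (@smval _ _ _ sE) (tm X (smod sE) g t).
  rewrite -t0; apply: (@tens_eq _ _ _ _ _ _ F (tm X Y f) _ _ _ t); rewrite /F.
  - by move=> x y; rewrite !tmapB.
  - by apply: tmapB => // x a; exact: fZ.
  - by move=> x q; rewrite !tmapE // => y a; exact: fZ.
apply: spanS => _ [x gx [q _ <-]]; exists x; last by exists q.
by rewrite /mkset -(smkK sE (fE x)) -/(g x) gx (zmorph0 (@smvalB _ _ _ _)).
Qed.
End FlatExact.

(** * Flatness over a von Neumann regular ring *)

(** This is the generation of finitely generated left ideals by idempotents, in the form of a common
    right unit for finitely many elements of L. *)
Lemma regular_idempotent (k : pzRingType) (L : set k) (s : seq k) :
  von_neumann_regular k -> subgroup L -> (forall a l, L l -> L (a * l)) ->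
  (forall l, l \in s -> L l) ->
  exists e, [/\ L e, e * e = e & forall l, l \in s -> l * e = l].
Proof.
move=> vk gL mL; elim: s => [_|l s IH Ls].
  by exists 0; split; rewrite ?mul0r //; exact: subgroup0.
have [|e [Le ee se]] := IH; first by move=> a sa; apply: Ls; rewrite inE sa orbT.
have Ll : L l by apply: Ls; rewrite mem_head.
have [y] := vk (l - l * e); set l' := l - l * e => l'y.
have l'e : l' * e = 0 by rewrite mulrBl -mulrA ee subrr.
have Ll' : L l' by apply: subgroupB => //; apply: mL.
pose g := y * l'.
have ge : g * e = 0 by rewrite -mulrA l'e mulr0.
have gg : g * g = g by rewrite /g -mulrA [l' * _]mulrA l'y.
have l'g : l' * g = l' by rewrite mulrA l'y.
have Lg : L g by apply: mL.
have le : l * e + l' = l by rewrite addrC subrK.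
clearbody g l'.
(* As g e = 0, the correction g - e g is an idempotent orthogonal to e on both sides; as l' e = 0,
   it still fixes l' from the right. *)
exists (e + (g - e * g)); split.
- by apply: subgroupD => //; apply: subgroupB => //; apply: mL.
- have he : (g - e * g) * e = 0 by rewrite mulrBl -mulrA ge mulr0 subrr.
  have eh : e * (g - e * g) = 0 by rewrite mulrBr mulrA ee subrr.
  have hh : (g - e * g) * (g - e * g) = g - e * g.
    by rewrite mulrBr mulrA he mul0r subr0 mulrBl -mulrA gg.
  by move: (g - _) he eh hh => h he eh hh; rewrite mulrDl !mulrDr ee he eh hh addr0 add0r.
- move=> a; rewrite inE => /predU1P[->|/se ae].
    have -> : l * (e + (g - e * g)) = (l * e + l') * (e + (g - e * g)) by rewrite le.
    rewrite mulrDl -mulrA (mulrDr e) ee [e * (_ - _)]mulrBr mulrA ee subrr addr0.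
    by rewrite mulrDr l'e add0r mulrBr mulrA l'e mul0r subr0 l'g le.
  by rewrite mulrDr mulrBr mulrA ae subrr addr0.
Qed.

Section RegularFlat.
Variables (k : pzRingType) (vk : von_neumann_regular k).
Variables (V : bimodType k) (M : lmodType k).

Fixpoint adjoin (F : set M) (s : seq M) : set M :=
  if s is x :: s' then [set y + a *: x | y in adjoin F s' & a in setT] else F.

Lemma adjoin_submodule F s : submodule F -> submodule (adjoin F s).
Proof.
move=> sF; elim: s => //= x s [gI mI]; split; first split.
- exists 0; first exact: subgroup0.
  by exists 0; rewrite ?scale0r ?addr0.
- move=> _ _ [y Iy [a _ <-]] [y' Iy' [a' _ <-]].
  exists (y - y'); first exact: subgroupB.
  by exists (a - a'); rewrite // scalerBl opprD addrACA.
- move=> b _ [y Iy [a _ <-]]; exists (b *: y); first exact: mI.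
  by exists (b * a); rewrite // scalerDr scalerA.
Qed.

Lemma adjoin_sub F s : F `<=` adjoin F s.
Proof.
elim: s => //= x s IH y /IH Fy; exists y => //; exists 0 => //.
by rewrite scale0r addr0.
Qed.

Lemma adjoin_in F s x : submodule F -> x \in s -> adjoin F s x.
Proof.
move=> sF; elim: s => //= y s IH; rewrite inE => /predU1P[->|/IH Fx].
  exists 0; first exact: subgroup0 (adjoin_submodule s sF).1.
  by exists 1; rewrite // add0r scale1r.
by exists x => //; exists 0; rewrite // scale0r addr0.
Qed.

Lemma adjoin_min F s G : submodule G -> F `<=` G -> (forall x, x \in s -> G x) ->
  adjoin F s `<=` G.
Proof.
move=> sG FG; elim: s => //= x s IH sx _ [y Fy [a _ <-]].
apply: (subgroupD sG.1); last by apply/sG.2/sx/mem_head.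
by apply: IH Fy => z sz; apply: sx; rewrite inE sz orbT.
Qed.

Lemma adjoin_catl F s t : submodule F -> adjoin F s `<=` adjoin F (s ++ t).
Proof.
move=> sF; apply: adjoin_min; first exact: adjoin_submodule.
  exact: adjoin_sub.
by move=> x sx; apply: adjoin_in => //; rewrite mem_cat sx.
Qed.

Lemma adjoin_catr F s t : submodule F -> adjoin F t `<=` adjoin F (s ++ t).
Proof.
move=> sF; apply: adjoin_min; first exact: adjoin_submodule.
  exact: adjoin_sub.
by move=> x sx; apply: adjoin_in => //; rewrite mem_cat sx orbT.
Qed.

Inductive tens_rel_on (F : set M) : {freeg (V * M)%type} -> Prop :=
| TensOnDl v v' m of F m :
    tens_rel_on F (<< (v + v', m) >> - << (v, m) >> - << (v', m) >>)
| TensOnDr v m m' of F m & F m' :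
    tens_rel_on F (<< (v, m + m') >> - << (v, m) >> - << (v, m') >>)
| TensOnA v a m of F m :
    tens_rel_on F (<< (ract v a, m) >> - << (v, a *: m) >>).

Lemma tens_rel_onS F G : F `<=` G -> tens_rel_on F `<=` tens_rel_on G.
Proof.
move=> FG _ [v v' m Fm|v m m' Fm Fm'|v a m Fm].
- by apply: TensOnDl; apply: FG.
- by apply: TensOnDr; apply: FG.
- by apply: TensOnA; apply: FG.
Qed.

(** One combination of relations mentions only finitely many elements of M, so it already holds over
    F with these adjoined. This reduces flatness to adjoining a single element. *)
Lemma tens_rel_finite F D : submodule F ->
  span (tens_rel (@ract k V) (@GRing.scale k M)) D ->
  exists s, span (tens_rel_on (adjoin F s)) D.
Proof.
move=> sF; move: D; apply: span_elim.
- by exists [::]; apply: subgroup0 (span_subgroup _).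
- move=> x y [s sx] [t ty]; exists (s ++ t).
  apply: (subgroupB (span_subgroup _)).
    by apply: spanS sx; apply: tens_rel_onS; exact: adjoin_catl.
  by apply: spanS ty; apply: tens_rel_onS; exact: adjoin_catr.
- move=> _ [v v' m|v m m'|v a m].
  + exists [:: m]; apply: sub_span; apply: TensOnDl.
    by apply: adjoin_in; rewrite ?mem_head.
  + exists [:: m; m']; apply: sub_span; apply: TensOnDr; apply: adjoin_in => //;
      by rewrite !inE eqxx ?orbT.
  + exists [:: m]; apply: sub_span; apply: TensOnA.
    by apply: adjoin_in; rewrite ?mem_head.
Qed.

Definition balanced_on (F : set M) (G : zmodType) (f : V -> M -> G) : Prop :=
  [/\ forall v v' m, F m -> f (v + v') m = f v m + f v' m,
      forall v m m', F m -> F m' -> f v (m + m') = f v m + f v m'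
    & forall v a m, F m -> f (ract v a) m = f v (a *: m)].

Lemma balanced_on_rel F (G : zmodType) (f : V -> M -> G) D :
  balanced_on F f -> span (tens_rel_on F) D -> fgsum f D = 0.
Proof.
move=> [fl fr fb]; apply: (@span_min _ _ [set D | fgsum f D = 0]).
  exact: preim_subgroup (@fgsumB _ _ _ f) _ (subgroup_set0 _).
move=> _ [a b c Fc|a b c Fb Fc|a b c Fc] /=; rewrite !fgsumB !fgsum1 /=.
- by rewrite fl // addrAC addrK subrr.
- by rewrite fr // addrAC addrK subrr.
- by rewrite fb // subrr.
Qed.

(** Let L be the left ideal of all l with l x in F. The new target is the pushout of G and V along V
    (x) L, where v (x) l goes to f v (l x) in G and to v l in V; a second component v stands for the
    future value of f' at (v, x). Regularity of k is what makes G inject into it. *)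
Lemma balanced_extend1 F (G : zmodType) (f : V -> M -> G) x :
  submodule F -> balanced_on F f ->
  exists (G' : zmodType) (j : G -> G') (f' : V -> M -> G'),
    [/\ zmod_morphism j, forall g, j g = 0 -> g = 0,
        balanced_on (adjoin F [:: x]) f'
      & forall v m, F m -> f' v m = j (f v m)].
Proof.
move=> sF [fl fr fb]; have [gF mF] := sF.
have f0l m : F m -> f 0 m = 0.
  by move=> Fm; apply: (@addrI _ (f 0 m)); rewrite -fl // !addr0.
have fBr v m m' : F m -> F m' -> f v (m - m') = f v m - f v m'.
  by move=> Fm Fm'; apply/eqP; rewrite eq_sym subr_eq -fr ?subrK //; exact: subgroupB.
have fNl v m : F m -> f (- v) m = - f v m.
  by move=> Fm; apply/eqP; rewrite -addr_eq0 -fl // addNr f0l.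
have r0 a : ract (0 : V) a = 0.
  by apply: (@addrI _ (ract (0 : V) a)); rewrite -ractDl !addr0.
have rN (v : V) a : ract (- v) a = - ract v a.
  by apply/eqP; rewrite -addr_eq0 -ractDl addNr r0.
have rB (v : V) a b : ract v (a - b) = ract v a - ract v b.
  by apply/eqP; rewrite eq_sym subr_eq -ractDr subrK.
pose L := [set l | F (l *: x)].
have gL : subgroup L.
  split=> [|a b La Lb]; rewrite /L /mkset ?scale0r ?scalerBl; first exact: subgroup0.
  exact: subgroupB.
pose S := [set p : G * V | exists2 l, L l & exists v, p = (f v (l *: x), - ract v l)].
pose j g := zpi S (g, 0).
have jB : zmod_morphism j.
  by move=> g g'; rewrite /j -raddfB; congr (zpi S _); congr pair; rewrite subr0.
have SE p : span S p -> exists2 s : seq (V * k), forall z, z \in s -> L z.2 &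
    p = (\sum_(z <- s) f z.1 (z.2 *: x), - \sum_(z <- s) ract z.1 z.2).
  move: p; apply: span_elim => [|p q [s Ls ->] [t Lt ->]|_ [l Ll [v ->]]].
  - by exists [::] => //; rewrite !big_nil oppr0.
  - exists (s ++ [seq (- z.1, z.2) | z <- t]).
      by move=> z; rewrite mem_cat => /orP[/Ls//|/mapP[w /Lt Lw ->]].
    rewrite !big_cat !big_map /=; congr pair.
      congr (_ + _); rewrite -[LHS]sumrN !big_seq; apply: eq_bigr => z /Lt Lz.
      by rewrite fNl.
    rewrite opprD; congr (_ + _); congr (- _); rewrite -[LHS]sumrN.
    by apply: eq_bigr => z _; rewrite rN.
  - by exists [:: (v, l)]; [move=> z; rewrite inE => /eqP ->|rewrite !big_seq1].
have j0 g : j g = 0 -> g = 0.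
  move=> /zpi_eq0/SE[s Ls [-> /esym/eqP]]; rewrite oppr_eq0 => /eqP s0.
  have [||e [Le ee se]] := @regular_idempotent k L [seq z.2 | z <- s] vk gL.
  - by move=> a l Ll; rewrite /L /mkset -scalerA; apply: mF.
  - by move=> _ /mapP[z /Ls Lz ->].
  (* Since l e = l for all coefficients l in play, f v (l x) = f (v l) (e x), so the sum only
     depends on the sum of the v l, which is 0. *)
  transitivity (f (\sum_(z <- s) ract z.1 z.2) (e *: x)); last by rewrite s0 f0l.
  have fS : {morph f^~ (e *: x) : u v / u + v} by move=> u v; rewrite fl.
  rewrite (big_morph _ fS (f0l _ Le)) !big_seq; apply: eq_bigr => z sz.
  by rewrite fb // scalerA se //; apply/mapP; exists z.
(* A decomposition y + a x is not unique; two of them differ by an element of L, and the resulting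
   ambiguity of f' lies in S. *)
have /choice[d dP] : forall m, exists p : M * k,
    adjoin F [:: x] m -> F p.1 /\ m = p.1 + p.2 *: x.
  move=> m; have [[y Fy [a _ ya]]|nm] := pselect (adjoin F [:: x] m).
    by exists (y, a).
  by exists (0, 0).
pose f' v m := zpi S (f v (d m).1, ract v (d m).2).
have f'E v y a : F y -> f' v (y + a *: x) = zpi S (f v y, ract v a).
  move=> Fy; have /dP[Fd dE] : adjoin F [:: x] (y + a *: x).
    by exists y => //; exists a.
  apply/zpi_eq; apply: sub_span.
  have dxy : (a - (d (y + a *: x)).2) *: x = (d (y + a *: x)).1 - y.
    by rewrite scalerBl; apply/eqP; rewrite subr_eq addrAC -dE addrC addKr.
  exists (a - (d (y + a *: x)).2); first by rewrite /L /mkset dxy; exact: subgroupB.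
  exists v; rewrite dxy fBr // rB opprB; congr pair.
exists (zquot S), j, f'; split=> //.
- split=> [v v' m|v m m'|v b m].
  + move=> [y Fy [a _ <-]]; rewrite !f'E // -raddfD; congr (zpi S _).
    by rewrite fl // ractDl.
  + move=> [y Fy [a _ <-]] [y' Fy' [a' _ <-]].
    rewrite addrACA -scalerDl !f'E //; last exact: subgroupD.
    by rewrite -raddfD; congr (zpi S _); rewrite fr // ractDr.
  + move=> [y Fy [a _ <-]]; rewrite scalerDr scalerA !f'E //; last exact: mF.
    by rewrite fb // ractA.
- move=> v m Fm; rewrite -[m in LHS]addr0 -(scale0r x) f'E //; congr (zpi S _).
  congr pair; have := rB v 0 0; rewrite subrr => ->; exact: subrr.
Qed.

Lemma balanced_extend F s (G : zmodType) (f : V -> M -> G) :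
  submodule F -> balanced_on F f ->
  exists (G' : zmodType) (j : G -> G') (f' : V -> M -> G'),
    [/\ zmod_morphism j, forall g, j g = 0 -> g = 0,
        balanced_on (adjoin F s) f'
      & forall v m, F m -> f' v m = j (f v m)].
Proof.
move=> sF bf; elim: s => [|x s [G1 [j1 [f1 [j1B j10 bf1 f1E]]]]].
  by exists G, id, f; split.
have [G2 [j2 [f2 [j2B j20 bf2 f2E]]]] :=
  balanced_extend1 x (adjoin_submodule s sF) bf1.
exists G2, (j2 \o j1), f2; split=> // [g h|g /j20/j10//|v m Fm] /=.
  by rewrite j1B j2B.
by rewrite f2E ?f1E //; exact: adjoin_sub.
Qed.

(* Flatness of [V]: [V (x) F -> V (x) M] is injective for a submodule [F], with
   [V (x) F] replaced by its universal property. *)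
Lemma regular_flat F (G : zmodType) (f : V -> M -> G) (s : seq (V * M)) :
  submodule F -> balanced_on F f -> (forall z, z \in s -> F z.2) ->
  \sum_(z <- s) tens (@ract k V) (@GRing.scale k M) z.1 z.2 = 0 ->
  \sum_(z <- s) f z.1 z.2 = 0.
Proof.
move=> sF bf Fs.
have -> : \sum_(z <- s) tens (@ract k V) (@GRing.scale k M) z.1 z.2 =
    zpi (tens_rel (@ract k V) (@GRing.scale k M)) (\sum_(z <- s) << z >>).
  by rewrite raddf_sum; apply: eq_bigr => -[].
move=> /zpi_eq0/(tens_rel_finite sF)[xs].
have [G' [j [f' [jB j0 bf' f'E]]]] := balanced_extend xs sF bf.
move=> /(balanced_on_rel bf') f'0; apply: j0; rewrite zmorph_sum //.
apply: etrans f'0; rewrite (zmorph_sum (@fgsumB _ _ _ f')) [LHS]big_seq [RHS]big_seq.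
apply: eq_bigr => z /Fs Fz.
by rewrite fgsum1 f'E.
Qed.
End RegularFlat.

(** * Tor_3 and the right Koszul complex *)

Section ExtensionOfScalars.
Variables (k A : pzRingType) (sc : k -> A).
Variables (M : zmodType) (ra : M -> k -> M).

Definition lscal (c : k) (a : A) : A := sc c * a.

(** The right A-module M (x)_k A, written as a left module over the converse ring. *)
Definition ext : Type := tprod ra lscal.
HB.instance Definition _ := GRing.Zmodule.on ext.
Local Notation tn := (tens ra lscal).

Definition ext_scale (a : A^c) (t : ext) : ext :=
  tmap ra lscal ra lscal id (fun b : A => b * (a : A)) t.

Fact mulrB_morph (a : A) : zmod_morphism (fun b : A => b * a).
Proof. by move=> x y; rewrite mulrBl. Qed.

Lemma ext_scaleE (a : A^c) m (b : A) : ext_scale a (tn m b) = tn m (b * (a : A)).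
Proof.
apply: tmapE => //; first exact: mulrB_morph.
by move=> r n; rewrite /lscal mulrA.
Qed.
Fact ext_scaleB a : zmod_morphism (ext_scale a).
Proof.
apply: tmapB => //; first exact: mulrB_morph.
by move=> r n; rewrite /lscal mulrA.
Qed.
Lemma ext_ind (K : ext -> Prop) :
  (forall m a, K (tn m a)) -> (forall s t, K s -> K t -> K (s - t)) ->
  forall t, K t.
Proof.
move=> Kt KB; apply: (@tens_ind _ _ _ ra lscal) => //; split=> //.
by have := KB _ _ (Kt 0 0) (Kt 0 0); rewrite subrr.
Qed.
Fact ext_scaleA a b t : ext_scale a (ext_scale b t) = ext_scale (a * b) t.
Proof.
elim/ext_ind: t => [m x|s t IHs IHt]; last by rewrite !ext_scaleB IHs IHt.
by rewrite !ext_scaleE -mulrA.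
Qed.
Fact ext_scale1 t : ext_scale 1 t = t.
Proof.
elim/ext_ind: t => [m x|s t IHs IHt]; last by rewrite !ext_scaleB IHs IHt.
by rewrite !ext_scaleE mulr1.
Qed.
Fact ext_scaleDr : right_distributive ext_scale +%R.
Proof. by move=> a s t; apply: (zmorphD (@ext_scaleB a)). Qed.
Fact ext_scaleDl t : {morph ext_scale^~ t : a b / a + b}.
Proof.
move=> a b; elim/ext_ind: t => [m x|s t IHs IHt].
  by rewrite !ext_scaleE mulrDr tensDr.
by rewrite !ext_scaleB IHs IHt opprD addrACA.
Qed.
HB.instance Definition _ := GRing.Zmodule_isLmodule.Build A^c ext
  ext_scaleA ext_scale1 ext_scaleDr ext_scaleDl.

Definition etens m (a : A) : ext := tn m a.
Lemma etensZ (a : A) m b : (a : A^c) *: etens m b = etens m (b * a).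
Proof. exact: ext_scaleE. Qed.
Lemma etens1 m a : etens m a = (a : A^c) *: etens m 1.
Proof. by rewrite etensZ mul1r. Qed.
Lemma etensr m c : etens (ra m c) 1 = (sc c : A^c) *: etens m 1.
Proof. by rewrite etensZ mul1r /etens tens_bal /lscal mulr1. Qed.

Variables (Y : lmodType A^c) (f : M -> Y).
Definition ext_lift (t : ext) : Y := tlift (fun m (a : A) => (a : A^c) *: f m) t.
Hypotheses (fB : zmod_morphism f) (fr : forall m c, f (ra m c) = (sc c : A^c) *: f m).

Fact ext_lift_bal : balanced ra lscal (fun m (a : A) => (a : A^c) *: f m).
Proof.
split=> [m m' a|m a b|m r a]; first by rewrite zmorphD ?scalerDr.
  exact: scalerDl.
by rewrite fr scalerA.
Qed.
Lemma ext_liftE m a : ext_lift (etens m a) = (a : A^c) *: f m.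
Proof. exact: tliftE ext_lift_bal m a. Qed.
Lemma ext_liftB : zmod_morphism ext_lift.
Proof. exact: tlift_zmod_morphism ext_lift_bal. Qed.
Lemma ext_liftZ : scalable ext_lift.
Proof.
move=> a t; elim/ext_ind: t => [m b|s t IHs IHt].
  by rewrite [a *: _]etensZ !ext_liftE scalerA.
by rewrite scalerBr !ext_liftB IHs IHt scalerBr.
Qed.
End ExtensionOfScalars.

Section Projections.
Variables (A : pzRingType) (Agr : nat -> set A).

Record proj_spec (M : zmodType) (Mgr : nat -> set M) (pr : nat -> M -> M) : Prop :=
  ProjSpec {
    projB : forall n, zmod_morphism (pr n);
    proj_in : forall n x, Mgr n (pr n x);
    proj_id : forall n x, Mgr n x -> pr n x = x;
    proj_neq : forall m n x, m != n -> Mgr n x -> pr m x = 0;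
    proj_sum : forall x, exists K, x = \sum_(n < K) pr n x }.

(** Uniqueness of the homogeneous decomposition forces the chosen components to be additive. *)
Lemma graded_proj (M : lmodType A) (Mgr : nat -> set M) :
  graded_lmodule Agr Mgr -> exists pr, proj_spec Mgr pr.
Proof.
case=> gM _ dM; have {dM}[c cP] := choice dM.
have c_uniq x d : (forall n, Mgr n (d n)) ->
    (exists N, (forall n, (N <= n)%N -> d n = 0) /\ x = \sum_(n < N) d n) ->
    c x = d.
  by move=> dg dx; apply: (cP x).2; split.
have cB x y : c (x - y) = (fun n => c x n - c y n).
  have [[cx [N [xN xE]]] _] := cP x; have [[cy [K [yK yE]]] _] := cP y.
  apply: c_uniq => [n|]; first exact: subgroupB.
  exists (maxn N K); split=> [n|].
    by rewrite geq_max => /andP[/xN -> /yK ->]; rewrite subrr.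
  rewrite sumrB; congr (_ - _).
    rewrite {1}xE; apply: sum_trunc => // i; by rewrite geq_max => /andP[/xN].
  rewrite {1}yE; apply: sum_trunc => // i; by rewrite geq_max => /andP[_ /yK].
have c1 n x : Mgr n x -> c x = (fun m => if m == n then x else 0).
  move=> nx; apply: c_uniq => [m|].
    by case: eqP => [->//|_]; exact: subgroup0.
  exists n.+1; split=> [m nm|]; first by rewrite gtn_eqF.
  rewrite big_ord_recr big1 /= ?eqxx ?add0r // => i _.
  by rewrite ltn_eqF.
exists (fun n x => c x n); split.
- by move=> n x y; rewrite cB.
- by move=> n x; have [[]] := cP x.
- by move=> n x /c1 ->; rewrite eqxx.
- by move=> m n x /negbTE mn /c1 ->; rewrite mn.
- by move=> x; have [[_ [N [_ xE]]] _] := cP x; exists N.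
Qed.

Lemma proj_comm (M M' : zmodType) (Mgr : nat -> set M) (Mgr' : nat -> set M')
    (pr : nat -> M -> M) (pr' : nat -> M' -> M') (h : M -> M') :
  proj_spec Mgr pr -> proj_spec Mgr' pr' -> zmod_morphism h ->
  (forall n x, Mgr n x -> Mgr' n (h x)) ->
  forall n x, pr' n (h x) = h (pr n x).
Proof.
move=> sp sp' hB hgr n x; have [K xE] := proj_sum sp x.
rewrite [in RHS]xE [in LHS]xE !zmorph_sum //; try exact: (projB sp); try exact: (projB sp').
apply: eq_bigr => i _; have ip := proj_in sp i x.
have [<-|ni] := eqVneq (i : nat) n.
  by rewrite (proj_id sp ip) (proj_id sp' (hgr _ _ ip)).
rewrite eq_sym in ni.
by rewrite (proj_neq sp ni ip) (proj_neq sp' ni (hgr _ _ ip)) zmorph0.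
Qed.
End Projections.

Section TorThree.
Variables (k A : pzRingType) (Agr : nat -> set A) (sc : k -> A) (eps : A -> k).
Hypotheses (scB : zmod_morphism sc) (scM : forall c d, sc (c * d) = sc c * sc d).
Hypotheses (sc1 : sc 1 = 1) (sc_gr : forall c, Agr 0%N (sc c)).
Hypotheses (epsB : zmod_morphism eps) (epsM : forall a b, eps (a * b) = eps a * eps b).
Hypotheses (eps_sc : forall c, eps (sc c) = c).
Hypothesis (eps_gr : forall n a, n <> 0%N -> Agr n a -> eps a = 0).

Variables (V : zmodType) (raV : V -> k -> V) (vv : V -> A).
Hypotheses (vvB : zmod_morphism vv) (vv_gr : forall v, Agr 1%N (vv v)).
Hypothesis (vvr : forall v c, vv (raV v c) = vv v * sc c).
Hypothesis (eps_ker : forall a, eps a = 0 -> span [set vv v * b | v in setT & b in setT] a).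

Local Notation X1 := (ext sc raV).

Variables (M : zmodType) (raM : M -> k -> M) (g : M -> X1) (N' : nat).
Hypotheses (gB : zmod_morphism g) (gr : forall m c, g (raM m c) = (sc c : A^c) *: g m).
Hypothesis (g_gr : forall m, span [set etens sc raV v b | v in setT & b in Agr N'] (g m)).

Local Notation X2 := (ext sc raM).

(** [mu1] and [mu2] are the differentials V (x) A -> A and M (x) A -> V (x) A at the start of a
    resolution of the right module k; M plays the part of the relations. *)
Definition mu1 : X1 -> (A^c)^o := ext_lift (Y := (A^c)^o) vv.
Definition mu2 : X2 -> X1 := ext_lift g.

Lemma mu1E v a : mu1 (etens sc raV v a) = vv v * a.
Proof. exact: (@ext_liftE _ _ _ _ _ (A^c)^o vv vvB vvr). Qed.
Lemma mu1B : zmod_morphism mu1.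
Proof. exact: (@ext_liftB _ _ _ _ _ (A^c)^o vv vvB vvr). Qed.
Lemma mu1Z : scalable mu1.
Proof. exact: (@ext_liftZ _ _ _ _ _ (A^c)^o vv vvB vvr). Qed.
Lemma mu2E m a : mu2 (etens sc raM m a) = (a : A^c) *: g m.
Proof. exact: ext_liftE. Qed.
Lemma mu2B : zmod_morphism mu2. Proof. exact: ext_liftB. Qed.
Lemma mu2Z : scalable mu2. Proof. exact: ext_liftZ. Qed.

Hypothesis mu1g : forall m, mu1 (g m) = 0.
Hypothesis mu_exact : forall x, mu1 x = 0 -> exists y, mu2 y = x.

Variable Q : graded_flat_resolution Agr eps.

Local Notation tQ X i := (tprod (@rscale A X) (@GRing.scale A (Q i))).
Local Notation tn X i := (tens (@rscale A X) (@GRing.scale A (Q i))).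

Definition dQ (X : lmodType A^c) (i : nat) : tQ X i.+1 -> tQ X i :=
  tmap (@rscale A X) (@GRing.scale A (Q i.+1)) (@rscale A X) (@GRing.scale A (Q i))
    id (res_d Q i).
Definition mQ (X Y : lmodType A^c) (f : X -> Y) (i : nat) : tQ X i -> tQ Y i :=
  tmap (@rscale A X) (@GRing.scale A (Q i)) (@rscale A Y) (@GRing.scale A (Q i)) f id.

Lemma dQE X i x q : dQ (tn X i.+1 x q) = tn X i x (res_d Q i q).
Proof. by apply: tmapE => //; [exact: raddfB | move=> a y; rewrite linearZ]. Qed.
Lemma dQB X i : zmod_morphism (@dQ X i).
Proof. by apply: tmapB => //; [exact: raddfB | move=> a y; rewrite linearZ]. Qed.

Section MQ.
Variables (X Y : lmodType A^c) (f : X -> Y) (fB : zmod_morphism f) (fZ : scalable f).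
Lemma mQE i x q : mQ f (tn X i x q) = tn Y i (f x) q.
Proof. by apply: tmapE => // y a; exact: fZ. Qed.
Lemma mQB i : zmod_morphism (@mQ X Y f i).
Proof. by apply: tmapB => // y a; exact: fZ. Qed.
Lemma dmQ i t : dQ (mQ f t) = mQ f (@dQ X i t).
Proof.
apply: (@tens_eq _ _ _ _ _ _ (fun t => dQ (mQ f t)) (fun t => mQ f (dQ t)) _ _ _ t).
- by move=> x y; rewrite mQB dQB.
- by move=> x y; rewrite dQB mQB.
- by move=> x q; rewrite mQE !dQE mQE.
Qed.
End MQ.

Lemma ddQ X i (t : tQ X i.+2) : dQ (dQ t) = 0.
Proof.
apply: (@tens_eq _ _ _ _ _ _ (fun t => dQ (dQ t)) (fun t => 0) _ _ _ t).
- by move=> x y; rewrite !dQB.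
- by move=> x y; rewrite subr0.
- move=> x q; rewrite !dQE; have -> : res_d Q i (res_d Q i.+1 q) = 0.
    by apply/res_exact; exists q.
  exact: tens0r.
Qed.

Lemma ex_proj : exists res_proj : forall i, nat -> Q i -> Q i,
  forall i, proj_spec (@res_gr _ _ _ _ Q i) (res_proj i).
Proof.
have := fun i => graded_proj (res_graded Q i).
by move=> h; exists (fun i => projT1 (cid (h i))) => i; case: cid.
Qed.

Definition res_proj := projT1 (cid ex_proj).
Lemma res_projP i : proj_spec (@res_gr _ _ _ _ Q i) (@res_proj i).
Proof. by rewrite /res_proj; case: cid. Qed.

Lemma res_proj_d i n q : res_proj n (res_d Q i q) = res_d Q i (res_proj n q).
Proof.
apply: (proj_comm (res_projP _) (res_projP _)); first exact: raddfB.
by move=> m x; apply: res_d_gr.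
Qed.

Lemma res_gr_scale i m n a (x : Q i) : Agr m a -> res_gr n x -> res_gr (m + n)%N (a *: x).
Proof. by case: (res_graded Q i) => _ h _; apply: h. Qed.
Lemma res_gr_subgroup i n : subgroup (@res_gr _ _ _ _ Q i n).
Proof. by case: (res_graded Q i). Qed.

Lemma res_proj_sc i n c (q : Q i) : res_proj n (sc c *: q) = sc c *: res_proj n q.
Proof.
apply: (proj_comm (res_projP _) (res_projP _)) => [x y|m x xm]; first exact: scalerBr.
exact: (res_gr_scale (sc_gr c) xm).
Qed.

Lemma homogeneous_lift i m (x : Q i) :
  res_gr m x -> (exists y, res_d Q i y = x) -> exists2 y, res_gr m y & res_d Q i y = x.
Proof.
move=> xm [y yx]; exists (res_proj m y); first exact: proj_in (res_projP _) _ _.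
by rewrite -res_proj_d yx (proj_id (res_projP _) xm).
Qed.

Lemma ex_aug_unit : exists2 aug_unit, @res_gr _ _ _ _ Q 0 0%N aug_unit & res_aug Q aug_unit = 1.
Proof.
have [x x1] := res_aug_surj Q 1; exists (res_proj 0%N x); first exact: proj_in (res_projP _) _ _.
rewrite -x1; have [K] := proj_sum (res_projP 0) x.
case: K => [|K] xE.
  by rewrite xE big_ord0 (zmorph0 (projB (res_projP 0) 0)).
rewrite {2}xE big_ord_recl raddfD raddf_sum /= big1 ?addr0 // => i _.
by apply: (@res_aug_gr _ _ _ _ _ (bump 0 i)) => //; exact: proj_in (res_projP _) _ _.
Qed.

Definition aug_unit := projT1 (cid2 ex_aug_unit).
Lemma aug_unit_gr : res_gr 0%N aug_unit. Proof. by rewrite /aug_unit; case: cid2. Qed.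
Lemma aug_unit_aug : res_aug Q aug_unit = 1. Proof. by rewrite /aug_unit; case: cid2. Qed.

(** Elements of total degree [m] (not counting the degree of [M]) of
    M (x)_k Q_i, inside (M (x)_k A) (x)_A Q_i. *)
Definition hspan (M : zmodType) (ra : M -> k -> M) (i m : nat) : set (tQ (ext sc ra) i) :=
  span [set tn (ext sc ra) i (etens sc ra v 1) q | v in setT & q in res_gr m].

Lemma tens_etens (W : zmodType) (ra : W -> k -> W) i w a q :
  tn (ext sc ra) i (etens sc ra w a) q = tn (ext sc ra) i (etens sc ra w 1) (a *: q).
Proof. by rewrite etens1; apply: tens_bal. Qed.

(** For a of degree j > 0, eps a = 0, so a [aug_unit] lies in the kernel of the augmentation and is
    a boundary of an element of degree j. *)
Lemma chase_start j d : j <> 0%N ->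
  span [set etens sc raM m a | m in setT & a in Agr j] d ->
  exists2 x1, @hspan M raM 1 j x1 & dQ x1 = tn X2 0 d aug_unit.
Proof.
move=> j0; move: d; apply: span_elim.
- exists 0; first exact: subgroup0 (span_subgroup _).
  by rewrite (zmorph0 (@dQB _ _)) tens0l.
- move=> d d' [x hx xd] [x' hx' xd']; exists (x - x').
    exact: subgroupB (span_subgroup _) _ _ hx hx'.
  by rewrite dQB xd xd' tens_Bl.
- move=> _ [m _ [a aj <-]].
  have [||q q1 qa] := @homogeneous_lift 0 j (a *: aug_unit).
  + by rewrite -[j]addn0; apply: res_gr_scale => //; exact: aug_unit_gr.
  + by apply/res_exact0; rewrite res_augZ (eps_gr j0 aj) mul0r.
  exists (tn X2 1 (etens sc raM m 1) q).
    by apply: sub_span; exists m => //; exists q.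
  by rewrite dQE qa [RHS]tens_etens.
Qed.

(** The shift is the A-degree N' of g m in V (x) A. With the further letter multiplied in by
    [res_act], an element of M (x) A_j arrives in Q_3 in degree N' + j + 1. *)
Lemma mu2_hspan i m x : @hspan M raM i m x -> @hspan V raV i (N' + m) (mQ mu2 x).
Proof.
move: x; apply: (span_morph (@mQB _ _ _ mu2B mu2Z i)) => [|_ [w _ [q qm <-]]].
  exact: span_subgroup.
rewrite mQE; [|exact: mu2B|exact: mu2Z].
rewrite mu2E scale1r.
have tB : zmod_morphism (fun y => tn X1 i y q) by move=> y z; exact: tens_Bl.
apply: (span_morph tB) (g_gr w) => [|y]; first exact: span_subgroup.
move=> [v _ [b bN <-]]; rewrite tens_etens; apply: sub_span; exists v => //.
  by exists (b *: q) => //; apply: res_gr_scale.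
Qed.

(* The syzygy module [ker aug] is a direct summand of [Q_0] as a left [k]-module,
   so no flatness of [V] is needed here. *)
Lemma hspan_exact m t : @hspan V raV 1 m t -> dQ t = 0 ->
  exists2 x, @hspan V raV 2 m x & dQ x = t.
Proof.
pose S := @dQ X1 1 @` @hspan V raV 2 m.
have gS : subgroup S.
  have gh := span_subgroup [set tn X1 2 (etens sc raV v 1) q | v in setT & q in res_gr m].
  split=> [|_ _ [x hx <-] [y hy <-]].
    exists 0; [exact: subgroup0 gh | exact: zmorph0 (@dQB _ _)].
  exists (x - y); [exact: subgroupB gh _ _ hx hy | exact: dQB].
have /choice[l lP] : forall z : Q 0, exists y, res_aug Q z = 0 -> res_d Q 0 y = z.
  move=> z; have [/res_exact0[y yz]|nz] := pselect (res_aug Q z = 0).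
    by exists y.
  by exists 0.
(* The k-linear projection of Q_0 onto the kernel of the augmentation along k [aug_unit]. *)
pose nz q := q - sc (res_aug Q q) *: aug_unit.
have nz0 q : res_aug Q (nz q) = 0.
  by rewrite raddfB /= res_augZ eps_sc aug_unit_aug mulr1 subrr.
have nzB q q' : nz (q - q') = nz q - nz q'.
  by rewrite /nz raddfB scB scalerBl !opprB addrACA [RHS]addrACA [- q' - _]addrC.
have nzZ c q : nz (sc c *: q) = sc c *: nz q.
  by rewrite /nz res_augZ eps_sc scM scalerBr scalerA.
pose h q := res_proj m (l (nz q)).
(* Two choices of a lift to Q_1 differ by a cycle; its degree m component is a boundary, so its
   tensor with v lies in S. *)
have Sker v z : res_d Q 0 z = 0 -> S (tn X1 1 (etens sc raV v 1) (res_proj m z)).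
  move=> z0; have [||y ym <-] := @homogeneous_lift 1 m (res_proj m z).
  - exact: proj_in (res_projP _) _ _.
  - by apply/res_exact; rewrite -res_proj_d z0 (zmorph0 (projB (res_projP 0) m)).
  exists (tn X1 2 (etens sc raV v 1) y); last by rewrite dQE.
  by apply: sub_span; exists v => //; exists y.
(* Modulo S this sends (v, dq) to the class of v (x) q_m, with q_m the degree m component of q, and
   so inverts the differential on tensors of degree m. *)
pose psi0 v q := zpi S (tn X1 1 (etens sc raV v 1) (h q)).
have prB := projB (res_projP 1) m.
have dB : zmod_morphism (res_d Q 0) by exact: raddfB.
have psi0Br v q q' : psi0 v (q - q') = psi0 v q - psi0 v q'.
  rewrite /psi0 -raddfB -tens_Br; apply/zpi_eq; apply: sub_span; rewrite -tens_Br /h -!prB.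
  by apply: Sker; rewrite !dB !lP // nzB subrr.
have psi0Dr v q q' : psi0 v (q + q') = psi0 v q + psi0 v q'.
  by apply: (zmorphD (f := psi0 v)) => x y; exact: psi0Br.
have psi0Dl v v' q : psi0 (v + v') q = psi0 v q + psi0 v' q.
  by rewrite /psi0 -raddfD -tensDl /etens -tensDl.
have psi0bal v c q : psi0 (raV v c) q = psi0 v (sc c *: q).
  rewrite /psi0 etensr [tn _ _ (_ *: _) _]tens_bal; apply/zpi_eq; apply: sub_span.
  rewrite -tens_Br /h -res_proj_sc -prB; apply: Sker.
  by rewrite dB linearZ /= !lP // nzZ subrr.
have bal1 q : balanced raV (@lscal k A sc) (fun v a => psi0 v (a *: q)).
  split=> [v v' a|v a a'|v c a]; first exact: psi0Dl.
    by rewrite scalerDl psi0Dr.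
  by rewrite psi0bal scalerA.
pose psi1 (x : X1) q := tlift (fun v (a : A) => psi0 v (a *: q)) x.
have psi1E v a q : psi1 (etens sc raV v a) q = psi0 v (a *: q).
  exact: tliftE (bal1 q) v a.
have psi1B q : zmod_morphism (psi1^~ q) := tlift_zmod_morphism (bal1 q).
have bal2 : balanced (@rscale A X1) (@GRing.scale A (Q 0)) psi1.
  split=> [x x' q|x q q'|x a q].
  - exact: zmorphD (psi1B q) _ _.
  - elim/ext_ind: x => [v a|x x' IH IH'].
      by rewrite !psi1E scalerDr psi0Dr.
    by rewrite !psi1B IH IH' opprD addrACA.
  - elim/ext_ind: x => [v b|x x' IH IH'].
      by rewrite /rscale [_ *: _]etensZ !psi1E scalerA.
    by rewrite /rscale scalerBr !psi1B IH IH'.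
move=> ht t0.
suff /zpi_eq0 : zpi S t = 0 by rewrite span_id // => -[x hx xt]; exists x.
have -> : zpi S t = tlift psi1 (dQ t).
  pose K := [set t | zpi S t = tlift psi1 (dQ t)].
  apply: (@span_elim _ _ K) ht; rewrite /K /mkset.
  - by rewrite raddf0 (zmorph0 (@dQB _ _)) (zmorph0 (tlift_zmod_morphism bal2)).
  - move=> x y xE yE.
    by rewrite raddfB /= xE yE dQB (tlift_zmod_morphism bal2).
  - move=> _ [v _ [q qm <-]]; rewrite dQE (tliftE bal2) psi1E scale1r.
    apply/zpi_eq; apply: sub_span; rewrite -tens_Br -[q in q - _](proj_id (res_projP 1) qm).
    rewrite /h -prB; apply: Sker; rewrite raddfB /= lP // /nz.
    have -> : res_aug Q (res_d Q 0 q) = 0 by apply/res_exact0; exists q.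
    by rewrite (zmorph0 scB) scale0r subr0 subrr.
by rewrite t0 (zmorph0 (tlift_zmod_morphism bal2)).
Qed.

(** The map [mu1] tensored with Q_i, after the identification of A (x)_A Q_i with Q_i. Its image is
    A_+ Q_i, so its cokernel is the term k (x)_A Q_i that computes Tor. *)
Definition res_act i (t : tQ X1 i) : Q i := tlift (fun x q => (mu1 x : A) *: q) t.

Lemma res_act_bal i : balanced (@rscale A X1) (@GRing.scale A (Q i))
  (fun x q => (mu1 x : A) *: q).
Proof.
split=> [x x' q|x q q'|x a q]; last by rewrite /rscale mu1Z scalerA.
  by rewrite (zmorphD mu1B) scalerDl.
by rewrite scalerDr.
Qed.
Lemma res_actE i v a q : res_act (tn X1 i (etens sc raV v a) q) = vv v *: (a *: q).
Proof. by rewrite /res_act (tliftE (res_act_bal i)) mu1E scalerA. Qed.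
Lemma res_actB i : zmod_morphism (@res_act i).
Proof. exact: tlift_zmod_morphism (res_act_bal i). Qed.

Lemma res_act_d i t : res_act (dQ t) = res_d Q i (res_act t).
Proof.
apply: (@tens_eq _ _ _ _ _ _ (fun t => res_act (dQ t)) (fun t => res_d Q i (res_act t)) _ _ _ t).
- by move=> x y; rewrite dQB res_actB.
- by move=> x y; rewrite res_actB raddfB.
- by move=> x q; rewrite dQE /res_act !(tliftE (res_act_bal _)) linearZ.
Qed.

Lemma res_act_mu2 i t : res_act (@mQ _ _ mu2 i t) = 0.
Proof.
apply: (@tens_eq _ _ _ _ _ _ (fun t => res_act (mQ mu2 t)) (fun t => 0) _ _ _ t).
- by move=> x y; rewrite (mQB mu2B mu2Z) res_actB.
- by move=> x y; rewrite subr0.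
move=> x q; rewrite (mQE mu2B mu2Z) /res_act (tliftE (res_act_bal _)).
suff -> : mu1 (mu2 x) = 0 by rewrite scale0r.
elim/ext_ind: x => [m a|s u IHs IHu]; last by rewrite mu2B mu1B IHs IHu subrr.
by rewrite mu2E mu1Z mu1g scaler0.
Qed.

Lemma res_act_hspan i m t : @hspan V raV i m t -> res_gr m.+1 (res_act t).
Proof.
apply: (span_morph (@res_actB i)) => [|_ [v _ [q qm <-]]]; first exact: res_gr_subgroup.
by rewrite res_actE scale1r -add1n; apply: res_gr_scale.
Qed.

Lemma res_act_eps i a (q : Q i) : eps a = 0 -> exists y, res_act y = a *: q.
Proof.
move=> /eps_ker; move: a; apply: span_elim.
- by exists 0; rewrite scale0r (zmorph0 (@res_actB i)).
- by move=> a b [y ya] [z zb]; exists (y - z); rewrite res_actB ya zb scalerBl.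
- move=> _ [v _ [b _ <-]]; exists (tn X1 i (etens sc raV v b) q).
  by rewrite res_actE scalerA.
Qed.

Lemma Tor0_cycle i n t : (forall c : Tor Q i n, c = 0) -> kQ_cycle (i := i) n t ->
  exists s, kQ_d (Q := Q) (i := i) s = t.
Proof.
move=> T0 tn.
have gr4 : subgroup (@kQ_gr _ _ _ _ Q i.+1 n) by exact: span_subgroup.
have dB : zmod_morphism (@kQ_d _ _ _ _ Q i).
  by apply: tmapB => //; [exact: raddfB | move=> a y; rewrite linearZ].
set B := @kQ_d _ _ _ _ Q i @` @kQ_gr _ _ _ _ Q i.+1 n.
have gB' : subgroup B.
  split=> [|_ _ [x hx <-] [y hy <-]].
    exists 0; [exact: subgroup0 gr4 | exact: zmorph0 dB].
  exists (x - y); [exact: subgroupB gr4 _ _ hx hy | exact: dB].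
have gZ : subgroup (@kQ_cycle _ _ _ _ Q i n).
  case: (i) => [|j]; first exact: span_subgroup.
  have dB' : zmod_morphism (@kQ_d _ _ _ _ Q j).
    by apply: tmapB => //; [exact: raddfB | move=> a y; rewrite linearZ].
  have gj : subgroup (@kQ_gr _ _ _ _ Q j.+1 n) by exact: span_subgroup.
  split=> [|x y [xg /= x0] [yg /= y0]].
    split; [exact: subgroup0 gj | exact: zmorph0 dB'].
  by split; [exact: subgroupB gj _ _ xg yg | rewrite /= dB' x0 y0 subrr].
have tZ : t \in span_pred (@kQ_cycle _ _ _ _ Q i n) by rewrite span_predE span_id.
have := T0 (sqclass (kQ_cycle n) B t).
have vB : zmod_morphism (fun z : subz (@kQ_cycle _ _ _ _ Q i n) => subz_val z).
  exact: subz_valB.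
move=> /zpi_eq0; rewrite span_id; last exact: preim_subgroup vB _ (span_subgroup B).
rewrite /mkset insubdK // span_id // => -[s _ st].
by exists s.
Qed.

(** Since d x3 lies in A_+ Q_i, the element 1 (x) x3 is a cycle of k (x)_A Q, hence a boundary. This
    is carried back to Q by c (x) q |-> c q, well defined modulo A_+ Q_(i+1) plus the boundaries,
    which sends boundaries to 0. *)
Lemma chase_tor i m x2 x3 : (forall c : Tor Q i.+1 m.+1, c = 0) ->
  @hspan V raV i m x2 -> res_gr m.+1 x3 -> res_d Q i x3 = res_act x2 ->
  exists y z, x3 = res_act y + res_d Q i.+1 z.
Proof.
move=> T0 hx2 x3m dx3.
pose th i c q := tens (kright eps) (@GRing.scale A (Q i)) c q.
have kdE j c q : kQ_d (th j.+1 c q) = th j c (res_d Q j q).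
  by apply: tmapE => //; [exact: raddfB | move=> a y; rewrite linearZ].
have th_act : th i 1 (res_act x2) = 0.
  have B : zmod_morphism (fun t => th i 1 (res_act t)).
    by move=> x y; rewrite /th res_actB tens_Br.
  apply: (span_morph B (subgroup_set0 _) _ hx2).
  move=> _ [v _ [q _ <-]]; rewrite res_actE scale1r /th -tens_bal /kright.
  by rewrite (eps_gr (n := 1) _ (vv_gr v)) // mulr0 tens0l.
have [|s st] := @Tor0_cycle i.+1 m.+1 (th i.+1 1 x3) T0.
  split; last by rewrite /mkset kdE dx3.
  by apply: sub_span; exists 1 => //; exists x3.
pose S := [set x : Q i.+1 | exists y z, x = res_act y + res_d Q i.+1 z].
have gS : subgroup S.
  split=> [|_ _ [y [z ->]] [y' [z' ->]]].
    by exists 0, 0; rewrite (zmorph0 (@res_actB _)) raddf0 addr0.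
  by exists (y - y'), (z - z'); rewrite res_actB raddfB opprD addrACA.
have bal : balanced (kright eps) (@GRing.scale A (Q i.+1)) (fun c q => zpi S (sc c *: q)).
  split=> [c c' q|c q q'|c a q].
  - by rewrite (zmorphD scB) scalerDl raddfD.
  - by rewrite scalerDr raddfD.
  - apply/zpi_eq; apply: sub_span; rewrite /kright scalerA -scalerBl.
    (* Modulo A_+ Q, an element a of A acts through the scalar eps a. *)
    have [|y yE] := @res_act_eps i.+1 (sc (c * eps a) - sc c * a) q.
      by rewrite epsB eps_sc epsM eps_sc subrr.
    by exists y, 0; rewrite raddf0 addr0.
have x3S : zpi S x3 = tlift (fun c q => zpi S (sc c *: q)) (th i.+1 1 x3).
  by rewrite (tliftE bal) sc1 scale1r.
suff /zpi_eq0 : zpi S x3 = 0 by rewrite span_id.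
rewrite x3S -st.
apply: (@tens_eq _ _ _ _ _ _ (fun s => tlift (fun c q => zpi S (sc c *: q)) (kQ_d s))
  (fun _ => 0) _ _ _ s) => [x y|x y|c q]; last 1 first.
- rewrite kdE (tliftE bal); apply/zpi_eq0; apply: sub_span.
  by exists 0, (sc c *: q); rewrite (zmorph0 (@res_actB _)) add0r linearZ.
- rewrite /kQ_d tmapB ?(tlift_zmod_morphism bal) //; first exact: raddfB.
  by move=> a u; rewrite linearZ.
- by rewrite subr0.
Qed.

Definition syz : set X2 := [set x | mu2 x = 0].
Lemma syz_submodule : submodule syz.
Proof.
split; first exact: preim_subgroup mu2B _ (subgroup_set0 _).
by move=> a x; rewrite /syz /mkset mu2Z => ->; rewrite scaler0.
Qed.

Lemma Tor3_syz_generated j d : j <> 0%N ->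
  (forall c : Tor Q 3 (N' + j).+1, c = 0) ->
  span [set etens sc raM m a | m in setT & a in Agr j] d -> mu2 d = 0 ->
  span [set (a : A^c) *: x | x in syz & a in [set a | eps a = 0]] d.
Proof.
move=> j0 T0 dj d0.
(* Zigzag: [dx1 = d (x) aug_unit], [mu2 x1 = dx2], [res_act x2 = dx3]. By the Tor
   hypothesis [x3] is a boundary modulo [A_+ Q_3], so [x2] can be corrected to
   come from [z2] over [X2]; then [x1 - dz2] comes from [w1] over [syz]. *)
have [x1 hx1 dx1] := chase_start j0 dj.
have m2B i := @mQB _ _ _ mu2B mu2Z i.
have [||x2 hx2 dx2] := @hspan_exact (N' + j) (mQ mu2 x1).
- exact: mu2_hspan.
- rewrite (dmQ mu2B mu2Z) dx1 (mQE mu2B mu2Z) d0; exact: tens0l.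
have [||x3 x3m dx3] := @homogeneous_lift 2 (N' + j).+1 (res_act x2).
- exact: res_act_hspan.
- by apply/res_exact; rewrite -res_act_d dx2 res_act_mu2.
have [y [z x3E]] := chase_tor T0 hx2 x3m dx3.
have ax2 : res_act (x2 - dQ y) = 0.
  rewrite res_actB res_act_d -dx3 x3E raddfD /= addrAC subrr add0r.
  by apply/res_exact; exists z.
have [z2 z2E] : exists z2, mQ mu2 z2 = x2 - dQ y.
  have m1B := mQB mu1B mu1Z (i := 2).
  have : mQ (mu1 : X1 -> (A^c)^o) (x2 - dQ y) = 0.
    (* Every tensor over A (x)_A Q_2 can be written 1 (x) q, so vanishing under [res_act] is
       vanishing under [mu1] (x) Q_2, to which flatness of Q_2 applies. *)
    have E : forall t, mQ (mu1 : X1 -> (A^c)^o) t = tn (A^c)^o 2 1 (res_act t).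
      pose F1 t := mQ (mu1 : X1 -> (A^c)^o) (i := 2) t.
      pose F2 t := tn (A^c)^o 2 1 (@res_act 2 t).
      apply: (@tens_eq _ _ _ _ _ _ F1 F2) => [|u v|u q]; rewrite /F1 /F2.
      - exact: m1B.
      - by rewrite res_actB tens_Br.
      - rewrite (mQE mu1B mu1Z) /res_act (tliftE (res_act_bal _)) -tens_bal.
        by congr (tens _ _ _ _); exact: (esym (@mul1r A (mu1 u))).
    by rewrite E ax2; exact: tens0r.
  move/(flat_exact (@res_flat _ _ _ _ Q 2) mu1B mu1Z).
  move: (x2 - dQ y) => t; move: t; apply: span_elim.
  - by exists 0; rewrite (zmorph0 (m2B _)).
  - by move=> u v [a au] [b bv]; exists (a - b); rewrite m2B au bv.
  - move=> _ [u /mu_exact[w <-] [q _ <-]]; exists (tn X2 2 w q).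
    by rewrite (mQE mu2B mu2Z).
have : mQ mu2 (x1 - dQ z2) = 0.
  by rewrite m2B -(dmQ mu2B mu2Z) z2E -dx2 dQB ddQ subr0 subrr.
move/(flat_exact (@res_flat _ _ _ _ Q 1) mu2B mu2Z).
pose D : lmodType A^c := smod syz_submodule.
pose io : D -> X2 := @smval _ _ _ syz_submodule.
have ioB : zmod_morphism io by exact: smvalB.
have ioZ : scalable io by exact: smvalZ.
move=> h; have [w1 w1E] : exists w1, mQ io w1 = x1 - dQ z2.
  move: (x1 - dQ z2) h => t; move: t; apply: span_elim.
  - by exists 0; rewrite (zmorph0 (mQB ioB ioZ (i := _))).
  - by move=> u v [a au] [b bv]; exists (a - b); rewrite (mQB ioB ioZ) au bv.
  - move=> _ [u u0 [q _ <-]]; exists (tn D 1 (@smk _ _ _ syz_submodule u u0) q).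
    by rewrite (mQE ioB ioZ).
pose d' : D := @smk _ _ _ syz_submodule d d0.
(* Flatness of Q_0 allows this equality over D to be tested over X2. *)
have dw1 : dQ w1 = tn D 0 d' aug_unit.
  apply: (flat_sub (@res_flat _ _ _ _ Q 0)).
  change (mQ io (dQ w1) = mQ io (tn D 0 d' aug_unit)).
  rewrite -(dmQ ioB ioZ) w1E (mQE ioB ioZ) dQB ddQ subr0; exact: dx1.
set S := [set _ | _ in _ & _ in _].
(* The map D (x)_A Q_0 -> D / D A_+, with the target realised inside X2 / S. It kills boundaries and
   sends d (x) [aug_unit] to the class of d. *)
pose f (x : D) q := zpi S ((sc (res_aug Q q) : A^c) *: io x).
have bal : balanced (@rscale A D) (@GRing.scale A (Q 0)) f.
  split=> [x x' q|x q q'|x a q].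
  - by rewrite /f (zmorphD ioB) scalerDr raddfD.
  - by rewrite /f raddfD (zmorphD scB) -raddfD; congr (zpi S _); exact: scalerDl.
  - rewrite /f /rscale ioZ scalerA res_augZ scM; apply/zpi_eq; apply: sub_span.
    rewrite -scalerBl; exists (io x); first exact: smvalP.
    exists (a * sc (res_aug Q q) - sc (eps a) * sc (res_aug Q q)) => //.
    by rewrite /mkset epsB !epsM !eps_sc subrr.
apply/zpi_eq0; have -> : zpi S d = tlift f (dQ w1).
  by rewrite dw1 (tliftE bal) /f aug_unit_aug sc1 scale1r.
apply: (@tens_eq _ _ _ _ _ _ (fun w => tlift f (dQ w)) (fun _ => 0) _ _ _ w1).
- by move=> x x'; rewrite dQB (tlift_zmod_morphism bal).
- by move=> x x'; rewrite subr0.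
- move=> x q; rewrite dQE (tliftE bal) /f.
  have -> : res_aug Q (res_d Q 0 q) = 0 by apply/res_exact0; exists q.
  by rewrite (zmorph0 scB) [_ *: _](@scale0r A^c X2) raddf0.
Qed.
End TorThree.

(** * Homogeneous components in T(V) *)

Section DirectSumLift.
Variables (G : nat -> zmodType) (Z : zmodType) (f : forall n, G n -> Z).
Hypothesis fB : forall n, zmod_morphism (@f n).

Definition dlift (x : dsum G) : Z := \sum_(n < dbound x) f (x n).

Lemma dliftE (x : dsum G) K : (forall n, (K <= n)%N -> x n = 0) -> dlift x = \sum_(n < K) f (x n).
Proof.
move=> xK; apply: (@sum_trunc _ (fun n => f (x n))) => n.
  by move/dboundP ->; rewrite (zmorph0 (@fB n)).
by move/xK ->; rewrite (zmorph0 (@fB n)).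
Qed.

Lemma dliftB : zmod_morphism dlift.
Proof.
move=> x y; pose K := maxn (dbound x) (dbound y).
have xK n : (K <= n)%N -> x n = 0 by rewrite geq_max => /andP[/dboundP].
have yK n : (K <= n)%N -> y n = 0 by rewrite geq_max => /andP[_ /dboundP].
rewrite (dliftE xK) (dliftE yK) (@dliftE (x - y) K) => [|n Kn]; last first.
  by rewrite dcompB xK ?yK ?subrr.
by rewrite -sumrB; apply: eq_bigr => i _; rewrite dcompB fB.
Qed.

Lemma dlift_inj n (x : G n) : dlift (dinj x) = f x.
Proof.
rewrite (@dliftE _ n.+1) => [|m nm]; last by rewrite dinj_neq // neq_ltn nm.
have lt0 i : (i < n)%N -> f (dinj x i) = 0.
  by move=> ni; rewrite dinj_neq ?(zmorph0 (@fB _)) // neq_ltn ni orbT.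
rewrite big_ord_recr big1 => [|i _]; last exact: (lt0 i (ltn_ord i)).
by rewrite /= add0r; congr f; exact: dinj_id.
Qed.
End DirectSumLift.

Section TensorRingTheory.
Variables (k : pzRingType) (V : bimodType k).
Local Notation T := (tensor_ring V).
Local Notation inj n := (@dinj (tensor_graded V) n).
Local Notation tn n := (tens (@ract k V) (@GRing.scale k (tpow V n))).
Implicit Types (x y z : T) (v : V) (c : k).

Definition tvec v : T := inj 1%N (tn 0 v (1 : k^o)).
Definition hcomp n x : T := inj n (x n).

Lemma tvec_inj v n (w : tpow V n) : tvec v * inj n w = inj n.+1 (tn n v w).
Proof.
rewrite mul_dinj; congr (inj n.+1 _).
by apply: (etrans (@tpmul_tens k V 0 n v (1 : k^o) w)); congr (tn _ _ _); exact: scale1r.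
Qed.

Lemma tscalar_inj c n (w : tpow V n) : tscalar V c * inj n w = inj n (c *: w).
Proof. exact: mul_dinj. Qed.

Lemma tscalarB : zmod_morphism (tscalar V).
Proof. exact: (@dinjB (tensor_graded V) 0). Qed.
Lemma tscalarM c d : tscalar V (c * d) = tscalar V c * tscalar V d.
Proof. by rewrite tscalar_inj. Qed.
Lemma tscalar1 : tscalar V 1 = 1. Proof. by []. Qed.

Lemma tvecB : zmod_morphism tvec.
Proof. by move=> u v; rewrite /tvec -dinjB -tens_Bl. Qed.
Lemma tvec_ract v c : tvec (ract v c) = tvec v * tscalar V c.
Proof. by rewrite tvec_inj /tvec tens_bal; congr (inj 1 (tn 0 _ _)); exact: mulr1. Qed.
Lemma tvec_scale c v : tvec (c *: v) = tscalar V c * tvec v.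
Proof. by rewrite tscalar_inj; congr (inj 1 _); exact/esym/btens_scaleE. Qed.

Lemma hcompB n : zmod_morphism (hcomp n).
Proof. by move=> x y; rewrite /hcomp dcompB dinjB. Qed.
Lemma hcomp_inj n (w : tpow V n) : hcomp n (inj n w) = inj n w.
Proof. by rewrite /hcomp dinj_id. Qed.
Lemma hcomp_tgr n x : tgr n x -> hcomp n x = x.
Proof. by case=> w _ <-; rewrite hcomp_inj. Qed.
Lemma tgr_hcomp n x : tgr n (hcomp n x).
Proof. by exists (x n). Qed.
Lemma tgr_neq m n x : m != n -> tgr m x -> x n = 0.
Proof. by move=> mn [w _ <-]; rewrite dinj_neq. Qed.
Lemma hcomp_neq m n x : m != n -> tgr m x -> hcomp n x = 0.
Proof. by move=> mn /(tgr_neq mn) xn; rewrite /hcomp xn raddf0. Qed.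
Lemma hcomp_comp n x : hcomp n x n = x n.
Proof. exact: dinj_id. Qed.
Lemma tgrM m n x y : tgr m x -> tgr n y -> tgr (m + n)%N (x * y).
Proof. by move=> [u _ <-] [w _ <-]; rewrite mul_dinj; exists (gmul (g := tensor_graded V) u w). Qed.
Lemma tgr_tvec v : tgr 1%N (tvec v). Proof. by exists (tn 0 v (1 : k^o)). Qed.
Lemma tgr_tscalar c : tgr 0%N (tscalar V c). Proof. by exists c. Qed.

Lemma hcomp_ind (K : set T) : subgroup K -> (forall n x, tgr n x -> K x) -> forall x, K x.
Proof.
move=> gK Kn; elim/dsum_ind => [n w|x y Kx Ky]; last exact: subgroupD.
by apply: (Kn n); exists w.
Qed.

Lemma hcompMr n m x y : tgr m y -> hcomp (n + m)%N (x * y) = hcomp n x * y.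
Proof.
move=> ym; move: x; apply: hcomp_ind => [|p x xp].
  split=> [|x z /= xE zE]; first by rewrite mul0r !(zmorph0 (hcompB _)) mul0r.
  by rewrite mulrBl !hcompB mulrBl xE zE.
have [pn|pn] := eqVneq p n.
  by rewrite -pn (hcomp_tgr xp) hcomp_tgr //; exact: tgrM.
by rewrite /= (hcomp_neq pn xp) mul0r (hcomp_neq _ (tgrM xp ym)) // eqn_add2r.
Qed.

Lemma hcompMr_lt n m x y : (n < m)%N -> tgr m y -> hcomp n (x * y) = 0.
Proof.
move=> nm ym; move: x; apply: hcomp_ind => [|p x xp].
  split=> [|x z /= xE zE]; first by rewrite mul0r (zmorph0 (hcompB _)).
  by rewrite mulrBl !hcompB xE zE subrr.
rewrite /= (hcomp_neq _ (tgrM xp ym)) // neq_ltn; apply/orP; right.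
exact: leq_trans nm (leq_addl _ _).
Qed.

Lemma hcompMl n m x y : tgr m x -> hcomp (m + n)%N (x * y) = x * hcomp n y.
Proof.
move=> xm; move: y; apply: hcomp_ind => [|p y yp].
  split=> [|y z /= yE zE]; first by rewrite mulr0 !(zmorph0 (hcompB _)) mulr0.
  by rewrite mulrBr !hcompB mulrBr yE zE.
have [pn|pn] := eqVneq p n.
  by rewrite -pn (hcomp_tgr yp) hcomp_tgr //; exact: tgrM.
by rewrite /= (hcomp_neq pn yp) mulr0 (hcomp_neq _ (tgrM xm yp)) // eqn_add2l.
Qed.

Lemma hcomp_tvec n v y : hcomp n.+1 (tvec v * y) = inj n.+1 (tn n v (y n)).
Proof. exact: etrans (hcompMl n y (tgr_tvec v)) (tvec_inj _ _). Qed.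

Lemma hcompMl_lt n m x y : (n < m)%N -> tgr m x -> hcomp n (x * y) = 0.
Proof.
move=> nm xm; move: y; apply: hcomp_ind => [|p y yp].
  split=> [|y z /= yE zE]; first by rewrite mulr0 (zmorph0 (hcompB _)).
  by rewrite mulrBr !hcompB yE zE subrr.
rewrite /= (hcomp_neq _ (tgrM xm yp)) // neq_ltn; apply/orP; right.
exact: leq_trans nm (leq_addr _ _).
Qed.

Lemma tgrS n x : tgr n.+1 x -> span [set tvec v * y | v in setT & y in tgr n] x.
Proof.
move=> [w _ <-]; pose K := [set w : btens V (tpow V n) | 
  span [set tvec v * y | v in setT & y in tgr n] (inj n.+1 w)].
apply: (@btens_ind _ _ _ K) w => [v w|w w' Kw Kw'].
  apply: sub_span; exists v => //; exists (inj n w); first by exists w.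
  exact: tvec_inj.
by rewrite /K /= dinjB; apply: (subgroupB (span_subgroup _)).
Qed.

Lemma tgr0 x : tgr 0%N x -> exists c, x = tscalar V c.
Proof. by move=> [c _ <-]; exists c. Qed.

Lemma aug_span x : x 0%N = 0 -> span [set tvec v * y | v in setT & y in setT] x.
Proof.
(* Removing the degree 0 part yields an additive map on all of T(V), on which induction over
   homogeneous elements can run. *)
pose h z : T := z - tscalar V (z 0%N).
have hB : zmod_morphism h.
  by move=> y z; rewrite /h dcompB tscalarB !opprB addrACA [RHS]addrACA [- z - _]addrC.
have gS := span_subgroup [set tvec v * y | v in setT & y in setT].
move=> x0; have -> : x = h x by rewrite /h x0 (zmorph0 tscalarB) subr0.
move: x {x0}; apply: hcomp_ind => [|[|n] x xn]; first exact: preim_subgroup hB _ gS.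
  case: (tgr0 xn) => c ->; rewrite /mkset /h [tscalar V c 0%N]dinj_id subrr.
  exact: subgroup0 gS.
rewrite /mkset /h (tgr_neq _ xn) // (zmorph0 tscalarB) subr0.
by apply: spanS (tgrS xn) => _ [v _ [y _ <-]]; exists v => //; exists y.
Qed.
End TensorRingTheory.

(** * The complex R (x)_k A -> V (x)_k A -> A *)

Section GeneratedIdeal.
Variables (T : pzRingType) (E : set T).
Lemma ideal_gen_subgroup : subgroup (ideal_gen E). Proof. by case: (ideal_gen_ideal E). Qed.
Lemma ideal_genMl a x : ideal_gen E x -> ideal_gen E (a * x).
Proof. by case: (ideal_gen_ideal E) => _ h /(h a)[]. Qed.
Lemma ideal_genMr a x : ideal_gen E x -> ideal_gen E (x * a).
Proof. by case: (ideal_gen_ideal E) => _ h /(h a)[]. Qed.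
Lemma sub_ideal_gen x : E x -> ideal_gen E x.
Proof. by move=> Ex K [_]; apply. Qed.
Lemma qpi_eq0 x : qpi E x = 0 <-> ideal_gen E x.
Proof. by rewrite -(raddf0 (qpi E)) qpi_eq subr0. Qed.
End GeneratedIdeal.
Arguments ideal_gen_subgroup {T E}.
Arguments ideal_genMl {T E} a {x} _.
Arguments ideal_genMr {T E} a {x} _.
Arguments sub_ideal_gen {T E x} _.
Arguments qpi_eq0 {T E} x.

Section Relations.
Variables (k : pzRingType) (V : bimodType k) (N' : nat).
Local Notation T := (tensor_ring V).
Local Notation inj n := (@dinj (tensor_graded V) n).
Local Notation tn n := (tens (@ract k V) (@GRing.scale k (tpow V n))).
Variable P : set T.
Hypothesis bP : subbimodule P.

Local Notation R := (top_part N'.+1 P).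
Local Notation A := (qring R).
Local Notation I := (ideal_gen R).
Local Notation pi := (@qpi T R).

Lemma top_part_hcomp p : P p -> R (hcomp N'.+1 p).
Proof. by move=> Pp; exists p. Qed.
Lemma top_part_tgr r : R r -> tgr N'.+1 r.
Proof. by case=> p _ <-; exact: tgr_hcomp. Qed.
Lemma top_part0 r : R r -> r 0%N = 0.
Proof. by move/top_part_tgr; apply: tgr_neq. Qed.
Lemma top_part_scale c r : R r -> R (tscalar V c * r).
Proof.
case=> p Pp <-; exists (tscalar V c * p); first by case: (bP.2 c p Pp).
change (hcomp N'.+1 (tscalar V c * p) = tscalar V c * hcomp N'.+1 p).
exact: hcompMl _ p (tgr_tscalar V c).
Qed.

(** In a product a r b, a left factor a of degree 0 is absorbed into R, and one of positive degree
    starts with a vector, leaving an element of I behind it. *)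
Lemma ideal_decomp y : I y ->
  span ([set r * t | r in R & t in setT] `|` [set tvec v * z | v in setT & z in I]) y.
Proof.
set S := _ `|` _; have gS := span_subgroup S.
(* Membership in I is carried along because left multiplication by a vector has to land in V I. *)
suff KI : ideal [set y | I y /\ span S y].
  have RK : R `<=` [set y | I y /\ span S y].
    move=> r Rr; split; first exact: sub_ideal_gen.
    by apply: sub_span; left; exists r => //; exists 1; rewrite ?mulr1.
  by move=> /(_ _ (conj KI RK))[].
split.
  split=> [|x z [Ix Sx] [Iz Sz]].
    by split; [exact: subgroup0 ideal_gen_subgroup | exact: subgroup0 gS].
  by split; [exact: subgroupB ideal_gen_subgroup _ _ Ix Iz | exact: subgroupB gS _ _ Sx Sz].
move=> a x [Ix Sx]; split; split; [exact: ideal_genMl| |exact: ideal_genMr|].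
  have mxB : zmod_morphism (fun a => a * x) by move=> b c; rewrite mulrBl.
  move: a; apply: hcomp_ind => [|[|n] a an]; first exact: preim_subgroup mxB _ gS.
    have [c ->] := tgr0 an; rewrite /mkset.
    have cB : zmod_morphism (fun y => tscalar V c * y) by move=> b d; rewrite mulrBr.
    apply: (span_morph cB gS _ Sx) => _ [[r Rr [t _ <-]]|[v _ [z Iz <-]]].
      apply: sub_span; left; exists (tscalar V c * r); first exact: top_part_scale.
      by exists t; rewrite ?mulrA.
    apply: sub_span; right; exists (c *: v) => //; exists z => //.
    by rewrite tvec_scale mulrA.
  apply: (span_morph mxB gS _ (tgrS an)) => _ [v _ [b _ <-]].
  apply: sub_span; right; exists v => //; exists (b * x); first exact: ideal_genMl.
  by rewrite mulrA.
have aB : zmod_morphism (fun y : T => y * a) by move=> b d; rewrite mulrBl.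
apply: (span_morph aB gS _ Sx) => _ [[r Rr [t _ <-]]|[v _ [z Iz <-]]].
  by apply: sub_span; left; exists r => //; exists (t * a); rewrite ?mulrA.
apply: sub_span; right; exists v => //; exists (z * a); first exact: ideal_genMr.
by rewrite mulrA.
Qed.

Lemma ideal_hcomp n x : I x -> I (hcomp n x).
Proof.
have gI : subgroup I := ideal_gen_subgroup.
suff KI : ideal [set x | forall n, I (hcomp n x)].
  have RK : R `<=` [set x | forall n, I (hcomp n x)].
    move=> r Rr m; have [<-|Nm] := eqVneq N'.+1 m.
      by rewrite (hcomp_tgr (top_part_tgr Rr)); exact: sub_ideal_gen.
    by rewrite (hcomp_neq Nm (top_part_tgr Rr)); exact: subgroup0 gI.
  by move=> /(_ _ (conj KI RK)).
split=> [|a y Iy].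
  split=> [m|y z Iy Iz m]; first by rewrite (zmorph0 (hcompB _)); exact: subgroup0 gI.
  by rewrite hcompB; exact: subgroupB gI _ _ (Iy m) (Iz m).
split=> m; move: a.
  have mB : zmod_morphism (fun a => hcomp m (a * y)) by move=> b c; rewrite mulrBl hcompB.
  apply: hcomp_ind => [|p a ap]; first exact: preim_subgroup mB _ gI.
  rewrite /mkset; have [mp|pm] := ltnP m p.
    by rewrite (hcompMl_lt _ mp ap); exact: subgroup0 gI.
  by rewrite -(subnKC pm) hcompMl //; exact: ideal_genMl.
have mB : zmod_morphism (fun a => hcomp m (y * a)) by move=> b c; rewrite mulrBr hcompB.
apply: hcomp_ind => [|p a ap]; first exact: preim_subgroup mB _ gI.
rewrite /mkset; have [mp|pm] := ltnP m p.
  by rewrite (hcompMr_lt _ mp ap); exact: subgroup0 gI.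
by rewrite -(subnK pm) hcompMr //; exact: ideal_genMr.
Qed.

Definition qsc c : A := pi (tscalar V c).
Local Notation X1 := (ext qsc (@ract k V)).
Local Notation et := (etens qsc (@ract k V)).

(** The map T(V)_+ -> V (x)_k A sending [v t] to [v (x) t], extended by 0 in
    degree 0. *)
Definition lead_comp n : tpow V n -> X1 :=
  if n is m.+1 then
    tmap (@ract k V) (@GRing.scale k (tpow V m)) (@ract k V) (lscal qsc)
      id (fun w => pi (inj m w))
  else fun=> 0.

Definition lead : T -> X1 := dlift lead_comp.

Fact qpi_inj_lin n : zmod_morphism (fun w : tpow V n => pi (inj n w)) /\
  forall c (w : tpow V n), pi (inj n (c *: w)) = lscal qsc c (pi (inj n w)).
Proof.
by split=> [u w|c w]; [rewrite dinjB raddfB | rewrite -tscalar_inj rmorphM].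
Qed.

Fact lead_compB n : zmod_morphism (@lead_comp n).
Proof.
case: n => [|n]; first by move=> x y; rewrite subr0.
by apply: tmapB => //; case: (qpi_inj_lin n).
Qed.

Lemma leadB : zmod_morphism lead. Proof. exact: dliftB lead_compB. Qed.

Lemma lead_tvec v y : lead (tvec v * y) = et v (pi y).
Proof.
move: y; apply: hcomp_ind => [|n _ [w _ <-]].
  split=> [|x y /= xE yE]; first by rewrite mulr0 (zmorph0 leadB) raddf0 [et _ _]tens0r.
  by rewrite mulrBr leadB xE yE raddfB /etens tens_Br.
rewrite /mkset tvec_inj; apply: etrans (dlift_inj lead_compB _) _.
by apply: tmapE => //; case: (qpi_inj_lin n).
Qed.

Lemma leadM (x y : T) : x 0%N = 0 -> lead (x * y) = (pi y : A^c) *: lead x.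
Proof.
move/aug_span; move: x; apply: span_elim.
- by rewrite mul0r (zmorph0 leadB) scaler0.
- by move=> x z xE zE; rewrite mulrBl !leadB scalerBr xE zE.
- move=> _ [v _ [z _ <-]]; rewrite -mulrA !lead_tvec etensZ.
  by congr (et _ _); apply: rmorphM.
Qed.

(** [P], isomorphic to [R], as a right [k]-module. *)
Definition raP (p : subz P) c : subz P := insubd 0 (subz_val p * tscalar V c).

Fact subzP (p : subz P) : P (subz_val p).
Proof. by have := subz_valP p; rewrite span_predE span_id //; exact: bP.1. Qed.
Lemma raPE p c : subz_val (raP p c) = subz_val p * tscalar V c.
Proof.
apply: insubdK; rewrite span_predE span_id; last exact: bP.1.
by case: (bP.2 c _ (subzP p)).
Qed.
Definition subP p (Pp : P p) : subz P := insubd 0 p.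
Lemma subPE p (Pp : P p) : subz_val (subP Pp) = p.
Proof. by apply: insubdK; rewrite span_predE span_id //; exact: bP.1. Qed.

Local Notation X2 := (ext qsc raP).

Definition relmap (p : subz P) : X1 := lead (hcomp N'.+1 (subz_val p)).

Lemma relmapB : zmod_morphism relmap.
Proof. by move=> p q; rewrite /relmap subz_valB hcompB leadB. Qed.
Lemma relmapr p c : relmap (raP p c) = (qsc c : A^c) *: relmap p.
Proof.
rewrite /relmap raPE; have := hcompMr N'.+1 (subz_val p) (tgr_tscalar V c).
rewrite addn0 => ->; apply: leadM; exact: (tgr_neq _ (tgr_hcomp _ _)).
Qed.
Lemma relmap_gr p : span [set et v b | v in setT & b in qgr R N'] (relmap p).
Proof.
apply: (span_morph leadB (span_subgroup _) _ (tgrS (tgr_hcomp N'.+1 (subz_val p)))).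
move=> _ [v _ [y yN <-]]; rewrite lead_tvec; apply: sub_span; exists v => //.
by exists (pi y) => //; exists y.
Qed.

Definition qvec v : A := pi (tvec v).
Lemma qvecB : zmod_morphism qvec. Proof. by move=> u v; rewrite /qvec tvecB raddfB. Qed.
Lemma qvecr v c : qvec (ract v c) = qvec v * qsc c.
Proof. by rewrite /qvec tvec_ract rmorphM. Qed.

Local Notation m1 := (mu1 (sc := qsc) (raV := @ract k V) qvec).
Local Notation m2 := (mu2 (raM := raP) relmap).

Lemma mu1_lead (x : T) : x 0%N = 0 -> m1 (lead x) = pi x.
Proof.
move/aug_span; move: x; apply: span_elim.
- by rewrite (zmorph0 leadB) (zmorph0 (mu1B qvecB qvecr)) raddf0.
- by move=> x y xE yE; rewrite leadB (mu1B qvecB qvecr) xE yE raddfB.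
- by move=> _ [v _ [y _ <-]]; rewrite lead_tvec (mu1E qvecB qvecr) -rmorphM.
Qed.

Lemma mu1_relmap p : m1 (relmap p) = 0.
Proof.
rewrite mu1_lead; last exact: (tgr_neq _ (tgr_hcomp _ _)).
by apply/qpi_eq0; apply: sub_ideal_gen; apply: top_part_hcomp; exact: subzP.
Qed.

(** Of the two summands of I, the products r t are values of [mu2], and V I dies in V (x) A. This
    gives exactness at V (x) A. *)
Lemma mu2_range_ideal y : I y -> range m2 (lead y).
Proof.
have m2B := mu2B relmapB relmapr.
have gm := range_subgroup m2B.
move/ideal_decomp; apply: (span_morph leadB gm) => _ [[_ [p Pp <-] [t _ <-]]|[v _ [z Iz <-]]].
  rewrite leadM; last exact: (tgr_neq _ (tgr_hcomp N'.+1 p)).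
  exists (etens qsc raP (subP Pp) (pi t)) => //.
  by rewrite (mu2E relmapB relmapr) /relmap subPE.
rewrite lead_tvec (iffRL (qpi_eq0 z) Iz) [et _ _]tens0r.
exact: subgroup0 gm.
Qed.

Lemma mu_exact x : m1 x = 0 -> exists y, m2 y = x.
Proof.
have m2B := mu2B relmapB relmapr.
have gm := range_subgroup m2B.
have m1B := mu1B qvecB qvecr.
have [y [y0 yx]] : exists y : T, y 0%N = 0 /\ lead y = x.
  elim/ext_ind: x => [v a|s t [y [y0 <-]] [z [z0 <-]]].
    exists (tvec v * qrepr a); split; last by rewrite lead_tvec qreprK.
    by rewrite tmul_comp0 (tgr_neq _ (tgr_tvec v)) //; exact: mul0r.
  by exists (y - z); rewrite dcompB y0 z0 subrr leadB.
rewrite -yx mu1_lead // => /qpi_eq0/mu2_range_ideal[z _ <-].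
by exists z.
Qed.

Local Notation eps := (qaug R).

Lemma eps_qpi x : eps (pi x) = x 0%N.
Proof. by apply: qaugE; exact: top_part0. Qed.

Variable Q : graded_flat_resolution (qgr R) eps.

Lemma syz_generated j d : j <> 0%N ->
  (forall c : Tor Q 3 (N' + j).+1, c = 0) ->
  span [set etens qsc raP m a | m in setT & a in qgr R j] d -> m2 d = 0 ->
  span [set (a : A^c) *: x | x in [set x | m2 x = 0] & a in [set a | eps a = 0]] d.
Proof.
have epsB : zmod_morphism eps.
  move=> a b; rewrite -[a]qreprK -[b]qreprK -raddfB !eps_qpi; exact: dcompB.
have epsM a b : eps (a * b) = eps a * eps b.
  rewrite -[a]qreprK -[b]qreprK -rmorphM !eps_qpi; exact: tmul_comp0.
have qscB : zmod_morphism qsc by move=> c d'; rewrite /qsc tscalarB raddfB.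
have qscM a b : qsc (a * b) = qsc a * qsc b by rewrite /qsc tscalarM rmorphM.
have qsc1 : qsc 1 = 1 by rewrite /qsc tscalar1 rmorph1.
have qsc_gr c : qgr R 0 (qsc c) by exists (tscalar V c) => //; exact: tgr_tscalar.
have eps_sc c : eps (qsc c) = c by rewrite eps_qpi; exact: dinj_id.
have eps_gr n a : n <> 0%N -> qgr R n a -> eps a = 0.
  by move=> /eqP n0 [x xn <-]; rewrite eps_qpi (tgr_neq n0 xn).
have qvec_gr v : qgr R 1 (qvec v) by exists (tvec v) => //; exact: tgr_tvec.
have eps_ker a : eps a = 0 -> span [set qvec v * b | v in setT & b in setT] a.
  rewrite -[a]qreprK eps_qpi => /aug_span.
  have piB : zmod_morphism pi by exact: raddfB.
  apply: (span_morph piB (span_subgroup _)) => _ [v _ [y _ <-]].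
  by apply: sub_span; exists v => //; exists (pi y) => //; rewrite -rmorphM.
exact: (Tor3_syz_generated qscB qscM qsc1 qsc_gr epsB epsM eps_sc eps_gr qvecB
  qvec_gr qvecr eps_ker relmapB relmapr relmap_gr mu1_relmap mu_exact).
Qed.
End Relations.
Arguments ideal_hcomp {k V N' P} n {x} _.

(** * The filtration of I(P) *)

Lemma span_setU (G : zmodType) (S S' : set G) x : span (S `|` S') x ->
  exists y z, [/\ span S y, span S' z & x = y + z].
Proof.
move: x; apply: span_elim.
- exists 0, 0; rewrite addr0; split=> //; exact: subgroup0 (span_subgroup _).
- move=> _ _ [y [z [Sy Sz ->]]] [y' [z' [Sy' Sz' ->]]]; exists (y - y'), (z - z').
  rewrite opprD addrACA; split=> //; exact: subgroupB (span_subgroup _) _ _ _ _.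
- move=> x [Sx|Sx]; [exists x, 0 | exists 0, x]; rewrite ?addr0 ?add0r;
    split=> //; try exact: sub_span; exact: subgroup0 (span_subgroup _).
Qed.

Section Filtration.
Variables (k : pzRingType) (V : bimodType k).
Local Notation T := (tensor_ring V).

Lemma tgr_tfil n x : @tgr k V n x -> tfil n x.
Proof. by move=> xn m nm; rewrite (tgr_neq _ xn) // neq_ltn nm. Qed.
Lemma tfilW m n (x : T) : (m <= n)%N -> tfil m x -> tfil n x.
Proof. by move=> mn xm p np; apply: xm; exact: leq_ltn_trans np. Qed.
Lemma tfil_sum n (x : T) : tfil n x -> x = \sum_(i < n.+1) hcomp i x.
Proof. exact: dsumE. Qed.
Lemma tfil_ind n (K : set T) : subgroup K ->
  (forall m x, (m <= n)%N -> tgr m x -> K x) -> forall x, tfil n x -> K x.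
Proof.
move=> gK Km x /tfil_sum ->; apply: (subgroup_sum gK) => i.
by apply: (Km i); [rewrite -ltnS | exact: tgr_hcomp].
Qed.
Lemma tfil_dbound (x : T) : tfil (dbound x) x.
Proof. by move=> m /ltnW /dboundP. Qed.
Lemma tfilB n (x y : T) : tfil n x -> tfil n y -> tfil n (x - y).
Proof. by move=> xn yn m nm; rewrite dcompB xn ?yn ?subrr. Qed.
Lemma tfil_cancel n (x y : T) :
  tfil n.+1 x -> tfil n.+1 y -> hcomp n.+1 x = hcomp n.+1 y -> tfil n (x - y).
Proof.
move=> xn yn xy m; rewrite leq_eqVlt => /predU1P[<-|nm].
  by rewrite dcompB -[x _]hcomp_comp xy hcomp_comp subrr.
exact: tfilB xn yn m nm.
Qed.

Variables (N' : nat) (P : set T).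
Hypotheses (N'gt0 : (0 < N')%N) (bP : subbimodule P) (PN : P `<=` tfil N'.+1).
Local Notation N := N'.+1.
Local Notation R := (top_part N P).
Local Notation A := (qring R).
Local Notation I := (ideal_gen R).
Local Notation pi := (@qpi T R).

(** The part of I(P) visibly of filtration degree at most [n]. *)
Definition ifil n : set T := span [set x | exists i j a p b,
  [/\ (i + N + j <= n)%N, tgr i a, P p, tgr j b & x = a * p * b]].

Lemma ifil_subgroup n : subgroup (ifil n). Proof. exact: span_subgroup. Qed.
Lemma ifilW m n : (m <= n)%N -> ifil m `<=` ifil n.
Proof.
move=> mn; apply: spanS => _ [i [j [a [p [b [ijm ai Pp bj ->]]]]]].
by exists i, j, a, p, b; split=> //; apply: leq_trans mn.
Qed.
Lemma ifil_gen p : P p -> ifil N p.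
Proof.
move=> Pp; apply: sub_span; exists 0%N, 0%N, 1, p, 1; rewrite mul1r mulr1 addn0.
by split=> //; rewrite -tscalar1; exact: tgr_tscalar.
Qed.
Lemma ifil_scalars i j a p b : (i + N + j <= N)%N -> tgr i a -> P p -> tgr j b ->
  [/\ i = 0%N, j = 0%N & P (a * p * b)].
Proof.
have [P0 hP] := bP.
move=> ijN ai Pp bj; have ij : (i + j <= 0)%N by rewrite -(leq_add2r N) add0n addnAC.
move: ij ai bj; rewrite leqn0 addn_eq0 => /andP[/eqP-> /eqP->].
move=> /tgr0[c ->] /tgr0[d ->]; split=> //.
by case: (hP d (tscalar V c * p)) => //; case: (hP c p).
Qed.
Lemma ifil_N x : ifil N x -> P x.
Proof.
have [P0 _] := bP; move: x; apply: span_min => // _ [i [j [a [p [b [ijN ai Pp bj ->]]]]]].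
by case: (ifil_scalars ijN ai Pp bj).
Qed.
Lemma ifil_lt n x : (n < N)%N -> ifil n x -> x = 0.
Proof.
move=> nN; apply: (@span_min _ _ [set 0]); first exact: subgroup_set0.
move=> _ [i [j [a [p [b [ijn _ _ _ ->]]]]]].
have := leq_ltn_trans ijn nN; rewrite addnAC ltnNge leq_addl //.
Qed.
Lemma ifil_tfil n x : ifil n x -> tfil n x.
Proof.
move: x; apply: span_min; first exact: tfil_subgroup.
move=> _ [i [j [a [p [b [ijn ai Pp bj ->]]]]]]; apply: tfilW ijn _.
by apply: tfilM; [apply: tfilM; [exact: tgr_tfil | exact: PN] | exact: tgr_tfil].
Qed.
Lemma ifil_Ml m n a x : tfil m a -> ifil n x -> ifil (m + n)%N (a * x).
Proof.
move=> am nx; move: a am; apply: tfil_ind => [|i a im ai].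
  apply: (@preim_subgroup _ _ (fun a => a * x)); last exact: ifil_subgroup.
  by move=> u v; rewrite mulrBl.
apply: ifilW (leq_add im (leqnn n)) _ _; move: x nx.
have aB : zmod_morphism (fun x : T => a * x) by move=> u v; rewrite mulrBr.
apply: (span_morph aB (ifil_subgroup _)).
move=> _ [i' [j [a' [p [b [ijn ai' Pp bj ->]]]]]]; apply: sub_span.
exists (i + i')%N, j, (a * a'), p, b; split=> //; last by rewrite !mulrA.
  by rewrite -!addnA leq_add2l addnA.
exact: tgrM.
Qed.
Lemma ifil_Mr m n b x : tfil m b -> ifil n x -> ifil (n + m)%N (x * b).
Proof.
move=> bm nx; move: b bm; apply: tfil_ind => [|j b jm bj].
  apply: (@preim_subgroup _ _ (fun b => x * b)); last exact: ifil_subgroup.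
  by move=> u v; rewrite mulrBr.
apply: ifilW (leq_add (leqnn n) jm) _ _; move: x nx.
have aB : zmod_morphism (fun x : T => x * b) by move=> u v; rewrite mulrBl.
apply: (span_morph aB (ifil_subgroup _)).
move=> _ [i [j' [a [p [b' [ijn ai Pp bj' ->]]]]]]; apply: sub_span.
exists i, (j' + j)%N, a, p, (b' * b); split=> //; last by rewrite !mulrA.
  by rewrite addnA leq_add2r.
exact: tgrM.
Qed.

Lemma ifil_top n x : ifil n x -> I (hcomp n x).
Proof.
move: x; apply: (span_morph (@hcompB _ _ n) (@ideal_gen_subgroup T R)).
move=> _ [i [j [a [p [b [ijn ai Pp bj ->]]]]]].
move: ijn; rewrite leq_eqVlt => /predU1P[<-|ijn].
  rewrite hcompMr // hcompMl //.
  exact: (ideal_genMr _ (ideal_genMl _ (sub_ideal_gen (top_part_hcomp N' Pp)))).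
have : tfil (i + N + j) (a * p * b).
  by apply: tfilM; [apply: tfilM; [exact: tgr_tfil | exact: PN] | exact: tgr_tfil].
by move/(_ n ijn) => x0; rewrite /hcomp x0 raddf0; exact: subgroup0 ideal_gen_subgroup.
Qed.

(** Replacing every relation in R by an element of P with that top component turns an expression in
    I(R) into one in J n. Together with [ifil_top], the degree n part of I(R) is exactly the set of
    degree n components of J n. *)
Lemma ifil_lift n y : I y -> exists2 x, ifil n x & hcomp n x = hcomp n y.
Proof.
pose K n := [set y | exists2 x, ifil n x & hcomp n x = hcomp n y].
have gK m : subgroup (K m).
  split=> [|u v [x xv xu] [y' yv yu]].
    by exists 0; first exact: subgroup0 (ifil_subgroup _).
  exists (x - y'); first exact: subgroupB (ifil_subgroup _) _ _ xv yv.
  by rewrite !hcompB xu yu.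
suff KI : ideal [set y | forall n, K n y].
  have RK : R `<=` [set y | forall n, K n y].
    move=> _ [p Pp <-] m; have [<-|Nm] := eqVneq N m.
      by exists p; [exact: ifil_gen | rewrite hcomp_inj].
    exists 0; first exact: subgroup0 (ifil_subgroup _).
    by rewrite (zmorph0 (@hcompB _ _ _)) (hcomp_neq Nm (tgr_hcomp _ _)).
  by move=> /(_ _ (conj KI RK))/(_ n).
split=> [|a u Ku].
  split=> [m|u v Ku Kv m]; first exact: subgroup0 (gK m).
  exact: subgroupB (gK m) _ _ (Ku m) (Kv m).
split=> m; move: a.
  have mB : zmod_morphism (fun a : T => a * u) by move=> b c; rewrite mulrBl.
  apply: hcomp_ind => [|p a ap]; first exact: preim_subgroup mB _ (gK m).
  have [mp|pm] := ltnP m p.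
    exists 0; first exact: subgroup0 (ifil_subgroup _).
    by rewrite (zmorph0 (@hcompB _ _ _)) (hcompMl_lt _ mp ap).
  have [x xv xu] := Ku (m - p)%N; rewrite -(subnKC pm).
  exists (a * x); first by apply: ifil_Ml => //; exact: tgr_tfil.
  by rewrite !hcompMl // xu.
have mB : zmod_morphism (fun a : T => u * a) by move=> b c; rewrite mulrBr.
apply: hcomp_ind => [|p a ap]; first exact: preim_subgroup mB _ (gK m).
have [mp|pm] := ltnP m p.
  exists 0; first exact: subgroup0 (ifil_subgroup _).
  by rewrite (zmorph0 (@hcompB _ _ _)) (hcompMr_lt _ mp ap).
have [x xv xu] := Ku (m - p)%N; rewrite -(subnK pm).
exists (x * a); first by apply: ifil_Mr => //; exact: tgr_tfil.
by rewrite !hcompMr // xu.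
Qed.

Lemma ideal_gen_ifil x : ideal_gen P x <-> exists n, ifil n x.
Proof.
split=> [|[n]].
  suff KI : ideal [set x | exists n, ifil n x].
    have PK : P `<=` [set x | exists n, ifil n x].
      by move=> p Pp; exists N; exact: ifil_gen.
    by move=> /(_ _ (conj KI PK)).
  split=> [|a y [m my]].
    split=> [|y z [m my] [p pz]]; first by exists 0%N; exact: subgroup0 (ifil_subgroup _).
    exists (maxn m p); apply: subgroupB (ifil_subgroup _) _ _ _ _.
      by apply: ifilW my; exact: leq_maxl.
    by apply: ifilW pz; exact: leq_maxr.
  by split; eexists; [apply: ifil_Ml my | apply: ifil_Mr my]; exact: tfil_dbound.
have [gP mP] := ideal_gen_ideal P.
move: x; apply: span_min => // _ [i [j [a [p [b [_ _ Pp _ ->]]]]]].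
have Ip : ideal_gen P p by move=> K [_]; exact.
by case: (mP b (a * p)) => //; case: (mP a p).
Qed.

(** [ifil n.-1 + V ifil n.-1]: all of [ifil n] except the summand [P V^(n - N)]. *)
Definition left_ifil n : set T :=
  span (ifil n.-1 `|` [set tvec v * z | v in setT & z in ifil n.-1]).

Lemma left_ifil_subgroup n : subgroup (left_ifil n). Proof. exact: span_subgroup. Qed.
Lemma left_ifil_sub n : ifil n.-1 `<=` left_ifil n.
Proof. by move=> x xn; apply: sub_span; left. Qed.
Lemma left_ifil_tvec n v z : ifil n.-1 z -> left_ifil n (tvec v * z).
Proof. by move=> zn; apply: sub_span; right; exists v => //; exists z. Qed.
Lemma left_ifil_tgrS i n b z : tgr i.+1 b -> ifil n z -> left_ifil (i + n).+1 (b * z).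
Proof.
move=> bi zn; have mB : zmod_morphism (fun b : T => b * z) by move=> u v; rewrite mulrBl.
apply: (span_morph mB (left_ifil_subgroup _) _ (tgrS bi)) => _ [v _ [y yi <-]].
by rewrite -mulrA; apply: left_ifil_tvec; apply: ifil_Ml => //; exact: tgr_tfil.
Qed.
Lemma left_ifil_Mr n m b z : (0 < n)%N -> tgr m b -> left_ifil n z -> left_ifil (n + m)%N (z * b).
Proof.
case: n => // n _ bm; move: z.
have mB : zmod_morphism (fun z : T => z * b) by move=> u v; rewrite mulrBl.
have bf := tgr_tfil bm.
apply: (span_morph mB (left_ifil_subgroup _)) => x [xn|[v _ [y yn <-]]].
  by apply: left_ifil_sub; exact: ifil_Mr.
by rewrite -mulrA; apply: left_ifil_tvec; exact: ifil_Mr.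
Qed.

Definition rel_tail j : set T := [set p * b | p in P & b in tgr j].

Lemma ifil_decomp j x : ifil (N + j) x ->
  exists y z, [/\ span (rel_tail j) y, left_ifil (N + j) z & x = y + z].
Proof.
suff : ifil (N + j) `<=` span (rel_tail j `|` left_ifil (N + j)).
  move=> h /h/span_setU[y [z [Sy Sz ->]]]; exists y, z; split=> //.
  by move: Sz; rewrite span_id //; exact: left_ifil_subgroup.
apply: span_min; first exact: span_subgroup.
move=> _ [i [j' [a [p [b [ijn ai Pp bj ->]]]]]]; apply: sub_span.
move: ijn; rewrite leq_eqVlt => /predU1P[ijn|ijn]; last first.
  right; apply: left_ifil_sub; apply: sub_span; exists i, j', a, p, b; split=> //.
case: i => [|i] in ijn ai *.
  have [c ->] := tgr0 ai; left; exists (tscalar V c * p).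
    by case: (bP.2 c p Pp).
  by exists b => //; move: ijn => /eqP; rewrite add0n eqn_add2l => /eqP <-.
right; rewrite -ijn addSn addSn -addnA -mulrA; apply: left_ifil_tgrS => //.
by apply: ifil_Mr; [exact: tgr_tfil | exact: ifil_gen].
Qed.

(** * Lifting relations from P (x)_k A to T(V) *)

Local Notation qsc := (qsc N' P).
Local Notation raP := (@raP k V P).
Local Notation X1 := (ext qsc (@ract k V)).
Local Notation X2 := (ext qsc raP).
Local Notation lead := (lead N' P).
Local Notation m2 := (mu2 (raM := raP) (@relmap k V N' P)).

(** Let w in J j have the same degree j component as y, and let r be the top component of p. Then p
    y_j = p (y_j - w) + (p - r) w + r w: the first two terms have lost one degree and lie in J
    (N+j-1), and r w lies in V J (N+j-1). *)
Lemma rel_tail_ideal j p y : P p -> I y -> left_ifil (N + j) (p * hcomp j y).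
Proof.
move=> Pp Iy; have gL := left_ifil_subgroup (N + j).
have [w wv wy] := ifil_lift j Iy.
have -> : p * hcomp j y = p * (hcomp j w - w) + ((p - hcomp N p) * w + hcomp N p * w).
  by rewrite wy -mulrDl subrK mulrBr subrK.
apply: (subgroupD gL); last apply: (subgroupD gL).
- case: j w wv wy gL => [|j] w wv wy gL.
    have := ifil_lt (ltn0Sn N') wv => ->.
    by rewrite (zmorph0 (@hcompB _ _ _)) subrr mulr0; exact: subgroup0 gL.
  apply: left_ifil_sub; rewrite addnS; apply: ifil_Mr; last exact: ifil_gen.
  apply: tfil_cancel; [exact: tgr_tfil (tgr_hcomp _ _) | exact: ifil_tfil |].
  exact: hcomp_tgr (tgr_hcomp _ _).
- apply: left_ifil_sub; apply: ifil_Ml wv.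
  apply: tfil_cancel; [exact: PN | exact: tgr_tfil (tgr_hcomp _ _) |].
  exact/esym/hcomp_tgr/tgr_hcomp.
- exact: (left_ifil_tgrS (tgr_hcomp _ _) wv).
Qed.

(** The tensor [p (x) a] stands for [r (x) a], [r] the top component of [p], and
    goes to [p a_j]; this is well defined only modulo [left_ifil] because [a_j]
    must be lifted to T(V). *)
Definition rel_lift j : X2 -> zquot (left_ifil (N + j)) :=
  tlift (fun (p : subz P) (a : A) =>
    zpi (left_ifil (N + j)) (subz_val p * hcomp j (qrepr a))).

Lemma zpi_rel_tail j (p : subz P) y :
  zpi (left_ifil (N + j)) (subz_val p * hcomp j (qrepr (pi y))) =
  zpi (left_ifil (N + j)) (subz_val p * hcomp j y).
Proof.
apply/zpi_eq; apply: sub_span; rewrite -mulrBr -hcompB; apply: rel_tail_ideal.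
  exact: subzP.
by apply/qpi_eq; rewrite qreprK.
Qed.

Lemma rel_lift_bal j : balanced raP (lscal qsc) (fun (p : subz P) (a : A) =>
    zpi (left_ifil (N + j)) (subz_val p * hcomp j (qrepr a))).
Proof.
split=> [p q a|p a b|p c a].
- by rewrite (zmorphD (@subz_valB _ _)) mulrDl raddfD.
- rewrite -[a]qreprK -[b]qreprK -raddfD !zpi_rel_tail.
  by rewrite (zmorphD (@hcompB _ _ _)) mulrDr raddfD.
- rewrite -[a]qreprK /lscal /qsc -rmorphM !zpi_rel_tail (raPE bP) -mulrA.
  by congr (zpi _ (_ * _)); rewrite -[j in RHS]add0n (hcompMl _ _ (tgr_tscalar V c)).
Qed.
Lemma rel_liftB j : zmod_morphism (rel_lift j).
Proof. exact: tlift_zmod_morphism (rel_lift_bal j). Qed.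
Lemma rel_liftE j (p : subz P) y :
  rel_lift j (etens qsc raP p (pi y)) = zpi (left_ifil (N + j)) (subz_val p * hcomp j y).
Proof. by rewrite [LHS](tliftE (rel_lift_bal j)) zpi_rel_tail. Qed.

Definition qproj j (a : A) : A := pi (hcomp j (qrepr a)).
Lemma qprojE j y : qproj j (pi y) = pi (hcomp j y).
Proof.
apply/qpi_eq; rewrite -hcompB; apply: (ideal_hcomp j _).
by apply/qpi_eq; rewrite qreprK.
Qed.
Lemma qprojB j : zmod_morphism (qproj j).
Proof.
move=> a b; rewrite -[a]qreprK -[b]qreprK -raddfB !qprojE hcompB.
exact: (raddfB pi).
Qed.
Lemma qprojZ j c a : qproj j (lscal qsc c a) = lscal qsc c (qproj j a).
Proof.
rewrite -[a]qreprK /lscal /qsc -rmorphM !qprojE -rmorphM; congr (pi _).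
exact: hcompMl _ _ (tgr_tscalar V c).
Qed.

Section Components.
Variables (M : zmodType) (ra : M -> k -> M).
Definition ext_proj j : ext qsc ra -> ext qsc ra :=
  tmap ra (lscal qsc) ra (lscal qsc) id (qproj j).
Lemma ext_projE j m a : ext_proj j (etens qsc ra m a) = etens qsc ra m (qproj j a).
Proof. by apply: tmapE => //; [exact: qprojB | exact: qprojZ]. Qed.
Lemma ext_projB j : zmod_morphism (ext_proj j).
Proof. by apply: tmapB => //; [exact: qprojB | exact: qprojZ]. Qed.
Lemma ext_proj_span j d :
  span [set etens qsc ra m a | m in setT & a in qgr R j] (ext_proj j d).
Proof.
elim/ext_ind: d => [m a|s t IHs IHt]; last first.
  by rewrite ext_projB; exact: subgroupB (span_subgroup _) _ _ IHs IHt.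
apply: sub_span; exists m => //; exists (qproj j a); last by rewrite [in RHS]ext_projE.
by exists (hcomp j (qrepr a)) => //; exact: tgr_hcomp.
Qed.
End Components.
Arguments ext_proj_span {M ra} j d.

Lemma ext_proj_lead n j (x y : T) : tgr n.+1 x ->
  ext_proj (n + j) ((pi y : A^c) *: lead x) = (pi (hcomp j y) : A^c) *: lead x.
Proof.
move/tgrS; move: x; apply: span_elim.
- by rewrite (zmorph0 (@leadB _ _ _ _)) !scaler0 (zmorph0 (@ext_projB _ _ _)).
- by move=> x z xE zE; rewrite leadB !scalerBr ext_projB xE zE.
- move=> _ [v _ [z zn <-]]; rewrite lead_tvec !etensZ ext_projE -!rmorphM qprojE.
  by rewrite hcompMl.
Qed.

Let m2B := mu2B (@relmapB k V N' P) (@relmapr k V N' P bP).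
Let m2E := mu2E (@relmapB k V N' P) (@relmapr k V N' P bP).

(** A relation of degree N has A-degree N' = N - 1 in V (x) A, its first letter being split off;
    hence the shift. *)
Lemma ext_proj_mu2 j d : ext_proj (N' + j) (m2 d) = m2 (ext_proj j d).
Proof.
elim/ext_ind: d => [p a|s t IHs IHt].
  rewrite -[a]qreprK ext_projE qprojE !m2E; exact: (ext_proj_lead _ _ (tgr_hcomp _ _)).
by rewrite m2B !ext_projB m2B IHs IHt.
Qed.

Lemma rel_lift_ext_proj j d : rel_lift j (ext_proj j d) = rel_lift j d.
Proof.
elim/ext_ind: d => [p a|s t IHs IHt].
  by rewrite -[a]qreprK ext_projE qprojE !rel_liftE (hcomp_tgr (tgr_hcomp _ _)).
by rewrite ext_projB !rel_liftB IHs IHt.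
Qed.

Lemma rel_tail_lead j p b : P p -> tgr j b ->
  lead (hcomp (N + j) (p * b)) = (pi b : A^c) *: lead (hcomp N p).
Proof.
move=> Pp bj; rewrite hcompMr //; apply: leadM.
exact: (tgr_neq _ (tgr_hcomp N p)).
Qed.

(** A single z in P V^j carries both the value of the lift and, through its top component, the value
    of [mu2]; this ties syzygies to cancellation of top components. *)
Lemma rel_lift_repr j d : span [set etens qsc raP m a | m in setT & a in qgr R j] d ->
  exists z, [/\ span (rel_tail j) z, rel_lift j d = zpi (left_ifil (N + j)) z
    & lead (hcomp (N + j) z) = m2 d].
Proof.
move: d; apply: span_elim.
- exists 0; split; first exact: subgroup0 (span_subgroup _).
    by rewrite (zmorph0 (@rel_liftB j)) raddf0.
  by rewrite (zmorph0 (@hcompB _ _ _)) (zmorph0 m2B) (zmorph0 (@leadB _ _ _ _)).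
- move=> d d' [z [zr zE zl]] [z' [zr' zE' zl']]; exists (z - z'); split.
  + exact: subgroupB (span_subgroup _) _ _ zr zr'.
  + by rewrite rel_liftB zE zE' raddfB.
  + by rewrite hcompB leadB m2B zl zl'.
- move=> _ [p _ [_ [b bj <-] <-]]; exists (subz_val p * b); split.
  + by apply: sub_span; exists (subz_val p); [exact: subzP | exists b].
  + by rewrite rel_liftE (hcomp_tgr bj).
  + by rewrite (rel_tail_lead (subzP bP p) bj) m2E.
Qed.

Lemma rel_tail_repr j z : span (rel_tail j) z ->
  exists d, rel_lift j d = zpi (left_ifil (N + j)) z /\ lead (hcomp (N + j) z) = m2 d.
Proof.
move: z; apply: span_elim.
- exists 0; rewrite (zmorph0 (@rel_liftB j)) raddf0; split=> //.
  by rewrite (zmorph0 (@hcompB _ _ _)) (zmorph0 m2B) (zmorph0 (@leadB _ _ _ _)).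
- move=> z z' [d [dz dl]] [d' [dz' dl']]; exists (d - d').
  by rewrite rel_liftB dz dz' raddfB hcompB leadB m2B dl dl'.
- move=> _ [p Pp [b bj <-]]; exists (etens qsc raP (subP Pp) (pi b)).
  by rewrite rel_liftE (hcomp_tgr bj) rel_tail_lead // m2E /relmap subPE.
Qed.

(** The inverse map v (x) a |-> v a is well defined modulo V I, since two lifts of a differ by an
    element of I. *)
Lemma lead_ker (x : T) : x 0%N = 0 -> lead x = 0 ->
  span [set tvec v * z | v in setT & z in I] x.
Proof.
set S := [set _ | _ in _ & _ in _] => x0 lx.
pose f v (a : A) := zpi S (tvec v * qrepr a).
have fE v y : f v (pi y) = zpi S (tvec v * y).
  apply/zpi_eq; rewrite -mulrBr; apply: sub_span; exists v => //.
  by exists (qrepr (pi y) - y) => //; apply/qpi_eq; rewrite qreprK.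
have bal : balanced (@ract k V) (lscal qsc) f.
  split=> [v v' a|v a b|v c a].
  - by rewrite /f (zmorphD (@tvecB _ _)) mulrDl raddfD.
  - rewrite -[a]qreprK -[b]qreprK -raddfD !fE mulrDr; exact: raddfD.
  - by rewrite -[a]qreprK /lscal /qsc -rmorphM !fE tvec_ract mulrA.
apply/zpi_eq0; have -> : zpi S x = tlift f (lead x).
  move/aug_span: x0; move: x {lx}; apply: span_elim.
  - by rewrite (zmorph0 (@leadB _ _ _ _)) (zmorph0 (tlift_zmod_morphism bal)) raddf0.
  - by move=> x y xE yE; rewrite leadB (tlift_zmod_morphism bal) raddfB /= xE yE.
  - by move=> _ [v _ [y _ <-]]; rewrite lead_tvec (tliftE bal) fE.
by rewrite lx (zmorph0 (tlift_zmod_morphism bal)).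
Qed.

Lemma lead_ker_lift n (x : T) : x 0%N = 0 -> lead x = 0 ->
  exists2 z, span [set tvec v * y | v in setT & y in ifil n] z & hcomp n.+1 z = hcomp n.+1 x.
Proof.
move=> x0 /(lead_ker x0); move: x {x0}; apply: span_elim.
- by exists 0; first exact: subgroup0 (span_subgroup _).
- move=> x y [z zs zE] [w ws wE]; exists (z - w).
    exact: subgroupB (span_subgroup _) _ _ zs ws.
  by rewrite !hcompB zE wE.
- move=> _ [v _ [y Iy <-]]; have [w wv wy] := ifil_lift n Iy.
  exists (tvec v * w); first by apply: sub_span; exists v => //; exists w.
  by rewrite -add1n !hcompMl ?wy //; exact: tgr_tvec.
Qed.

(** For a syzygy, the top component of z in P V^j lies in V I(R), so an element z' of V J (N'+j) has
    the same one. The difference z - z' drops in filtration degree, and the two conditions on P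
    speak about exactly this difference for j = 0 and j = 1. *)
Lemma syz_repr j d : m2 d = 0 -> exists z z',
  [/\ span (rel_tail j) z, rel_lift j d = zpi (left_ifil (N + j)) z,
      span [set tvec v * y | v in setT & y in ifil (N' + j)] z'
    & hcomp (N + j) z' = hcomp (N + j) z].
Proof.
move=> d0; have [z [zr zE zl]] := rel_lift_repr (ext_proj_span j d).
have [||z' z's z'E] := @lead_ker_lift (N' + j) (hcomp (N + j) z).
- exact: (tgr_neq _ (tgr_hcomp (N + j) z)).
- by rewrite zl -ext_proj_mu2 d0 (zmorph0 (@ext_projB _ _ _)).
exists z, z'; split=> //; first by rewrite -rel_lift_ext_proj.
by rewrite z'E (hcomp_tgr (tgr_hcomp _ _)).
Qed.

(** * Vanishing of the lift on syzygies *)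

Hypothesis P0 : P `&` tfil N' = [set 0].
Hypothesis PV : set_add (set_mul P (tgr 1)) (set_mul (tgr 1) P) `&` tfil N `<=` P.

Lemma rel_tail_tfil j z : span (rel_tail j) z -> tfil (N + j) z.
Proof.
move: z; apply: span_min; first exact: tfil_subgroup.
move=> _ [p Pp [b bj <-]]; apply: tfilM; [exact: PN | exact: tgr_tfil].
Qed.

(** Here J N' = 0, so z' = 0 and z is an element of P without top component. *)
Lemma rel_lift_syz0 d : m2 d = 0 -> rel_lift 0 d = 0.
Proof.
move=> /(syz_repr 0)[z [z' [zr -> z's z'E]]].
have z'0 : z' = 0.
  move: z' z's {z'E}; apply: span_min; first exact: subgroup_set0.
  move=> _ [v _ [y yv <-]]; have : (N' + 0 < N)%N by rewrite addn0.
  by move=> /ifil_lt/(_ yv) ->; rewrite mulr0.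
have Pz : P z.
  move: z zr {z'E}; apply: span_min; first exact: bP.1.
  move=> _ [p Pp [b /tgr0[c ->] <-]]; by case: (bP.2 c p Pp).
have : (P `&` tfil N') z.
  split=> //; rewrite -[z]subr0; apply: tfil_cancel; [exact: PN | by [] |].
  by rewrite -[N]addn0 -z'E z'0.
by rewrite P0 => ->; rewrite raddf0.
Qed.

(** Here J N = P, so z - z' lies in PV + VP and in F^N, hence in P; what remains, z' in V J N,
    vanishes modulo [left_ifil]. *)
Lemma rel_lift_syz1 d : m2 d = 0 -> rel_lift 1 d = 0.
Proof.
move=> /(syz_repr 1)[z [z' [zr -> z's z'E]]]; apply/zpi_eq0.
rewrite span_id; last exact: left_ifil_subgroup.
have gL := left_ifil_subgroup (N + 1).
have z'f : tfil (N + 1) z'.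
  move: z' z's {z'E}; apply: span_min; first exact: tfil_subgroup.
  move=> _ [v _ [y yv <-]]; rewrite addn1 -add1n; apply: tfilM.
    exact: tgr_tfil (tgr_tvec v).
  by apply: ifil_tfil; rewrite -addn1.
have zf := rel_tail_tfil zr.
rewrite addn1 in zf z'f z'E.
have Pzz : P (z - z').
  apply: PV; split; last exact: tfil_cancel.
  exists z; first exact: zr.
  exists (- z') => //; apply: (subgroupN (span_subgroup _)).
  apply: spanS z's => _ [v _ [y yv <-]]; exists (tvec v); first exact: tgr_tvec.
  by exists y => //; apply: ifil_N; rewrite -addn1.
rewrite -[z](subrK z'); apply: (subgroupD gL).
  by apply: left_ifil_sub; rewrite addn1; exact: ifil_gen.
apply: (span_min gL _ z's) => _ [v _ [y yv <-]]; apply: left_ifil_tvec.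
by rewrite addSn.
Qed.

(** If z represents the lift of x, then z b represents that of x b, and [left_ifil] is stable under
    right multiplication by homogeneous elements. *)
Lemma rel_lift_scale l i b x : tgr l b -> rel_lift i x = 0 ->
  rel_lift (i + l) ((pi b : A^c) *: x) = 0.
Proof.
move=> bl; have [z [-> ->]] : exists z, rel_lift i x = zpi (left_ifil (N + i)) z /\
    rel_lift (i + l) ((pi b : A^c) *: x) = zpi (left_ifil (N + (i + l))) (z * b).
  elim/ext_ind: x => [p a|s t [z [zi zl]] [w [wi wl]]].
    exists (subz_val p * hcomp i (qrepr a)); split.
      by rewrite -{1}[a]qreprK rel_liftE.
    by rewrite etensZ -{1}[a]qreprK -rmorphM rel_liftE hcompMr // mulrA.
  by exists (z - w); rewrite scalerBr !rel_liftB mulrBl !raddfB /= zi zl wi wl.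
move/zpi_eq0; rewrite span_id; last exact: left_ifil_subgroup.
move=> zi; apply/zpi_eq0; apply: sub_span; rewrite addnA.
exact: left_ifil_Mr.
Qed.

Lemma rel_lift_scale_lt l j b x : tgr l b -> (j < l)%N -> rel_lift j ((pi b : A^c) *: x) = 0.
Proof.
move=> bl jl; elim/ext_ind: x => [p a|s t IHs IHt].
  by rewrite etensZ -{1}[a]qreprK -rmorphM rel_liftE (hcompMr_lt _ jl bl) mulr0 raddf0.
by rewrite scalerBr rel_liftB IHs IHt subrr.
Qed.

Variable Q : graded_flat_resolution (qgr R) (qaug R).
Hypothesis torQ : Tor_concentrated Q 3 N.+1.

Lemma rel_lift_syz j d : m2 d = 0 -> rel_lift j d = 0.
Proof.
elim/ltn_ind: j d => -[_|[_|j IH]] d d0; [exact: rel_lift_syz0 | exact: rel_lift_syz1 |].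
rewrite -rel_lift_ext_proj.
have e0 : m2 (ext_proj j.+2 d) = 0.
  by rewrite -ext_proj_mu2 d0 (zmorph0 (@ext_projB _ _ _)).
have := syz_generated bP (Q := Q) (j := j.+2) _ _ (ext_proj_span j.+2 d) e0.
(* The relevant degree of Tor_3 is N + j + 2, which is never N + 1. *)
have T0 : forall c : Tor Q 3 (N' + j.+2).+1, c = 0.
  by apply: torQ; rewrite !addnS => -[] /eqP; rewrite -{2}[N']addn0 -addnS eqn_add2l.
have j0 : j.+2 <> 0%N by [].
move=> /(_ j0 T0).
apply: (span_morph (@rel_liftB j.+2) (subgroup_set0 _)) => _ [x x0 [a a0 <-]].
rewrite -[a]qreprK in a0 *; move: a0; rewrite /mkset eps_qpi => /aug_span.
have pB : zmod_morphism (fun y : T => rel_lift j.+2 ((pi y : A^c) *: x)).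
  by move=> u w; rewrite raddfB -rel_liftB; congr (rel_lift _ _); exact: (scalerBl (_ : A^c)).
apply: (span_morph pB (subgroup_set0 _)) => _ [v _ [y _ <-]].
move: y; apply: hcomp_ind => [|l y yl].
  pose f (y : T) := rel_lift j.+2 ((pi (tvec v * y) : A^c) *: x).
  apply: (preim_subgroup (f := f) _ (subgroup_set0 _)).
  by move=> u w; rewrite /f mulrBr; exact: (pB (tvec v * u) (tvec v * w)).
have vyl := tgrM (tgr_tvec v) yl.
(* Although x is not homogeneous, the lift of x (v y) at index j + 2 depends only on the lift of x
   at index j + 2 - (1 + l), and is 0 if 1 + l exceeds j + 2. The letter v keeps 1 + l positive, so
   the index drops. *)
have [jl|lj] := ltnP j.+2 (1 + l); first exact: rel_lift_scale_lt vyl jl.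
rewrite /mkset -(subnK lj); apply: rel_lift_scale => //; apply: IH => //.
by rewrite ltn_subrL.
Qed.

(** * Cancellation in the filtration of I(P) *)

Hypothesis vk : von_neumann_regular k.

Lemma ifil_tvec n v z : ifil n z -> ifil n.+1 (tvec v * z).
Proof. by rewrite -add1n; apply: ifil_Ml; exact: tgr_tfil (tgr_tvec v). Qed.

Lemma span_tvec_seq n x : span [set tvec v * y | v in setT & y in ifil n] x ->
  exists2 s : seq (V * T), forall z, z \in s -> ifil n z.2 &
    x = \sum_(z <- s) tvec z.1 * z.2.
Proof.
move: x; apply: span_elim.
- by exists [::]; rewrite ?big_nil.
- move=> _ _ [s sn ->] [t tn ->]; exists (s ++ [seq (z.1, - z.2) | z <- t]).
    move=> z; rewrite mem_cat => /orP[/sn //|/mapP[w /tn wn ->]].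
    by have := subgroupN (ifil_subgroup n) wn.
  rewrite big_cat big_map /=; congr (_ + _); rewrite -sumrN.
  by apply: eq_bigr => z _; rewrite mulrN.
- move=> _ [v _ [y yn <-]]; exists [:: (v, y)]; last by rewrite big_seq1.
  by move=> z; rewrite inE => /eqP ->.
Qed.

(** Write x as a sum of v z. The top components of the z lie in F, the degree n + 1 part of I(R),
    and the sum of v (x) z_(n+1) vanishes in V (x) V^(n+1); by flatness it vanishes already in V (x)
    F. The map v (x) w |-> v l(w), with l(w) in J (n+1) a lift of w, recovers x modulo J (n+1). It
    is well defined because two lifts differ by an element of J (n+1) in F^n, which is in J n by the
    hypothesis, and V J n is contained in J (n+1). *)
Lemma span_tvec_cancel n x :
  (forall z, ifil n.+1 z -> tfil n z -> ifil n z) ->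
  span [set tvec v * y | v in setT & y in ifil n.+1] x -> tfil n.+1 x -> ifil n.+1 x.
Proof.
move=> W /span_tvec_seq[s sn xE] xf.
pose F := [set w : tpow V n.+1 | I (@dinj (tensor_graded V) n.+1 w)].
have sF : submodule F.
  split; first exact: preim_subgroup (@dinjB (tensor_graded V) n.+1) _ (@ideal_gen_subgroup T R).
  by move=> c w Fw; rewrite /F /mkset -tscalar_inj; exact: ideal_genMl.
have /choice[l lP] : forall w : tpow V n.+1, exists y : T,
    F w -> ifil n.+1 y /\ y n.+1 = w.
  move=> w; have [Fw|nF] := pselect (F w); last by exists 0.
  have [y yn yw] := ifil_lift n.+1 Fw; exists y => _; split=> //.
  by rewrite -[LHS]hcomp_comp yw hcomp_comp dinj_id.
have lW w y : F w -> ifil n.+1 y -> y n.+1 = w -> forall v, ifil n.+1 (tvec v * l w - tvec v * y).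
  move=> /lP[ln lw] yn yw v; rewrite -mulrBr; apply: ifil_tvec; apply: W.
    exact: subgroupB (ifil_subgroup _) _ _ ln yn.
  by apply: tfil_cancel; [exact: ifil_tfil | exact: ifil_tfil | rewrite /hcomp lw yw].
pose f (v : V) (w : tpow V n.+1) := zpi (ifil n.+1) (tvec v * l w).
have bf : balanced_on F f.
  split=> [v v' w Fw|v w w' Fw Fw'|v c w Fw].
  - by rewrite /f -raddfD (zmorphD (@tvecB _ _)) mulrDl.
  - rewrite /f -raddfD -mulrDr; apply/zpi_eq; apply: sub_span.
    have [[lw wE] [lw' wE']] := (lP _ Fw, lP _ Fw').
    apply: lW; [exact: subgroupD sF.1 _ _ Fw Fw' | exact: subgroupD (ifil_subgroup _) _ _ lw lw' |].
    by rewrite dcompD wE wE'.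
  - rewrite /f tvec_ract -mulrA; apply/esym/zpi_eq; apply: sub_span.
    have [lw wE] := lP _ Fw; apply: lW; first exact: sF.2.
      by rewrite -[n.+1]add0n; apply: ifil_Ml lw; exact: tgr_tfil (tgr_tscalar V c).
    have := @hcompMl _ _ n.+1 0 (tscalar V c) (l w) (tgr_tscalar V c).
    rewrite /hcomp wE tscalar_inj => /(congr1 (fun x : T => x n.+1)).
    by rewrite !dinj_id.
have := @regular_flat k vk V (tpow V n.+1) F _ f [seq (z.1, (z.2 : T) n.+1) | z <- s] sF bf.
rewrite !big_map /= => h; have {h} : \sum_(z <- s) f z.1 ((z.2 : T) n.+1) = 0.
  apply: h => [_ /mapP[z /sn zn ->]|]; first exact: ifil_top zn.
  have := xf n.+2 (leqnn _); rewrite -[x _]hcomp_comp xE.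
  rewrite (zmorph_sum (@hcompB _ _ _)).
  rewrite dcomp_sum => h; apply: etrans h; apply: eq_bigr => z _.
  by rewrite hcomp_tvec dinj_id.
move=> f0; have := ifil_subgroup n.+1; rewrite -{2}(span_id (ifil_subgroup n.+1)) => _.
suff : zpi (ifil n.+1) x = 0 by move/zpi_eq0; rewrite span_id //; exact: ifil_subgroup.
rewrite -f0 xE raddf_sum !big_seq; apply: eq_bigr => z /sn zn.
apply/esym/zpi_eq; apply: sub_span; apply: lW => //; exact: ifil_top zn.
Qed.

Lemma ifil_cancel n x : ifil n.+1 x -> tfil n x -> ifil n x.
Proof.
elim: n x => [|n IH] x xv xf.
  (* J 1 = 0 because N >= 2. *)
  by rewrite (ifil_lt _ xv) //; exact: subgroup0 (ifil_subgroup _).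
have [nN|Nn] := ltnP n.+2 N.
  by rewrite (ifil_lt nN xv); exact: subgroup0 (ifil_subgroup _).
move: xv; rewrite -(subnKC Nn); set j := (n.+2 - N)%N => /ifil_decomp[y [z [yr zl xE]]].
have nE : (N + j = n.+2)%N by rewrite subnKC.
have [d [dy yl]] := rel_tail_repr yr.
have zE : exists u w, [/\ ifil n.+1 u,
    span [set tvec v * t | v in setT & t in ifil n.+1] w & z = u + w].
  move: zl; rewrite /left_ifil nE => /span_setU[u [w [un wn ->]]]; exists u, w.
  by split=> //; rewrite -(span_id (ifil_subgroup n.+1)).
(* The top components of y and z cancel. That of z comes from V J (n+1), so it lies in V I(R) and is
   killed by [lead]; hence d is a syzygy. *)
have d0 : m2 d = 0.
  have : hcomp n.+2 x = 0 by rewrite /hcomp xf // raddf0.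
  rewrite xE (zmorphD (@hcompB _ _ _)) => /eqP; rewrite addr_eq0 => /eqP yz.
  rewrite -yl nE yz (zmorphN (@leadB _ _ _ _)).
  have [u [w [un ws ->]]] := zE; rewrite (zmorphD (@hcompB _ _ _)).
  have -> : hcomp n.+2 u = 0 by rewrite /hcomp (ifil_tfil un) // raddf0.
  rewrite add0r; apply/eqP; rewrite oppr_eq0; apply/eqP.
  have lB : zmod_morphism (fun w : T => lead (hcomp n.+2 w)).
    by move=> a b; rewrite hcompB leadB.
  apply: (span_morph lB (subgroup_set0 _) _ ws) => _ [v _ [t tn <-]].
  have -> : hcomp n.+2 (tvec v * t) = tvec v * hcomp n.+1 t := hcompMl n.+1 t (tgr_tvec v).
  rewrite /mkset lead_tvec.
  by rewrite (iffRL (qpi_eq0 _) (ifil_top tn)); exact: tens0r.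
have yl' : left_ifil (N + j) y.
  have : zpi (left_ifil (N + j)) y = 0 by rewrite -dy rel_lift_syz.
  by move/zpi_eq0; rewrite span_id //; exact: left_ifil_subgroup.
have : left_ifil (N + j) x by rewrite xE; exact: subgroupD (left_ifil_subgroup _) _ _ yl' zl.
rewrite /left_ifil nE => /span_setU[u [w [un ws xE']]].
rewrite span_id in un; last exact: ifil_subgroup.
(* Both x and u have filtration degree at most n + 1, hence so has w, and the induction hypothesis
   applies behind its first letter. *)
have wn : ifil n.+1 w.
  apply: (span_tvec_cancel IH ws); have -> : w = x - u by rewrite xE' addrC addKr.
  exact: tfilB xf (ifil_tfil un).
by rewrite xE'; exact: (subgroupD (ifil_subgroup n.+1) un wn).
Qed.

Lemma ideal_tfil n x : ideal_gen P x -> tfil n x -> ifil n x.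
Proof.
move=> /ideal_gen_ifil[m xm] xn; have [mn|nm] := leqP m n; first exact: ifilW xm.
elim: m nm xm => // m IH; rewrite ltnS leq_eqVlt => /predU1P[nm|nm] xm.
  by rewrite -nm in xm; exact: ifil_cancel xm xn.
exact: IH nm (ifil_cancel xm (tfilW (ltnW nm) xn)).
Qed.
End Filtration.

(** * The morphism A -> gr(U) *)

Section NaturalMorphism.
Variables (k : pzRingType) (V : bimodType k) (N' : nat) (P : set (tensor_ring V)).
Local Notation T := (tensor_ring V).
Local Notation N := N'.+1.
Local Notation R := (top_part N P).
Local Notation inj n := (@dinj (tensor_graded V) n).
Local Notation U := (qring P).
Local Notation F := (qfil P).
Local Notation gU := (gr_ring F).
Local Notation gcl := (gr_class F).

Hypothesis PN : P `<=` tfil N.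

Lemma qfil_tgr n x : tgr n x -> F n (qpi P x).
Proof. by move=> xn; exists x => //; exact: tgr_tfil. Qed.
Lemma qfil_inj n (w : tpow V n) : F n (qpi P (inj n w)).
Proof. by apply: qfil_tgr; exists w. Qed.

Definition gr_map_comp n (w : tpow V n) : gU :=
  @dinj (assoc_graded F) n (gcl n (qpi P (inj n w))).
Definition gr_map : T -> gU := dlift gr_map_comp.

Lemma gr_map_compB n : zmod_morphism (@gr_map_comp n).
Proof.
move=> u w; rewrite /gr_map_comp dinjB raddfB.
by rewrite (gr_classB (qfil_inj u) (qfil_inj w)); exact: dinjB.
Qed.

Lemma gr_mapB : zmod_morphism gr_map. Proof. exact: dliftB gr_map_compB. Qed.

Lemma gr_map_tgr n x : tgr n x ->
  gr_map x = @dinj (assoc_graded F) n (gcl n (qpi P x)).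
Proof. by case=> w _ <-; exact: (@dlift_inj (tensor_graded V) gU gr_map_comp gr_map_compB n w). Qed.

Lemma gr_map_comp_hcomp x n : gr_map x n = gcl n (qpi P (hcomp n x)).
Proof.
move: x; apply: hcomp_ind => [|m x xm].
  split=> [|x y /= xE yE].
    rewrite (zmorph0 gr_mapB) (zmorph0 (@hcompB _ _ _)) raddf0; apply/esym.
    have F0 := subgroup0 (fil_subgroup F n).
    by have := gr_classB F0 F0; rewrite !subrr.
  rewrite gr_mapB hcompB raddfB gr_classB; try exact: qfil_tgr (tgr_hcomp _ _).
  by rewrite -xE -yE.
rewrite /mkset (gr_map_tgr xm); have [<-|mn] := eqVneq m n.
  by rewrite (hcomp_tgr xm); exact: dinj_id.
rewrite (hcomp_neq mn xm) raddf0; apply: etrans (dinj_neq _ mn) _.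
have F0 := subgroup0 (fil_subgroup F n).
by have := gr_classB F0 F0; rewrite !subrr.
Qed.

Lemma gr_mapM x y : gr_map (x * y) = gr_map x * gr_map y.
Proof.
move: x; apply: hcomp_ind => [|m x xm].
  split=> [|x z /= xE zE]; first by rewrite mul0r !(zmorph0 gr_mapB) mul0r.
  by rewrite mulrBl !gr_mapB mulrBl xE zE.
rewrite /mkset; move: y; apply: hcomp_ind => [|n y yn].
  split=> [|y z /= yE zE]; first by rewrite mulr0 !(zmorph0 gr_mapB) mulr0.
  by rewrite mulrBr !gr_mapB mulrBr yE zE.
rewrite /mkset (gr_map_tgr (tgrM xm yn)) (gr_map_tgr xm) (gr_map_tgr yn).
apply: esym; apply: etrans (@mul_dinj (assoc_graded F) _ _ _ _) _.
congr (dinj _); rewrite rmorphM; exact: gr_class_mul (qfil_tgr xm) (qfil_tgr yn).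
Qed.

Lemma gr_map1 : gr_map 1 = 1.
Proof.
rewrite -(tscalar1 V) (gr_map_tgr (tgr_tscalar V 1)) tscalar1 rmorph1.
by rewrite (total1E (assoc_graded F)).
Qed.

(** The top component r of p in P equals r - p modulo I(P), and r - p has degree below N, so r has
    class 0 in degree N of gr(U). *)
Lemma gr_map_ideal x : ideal_gen R x -> gr_map x = 0.
Proof.
pose K := [set x | gr_map x = 0].
suff KI : ideal K /\ R `<=` K by move/(_ K KI).
split; last first.
  move=> _ [p Pp <-]; rewrite /K /mkset (gr_map_tgr (tgr_hcomp N p)).
  rewrite -[RHS](raddf0 (@dinj (assoc_graded F) N)); congr (dinj _).
  have F0 := subgroup0 (fil_subgroup F N).
  have -> : 0 = gcl N 0 by have := gr_classB F0 F0; rewrite !subrr.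
  apply/gr_class_eq => //; first exact: qfil_tgr (tgr_hcomp _ _).
  exists (hcomp N p - p); last first.
    rewrite raddfB; congr (_ - _); apply/qpi_eq0; exact: sub_ideal_gen.
  apply: tfil_cancel; [exact: tgr_tfil (tgr_hcomp _ _) | exact: PN |].
  exact: hcomp_tgr (tgr_hcomp _ _).
split; first exact: preim_subgroup gr_mapB _ (subgroup_set0 _).
by move=> a y; rewrite /K /mkset !gr_mapM => ->; rewrite mulr0 mul0r.
Qed.

Definition nat_map (a : qring R) : gU := gr_map (qrepr a).

Lemma nat_mapE x : nat_map (qpi R x) = gr_map x.
Proof.
apply/eqP; rewrite -subr_eq0 -gr_mapB; apply/eqP/gr_map_ideal.
by apply/qpi_eq; rewrite qreprK.
Qed.
Fact nat_mapB : zmod_morphism nat_map.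
Proof.
by move=> a b; rewrite -[a]qreprK -[b]qreprK -raddfB !nat_mapE gr_mapB.
Qed.
Fact nat_map_monoid : monoid_morphism nat_map.
Proof.
split=> [|a b]; first by rewrite -(rmorph1 (qpi R)) nat_mapE gr_map1.
by rewrite -[a]qreprK -[b]qreprK -rmorphM !nat_mapE gr_mapM.
Qed.

Lemma nat_map_surj (y : gU) : exists a, nat_map a = y.
Proof.
elim/dsum_ind: y => [n c|y z [a ay] [b bz]]; last first.
  by exists (a + b); rewrite (zmorphD nat_mapB) ay bz.
have [x xn xc] := gr_reprP c; exists (qpi R (hcomp n x)).
rewrite nat_mapE (gr_map_tgr (tgr_hcomp n x)); congr (dinj _).
rewrite -[RHS]gr_reprK -xc.
apply/gr_class_eq; [exact: qfil_tgr (tgr_hcomp _ _) | by exists x |].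
(* In degree 0 the preceding filtration step is 0, so an equality is required instead of agreement
   up to lower order. *)
case: n c xc xn => [|n] c xc xn.
  rewrite /mkset -raddfB; have -> : hcomp 0 x - x = 0; last exact: raddf0.
  apply: dsumP => -[|m]; first by rewrite dcompB hcomp_comp subrr.
  by rewrite dcompB (tgr_neq _ (tgr_hcomp 0 x)) // xn // subr0.
exists (hcomp n.+1 x - x); last exact: raddfB.
apply: tfil_cancel => //; first exact: tgr_tfil (tgr_hcomp _ _).
exact: hcomp_tgr (tgr_hcomp _ _).
Qed.

Hypothesis PI : forall n x, ideal_gen P x -> tfil n x -> ifil N' P n x.

(** If x_n has class 0, then x_n - y lies in I(P) for some y of degree below n. By [PI] the
    difference lies in J n, whose top components belong to I(R), and its top component is x_n. *)
Lemma nat_map_inj : injective nat_map.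
Proof.
move=> a b ab; apply/eqP; rewrite -subr_eq0; apply/eqP.
have {ab} : nat_map (a - b) = 0 by rewrite nat_mapB ab subrr.
move: (a - b) => {a b} a; rewrite -[a]qreprK nat_mapE; move: (qrepr a) => x x0.
have xf : tfil (dbound x) x by exact: tfil_dbound.
apply/qpi_eq0; rewrite (tfil_sum xf).
apply: (subgroup_sum ideal_gen_subgroup) => n.
have F0 := subgroup0 (fil_subgroup F n).
have : gcl n (qpi P (hcomp n x)) = gcl n 0.
  rewrite -gr_map_comp_hcomp x0; apply/esym.
  by have := gr_classB F0 F0; rewrite !subrr.
move/gr_class_eq => /(_ (qfil_tgr (tgr_hcomp n x)) F0); rewrite subr0.
case: (nat_of_ord n) => [|m].
  move=> /qpi_eq0 x0P; rewrite (ifil_lt (ltn0Sn N') (PI x0P (tgr_tfil (tgr_hcomp 0 x)))).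
  exact: subgroup0 ideal_gen_subgroup.
case=> y ym yx; have xyP : ideal_gen P (hcomp m.+1 x - y) by apply/qpi_eq.
have yt : tfil m.+1 y by exact: tfilW (leqnSn m) ym.
have xyf : tfil m.+1 (hcomp m.+1 x - y) by exact: tfilB (tgr_tfil (tgr_hcomp m.+1 x)) yt.
have := ifil_top PN (PI xyP xyf).
rewrite hcompB (hcomp_tgr (tgr_hcomp _ _)).
by have -> : hcomp m.+1 y = 0; [rewrite /hcomp ym // raddf0 | rewrite subr0].
Qed.

Lemma PBW_of_ideal : PBW_property N P.
Proof.
pose phi : {rmorphism qring R -> gU} := HB.pack nat_map
  (GRing.isZmodMorphism.Build _ _ nat_map nat_mapB)
  (GRing.isMonoidMorphism.Build _ _ nat_map nat_map_monoid).
exists phi; split=> [n w|].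
  by rewrite [phi _]nat_mapE; apply: gr_map_tgr; exists w.
have /choice[g gK] := nat_map_surj.
by exists g => x; [apply: nat_map_inj; exact: gK | exact: gK].
Qed.
End NaturalMorphism.

Theorem theorem1p2 (k : pzRingType) (V : bimodType k) (N : nat)
    (P : set (tensor_ring V))
    (Q : graded_flat_resolution (qgr (top_part N P)) (qaug (top_part N P))) :
  von_neumann_regular k ->
  (2 <= N)%N ->
  subbimodule P ->
  P `<=` tfil N ->
  Tor_concentrated Q 3 N.+1 ->
  P `&` tfil N.-1 = [set 0] ->
  set_add (set_mul P (tgr 1)) (set_mul (tgr 1) P) `&` tfil N `<=` P ->
  PBW_property N P.
Proof.
case: N Q => // N' Q vk N'gt0 bP PN torQ P0 PV.
apply: PBW_of_ideal => // n x.
exact: (ideal_tfil N'gt0 bP PN P0 PV torQ vk).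
Qed.
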